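(* Let $\Omega$ be a bounded strictly pseudoconvex homogeneous complete circular domain with smooth boundary in $\mathbb C^n$. Then the corona theorem (i.e. the Corona Property) holds for $H^\infty(\Omega)$ if and only if the Convex Poisson Property holds for $A^2(\Omega)$.
   Context: Homogeneous: the group of holomorphic automorphisms of $\Omega$ acts transitively. Complete circular: $\lambda z\in\Omega$ whenever $z\in\Omega$, $\lambda\in\mathbb C$, $|\lambda|\le1$. $H^\infty(\Omega)$ is the algebra of bounded holomorphic functions on $\Omega$. $A^2(\Omega)$ is the Bergman space of holomorphic $f$ with $\|f\|^2=\int_\Omega|f|^2d\mu<\infty$, $\mu$ normalized Lebesgue measure on $\Omega$; $k_a$ is its reproducing kernel at $a\in\Omega$ and $\widetilde{k_a}=k_a/\sqrt{k_a(a)}$. For $M\ge1$, $\mathbf a=(a_1,\dots,a_M)\in\Omega^M$ and $\theta=(\theta_0,\dots,\theta_M)\in[0,1]^{M+1}$ with $\sum_m\theta_m=1$, put $$\|h\|_{\mathbf a,\theta}^2=\int_\Omega|h|^2\Big(\theta_0+\sum_{m=1}^M\theta_m|\widetilde{k_{a_m}}|^2\Big)d\mu .$$ Corona data: $N\ge1$, $c>0$, and $\varphi_1,\dots,\varphi_N\in H^\infty(\Omega)$ with $1\ge\max_\ell|\varphi_\ell(z)|^2\ge c^2>0$ for all $z\in\Omega$. Corona Property for $H^\infty(\Omega)$: for all corona data there are $C>0$ and $f_1,\dots,f_N\in H^\infty(\Omega)$ with $\max_\ell|f_\ell(z)|^2\le C^2$ and $\sum_\ell\varphi_\ell(z)f_\ell(z)=1$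 for all $z\in\Omega$. Convex Poisson Property for $A^2(\Omega)$: for all corona data there is $C>0$ such that for all $M\ge1$, all $\mathbf a=(a_1,\dots,a_M)\in\Omega^M$ and all $\theta=(\theta_0,\dots,\theta_M)\in[0,1]^{M+1}$ with $\sum_{m=0}^M\theta_m=1$ there are $f_1,\dots,f_N\in A^2(\Omega)$ with $\sum_\ell\|f_\ell\|_{\mathbf a,\theta}^2\le C^2$ and $\sum_\ell\varphi_\ell f_\ell=1$ on $\Omega$. *)

(* Defs.v *)
From HB Require Import structures.
From mathcomp Require Import all_boot all_order all_algebra.
From mathcomp Require Import complex.
From mathcomp Require Import all_classical all_reals all_analysis.

Set Implicit Arguments.
Unset Strict Implicit.
Unset Printing Implicit Defensive.

Import Order.TTheory GRing.Theory Num.Theory.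
Import numFieldNormedType.Exports.
Local Open Scope classical_set_scope.
Local Open Scope ring_scope.

(* The usual metric on R[i], with R[i] as a normed module over itself, so that
   'rV[R[i]]_n becomes a normed module over R[i] (sup norm) and [differentiable]
   means complex (Frechet) differentiable. *)
HB.instance Definition _ (R : rcfType) := PseudoPointedMetric.copy R[i] R[i]^o.
HB.instance Definition _ (R : rcfType) := GRing.ComAlgebra.copy R[i] R[i]^o.
HB.instance Definition _ (R : rcfType) := Vector.copy R[i] R[i]^o.
HB.instance Definition _ (R : rcfType) := NormedModule.copy R[i] R[i]^o.

Definition tuple_cons_pair (T : Type) (n : nat) (p : T * n.-tuple T) :
  n.+1.-tuple T := [the n.+1.-tuple T of p.1 :: p.2].

Lemma measurable_tuple_cons_pair d (T : measurableType d) n :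
  measurable_fun [set: (T * n.-tuple T)%type] (@tuple_cons_pair T n).
Proof. exact: measurable_cons. Qed.

Section product_cons.
Context d (T : measurableType d) (R : realType) (n : nat).
Variable m1 : {sigma_finite_measure set T -> \bar R}.
Variable m2 : {sigma_finite_measure set (n.-tuple T) -> \bar R}.

Definition product_cons : set (n.+1.-tuple T) -> \bar R :=
  pushforward (m1 \x m2)%E (@tuple_cons_pair T n).

Let product_cons0 : product_cons set0 = 0%E.
Proof. by rewrite /product_cons /pushforward preimage_set0 measure0. Qed.

Let product_cons_ge0 A : (0 <= product_cons A)%E.
Proof. exact: (measure_ge0 (m1 \x m2)%E (@tuple_cons_pair T n @^-1` A)). Qed.

Let product_cons_sigma_additive : semi_sigma_additive product_cons.
Proof.
move=> F mF tF mUF; rewrite /product_cons /pushforward preimage_bigcup.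
have mc := @measurable_tuple_cons_pair _ T n.
apply: measure_semi_sigma_additive.
- by move=> k; rewrite -[X in measurable X]setTI; exact: mc.
- apply/trivIsetP => /= i j _ _ ij; rewrite -preimage_setI.
  by move/trivIsetP : tF => /(_ _ _ _ _ ij) ->//; rewrite preimage_set0.
- by rewrite -preimage_bigcup -[X in measurable X]setTI; exact: mc.
Qed.

HB.instance Definition _ := isMeasure.Build _ _ _ product_cons
  product_cons0 product_cons_ge0 product_cons_sigma_additive.

Let product_cons_sigma_finite : sigma_finite setT product_cons.
Proof.
have /sigma_finiteP[F [TF ndF Foo]] := sigma_finiteT m1.
have /sigma_finiteP[G [TG ndG Goo]] := sigma_finiteT m2.
pose split_cons (t : n.+1.-tuple T) := (thead t, [tuple of behead t]).
have msplit : measurable_fun [set: n.+1.-tuple T] split_cons.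
  apply: measurable_fun_pair; last exact: measurable_behead.
  exact: measurable_tnth.
exists (fun k => split_cons @^-1` (F k `*` G k)).
  rewrite -preimage_bigcup (_ : \bigcup_k _ = setT) ?preimage_setT//.
  rewrite -subTset => -[x t] _.
  have : [set: T] x by []. have : [set: n.-tuple T] t by [].
  rewrite TF TG => -[k _ Gkt] [l _ Flx]; exists (maxn l k) => //; split => /=.
    by move: x Flx; exact/subsetPset/ndF/leq_maxl.
  by move: t Gkt; exact/subsetPset/ndG/leq_maxr.
move=> k; have [mF Fk] := Foo k; have [mG Gk] := Goo k; split.
  by rewrite -[X in measurable X]setTI; apply: msplit => //; exact: measurableX.
rewrite /product_cons /pushforward -comp_preimage.
rewrite (_ : split_cons \o _ = id); last first.
  by apply/funext => -[x t]; rewrite /split_cons /=; congr pair; exact/val_inj.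
by rewrite product_measure1E// lte_mul_pinfty// ge0_fin_numE.
Qed.

HB.instance Definition _ := Measure_isSigmaFinite.Build _ _ _ product_cons
  product_cons_sigma_finite.

End product_cons.

Fixpoint tuple_measure d (T : measurableType d) (R : realType)
    (m : {sigma_finite_measure set T -> \bar R}) (n : nat) :
    {sigma_finite_measure set (n.-tuple T) -> \bar R} :=
  match n with
  | 0 => \d_([tuple] : 0.-tuple T)
  | n'.+1 => product_cons m (tuple_measure m n')
  end.

Section Cn_measure.
Context {R : realType} {n : nat}.

(* The identification R^2n = C^n, (x, y) |-> x + iy. *)
Definition Cn_of_R2n (t : (n + n).-tuple (measurableTypeR R)) : 'rV[R[i]]_n :=
  \row_j (tnth t (lshift n j) +i* tnth t (rshift n j))%C.

(* The Borel sets of C^n, transported from R^2n. *)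
Definition Cn_measurable : set_system 'rV[R[i]]_n :=
  [set A | measurable (Cn_of_R2n @^-1` A)].

Let Cn_measurable0 : Cn_measurable set0.
Proof. by rewrite /Cn_measurable /= preimage_set0. Qed.

Let Cn_measurableC A : Cn_measurable A -> Cn_measurable (~` A).
Proof. by rewrite /Cn_measurable /= preimage_setC; exact: measurableC. Qed.

Let Cn_measurable_bigcup (F : (set 'rV[R[i]]_n)^nat) :
  (forall k, Cn_measurable (F k)) -> Cn_measurable (\bigcup_k F k).
Proof.
by rewrite /Cn_measurable /= preimage_bigcup; exact: bigcupT_measurable.
Qed.

HB.instance Definition _ := @isMeasurable.Build default_measure_display
  'rV[R[i]]_n Cn_measurable Cn_measurable0 Cn_measurableC Cn_measurable_bigcup.

Lemma measurable_Cn_of_R2n : measurable_fun setT Cn_of_R2n.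
Proof. by move=> _ A mA; rewrite setTI. Qed.

Definition lebesgue_Cn : set 'rV[R[i]]_n -> \bar R :=
  pushforward (tuple_measure (@lebesgue_measure R) (n + n)) Cn_of_R2n.

Let lebesgue_Cn0 : lebesgue_Cn set0 = 0%E.
Proof. by rewrite /lebesgue_Cn /pushforward preimage_set0 measure0. Qed.

Let lebesgue_Cn_ge0 A : (0 <= lebesgue_Cn A)%E.
Proof. exact: (measure_ge0 (tuple_measure _ _) (Cn_of_R2n @^-1` A)). Qed.

Let lebesgue_Cn_sigma_additive : semi_sigma_additive lebesgue_Cn.
Proof.
move=> F mF tF mUF; rewrite /lebesgue_Cn /pushforward preimage_bigcup.
apply: measure_semi_sigma_additive; first exact: mF.
- apply/trivIsetP => /= i j _ _ ij; rewrite -preimage_setI.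
  by move/trivIsetP : tF => /(_ _ _ _ _ ij) ->//; rewrite preimage_set0.
- by rewrite -preimage_bigcup; exact: mUF.
Qed.

HB.instance Definition _ := isMeasure.Build _ _ _ lebesgue_Cn
  lebesgue_Cn0 lebesgue_Cn_ge0 lebesgue_Cn_sigma_additive.

Lemma vol_inv_ge0 (Omega : set 'rV[R[i]]_n) :
  0 <= (fine (lebesgue_Cn Omega))^-1.
Proof. by rewrite invr_ge0 fine_ge0. Qed.

(* Lebesgue measure divided by the volume of Omega; only ever integrated
   over Omega, where it is the normalized Lebesgue measure. *)
Definition normalized_lebesgue (Omega : set 'rV[R[i]]_n) :
    {measure set 'rV[R[i]]_n -> \bar R} :=
  mscale (NngNum (vol_inv_ge0 Omega)) lebesgue_Cn.

End Cn_measure.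

Definition complex_integral d (T : measurableType d) (R : realType)
    (mu : {measure set T -> \bar R}) (D : set T) (f : T -> R[i]) : R[i] :=
  (Rintegral mu D (fun x => complex.Re (f x)) +i* Rintegral mu D (fun x => complex.Im (f x)))%C.

Section domains.
Context {R : realType} {n : nat}.
Local Notation C := R[i].
Local Notation Cn := 'rV[C]_n.
Local Notation normc := ComplexField.Normc.normc.
Implicit Types (Omega U : set Cn) (z w p v : Cn).

Definition holomorphic_on (W : normedModType C) Omega (f : Cn -> W) : Prop :=
  forall z, Omega z -> differentiable f z.

Definition is_domain Omega : Prop :=
  [/\ Omega !=set0, open Omega & connected Omega].

Definition automorphism Omega (F : Cn -> Cn) : Prop :=
  exists G : Cn -> Cn,
    [/\ holomorphic_on Omega F, holomorphic_on Omega G,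
        (forall z, Omega z -> Omega (F z) /\ G (F z) = z) &
        (forall z, Omega z -> Omega (G z) /\ F (G z) = z)].

Definition homogeneous Omega : Prop :=
  forall a b, Omega a -> Omega b ->
    exists F, automorphism Omega F /\ F a = b.

Definition complete_circular Omega : Prop :=
  forall (l : C) z, `|l| <= 1 -> Omega z -> Omega (l *: z).

(* Derivatives in the real direction v of the underlying R^2n: the matrix space
   carries no normed module structure over R, so one restricts g to a line. *)
Definition rderivable v (g : Cn -> R) z : Prop :=
  derivable (fun t : R => g (z + t%:C%C *: v)) 0 1.

Definition rderive v (g : Cn -> R) z : R :=
  derive1 (fun t : R => g (z + t%:C%C *: v)) 0.

(* C^k in the real sense on the open set U: all iterated directional derivatives
   up to order k exist and are continuous. *)
Fixpoint class_C (k : nat) U (g : Cn -> R) : Prop :=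
  (forall z, U z -> {for z, continuous g}) /\
  match k with
  | 0 => True
  | k'.+1 => forall v,
      (forall z, U z -> rderivable v g z) /\ class_C k' U (rderive v g)
  end.

Definition cderive v (f : Cn -> C) z : C :=
  (rderive v (fun x => complex.Re (f x)) z +i* rderive v (fun x => complex.Im (f x)) z)%C.

(* The Wirtinger derivatives (1/2)(d/dx_j -+ i d/dy_j). *)
Definition dz (j : 'I_n) (f : Cn -> C) z : C :=
  (cderive (delta_mx 0 j) f z - 'i%C * cderive ('i%C *: delta_mx 0 j) f z) / 2.

Definition dzbar (j : 'I_n) (f : Cn -> C) z : C :=
  (cderive (delta_mx 0 j) f z + 'i%C * cderive ('i%C *: delta_mx 0 j) f z) / 2.

Definition levi_form (rho : Cn -> R) p w : C :=
  \sum_(j < n) \sum_(k < n)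
    dz j (dzbar k (fun z => (rho z)%:C%C)) p * w 0 j * (w 0 k)^*.

Definition complex_tangent (rho : Cn -> R) p w : Prop :=
  \sum_(j < n) dz j (fun z => (rho z)%:C%C) p * w 0 j = 0.

Definition boundary Omega : set Cn := closure Omega `\` interior Omega.

Definition local_defining_function (k : nat) Omega p U (rho : Cn -> R) : Prop :=
  [/\ open U, U p, class_C k U rho,
      (forall z, U z -> (Omega z <-> rho z < 0)) &
      exists v, rderive v rho p != 0].

Definition smooth_boundary Omega : Prop :=
  forall p, boundary Omega p ->
    exists U rho, forall k, local_defining_function k Omega p U rho.

(* Positivity of the Levi form on the complex tangent space does not depend on
   the choice of the C^2 local defining function. *)
Definition strictly_pseudoconvex Omega : Prop :=
  forall p, boundary Omega p ->
    exists U rho, local_defining_function 2 Omega p U rho /\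
      forall w, w != 0 -> complex_tangent rho p w -> 0 < levi_form rho p w.

Definition Hinfty Omega (f : Cn -> C) : Prop :=
  holomorphic_on Omega f /\
  exists B : R, forall z, Omega z -> normc (f z) <= B.

Definition weighted_sqnorm Omega (w : Cn -> R) (h : Cn -> C) : \bar R :=
  (\int[normalized_lebesgue Omega]_(z in Omega) (normc (h z) ^+ 2 * w z)%:E)%E.

Definition Bergman Omega (f : Cn -> C) : Prop :=
  holomorphic_on Omega f /\ (weighted_sqnorm Omega (fun=> 1%R) f < +oo)%E.

Definition Bergman_dot Omega (f g : Cn -> C) : C :=
  complex_integral (normalized_lebesgue Omega) Omega (fun z => f z * (g z)^*).

Definition reproducing_at Omega (a : Cn) (k : Cn -> C) : Prop :=
  Bergman Omega k /\
  forall f, Bergman Omega f -> f a = Bergman_dot Omega f k.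

(* Determined on Omega only; its values off Omega are irrelevant. *)
Definition Bergman_kernel Omega (a : Cn) : Cn -> C :=
  xget (fun=> 0) [set k | reproducing_at Omega a k].

Definition normalized_kernel Omega (a : Cn) : Cn -> C :=
  fun z => Bergman_kernel Omega a z / sqrtC (Bergman_kernel Omega a a).

Definition convex_weight Omega (M : nat) (a : 'I_M -> Cn)
    (theta : 'I_M.+1 -> R) (z : Cn) : R :=
  theta ord0 + \sum_(m < M)
    theta (lift ord0 m) * normc (normalized_kernel Omega (a m) z) ^+ 2.

Definition max_sqnorm (N : nat) (f : 'I_N -> Cn -> C) (z : Cn) : R :=
  \big[Num.max/0]_(l < N) normc (f l z) ^+ 2.

Definition corona_data Omega (N : nat) (c : R) (phi : 'I_N -> Cn -> C) : Prop :=
  [/\ (0 < N)%N, 0 < c, (forall l, Hinfty Omega (phi l)) &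
      forall z, Omega z ->
        max_sqnorm phi z <= 1 /\ c ^+ 2 <= max_sqnorm phi z].

Definition corona_property Omega : Prop :=
  forall (N : nat) (c : R) (phi : 'I_N -> Cn -> C),
    corona_data Omega c phi ->
    exists (C0 : R) (f : 'I_N -> Cn -> C),
      [/\ 0 < C0, (forall l, Hinfty Omega (f l)),
          (forall z, Omega z -> max_sqnorm f z <= C0 ^+ 2) &
          (forall z, Omega z -> \sum_(l < N) phi l z * f l z = 1)].

Definition convex_poisson_property Omega : Prop :=
  forall (N : nat) (c : R) (phi : 'I_N -> Cn -> C),
    corona_data Omega c phi ->
    exists2 C0 : R, 0 < C0 &
    forall (M : nat) (a : 'I_M -> Cn) (theta : 'I_M.+1 -> R),
      (0 < M)%N ->
      (forall m, Omega (a m)) ->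
      (forall m, 0 <= theta m <= 1) ->
      \sum_m theta m = 1 ->
      exists f : 'I_N -> Cn -> C,
        [/\ (forall l, Bergman Omega (f l)),
            (\sum_(l < N) weighted_sqnorm Omega (convex_weight Omega a theta) (f l)
              <= (C0 ^+ 2)%:E)%E &
            (forall z, Omega z -> \sum_(l < N) phi l z * f l z = 1)].

End domains.

(* Main.v *)
(* A bounded solution f of sum_l phi_l f_l = 1 is a solution in A^2, and its
   weighted norms are bounded since the normalized kernels have norm 1.

   Conversely, fix points a_1, ..., a_M.  The Convex Poisson Property bounds every
   convex combination of the squared norms of f with respect to 1 and to the
   |k~_{a_m}|^2, the solution depending on the combination.  The set of vectors of
   squared norms of solutions being convex, a minimax argument gives one solution
   for which all these norms are at most D = 2 C^2 + 1.  The reproducing property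
   applied to f_l k_{a_m} gives |f_l(a_m)|^2 <= D.  For points a_m dense in the
   domain, solutions of almost minimal norm among those bounded by D at
   a_1, ..., a_M form, as M grows, a Cauchy sequence in A^2, and its limit is
   bounded by D everywhere.  The facts about A^2 come from the inequality
   |f(z)|^2 <= A |f|^2, itself a consequence of Cauchy's formula on rectangles. *)

Require Import Defs.
From HB Require Import structures.
From mathcomp Require Import all_boot all_order all_algebra.
From mathcomp Require Import complex ring lra.
From mathcomp Require Import all_classical all_reals all_analysis measurable_realfun.

Set Implicit Arguments.
Unset Strict Implicit.
Unset Printing Implicit Defensive.

Import Order.TTheory GRing.Theory Num.Theory.
Import numFieldNormedType.Exports.
Local Open Scope classical_set_scope.
Local Open Scope ring_scope.

(** The constant [2 C^2 + 1], where a minimax theorem suggests [C^2], is the price of strictly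
    positive weights. A coefficient zero gives no control over the norm for that weight, which a
    priori may be infinite, so the weights dictated by the penalty are averaged with uniform ones:
    all norms become finite and bounded, at the cost of a factor 2, and the 1 absorbs an infimum
    that need not be attained. What matters is that the constant does not depend on the number of
    points, so that the points can exhaust a dense sequence.

    Neither weak limits nor Montel's theorem are invoked. The solutions bounded at the first M
    points form decreasing convex sets, so almost minimal elements converge strongly in A^2, and the
    pointwise bound turns this into convergence of the functions and of their derivatives. The same
    argument for a constant family of sets yields the element of least norm with value 1 at a, and
    hence the Bergman kernel.

    The finiteness of the norm of f_l for the weight |k~_{a_m}|^2 is exactly what puts f_l k_{a_m}
    in A^2. *)

Local Notation nc := ComplexField.Normc.normc.

(** * The modulus of a complex number as a real number *)

Section complex_modulus.
Context {R : realType}.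
Implicit Types (x y : R) (z w : R[i]).

Lemma nc_ge0 z : 0 <= nc z.
Proof. by case: z => a b; exact: sqrtr_ge0. Qed.

Lemma nc_norm z : `|z| = (nc z)%:C%C.
Proof. by case: z. Qed.

Lemma ncM z w : nc (z * w) = nc z * nc w.
Proof. exact: ComplexField.Normc.normcM. Qed.

Lemma ncN z : nc (- z) = nc z.
Proof. by apply: (@complexI R); rewrite -!nc_norm normrN. Qed.

Lemma ncD z w : nc (z + w) <= nc z + nc w.
Proof. by rewrite -lecR rmorphD /= -!nc_norm ler_normD. Qed.

Lemma ncB z w : nc (z - w) <= nc z + nc w.
Proof. by rewrite (le_trans (ncD _ _))// ncN. Qed.

Lemma nc_distC z w : nc (z - w) = nc (w - z).
Proof. by rewrite -ncN opprB. Qed.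

Lemma nc0 : nc (0 : R[i]) = 0.
Proof. exact: ComplexField.Normc.normc0. Qed.

Lemma nc1 : nc (1 : R[i]) = 1.
Proof. exact: ComplexField.Normc.normc1. Qed.

Lemma ncX z k : nc (z ^+ k) = nc z ^+ k.
Proof. by elim: k => [|k IH]; rewrite ?nc1// !exprS ncM IH. Qed.

Lemma ncV z : nc z^-1 = (nc z)^-1.
Proof. exact: ComplexField.Normc.normcV. Qed.

Lemma nc_eq0 z : (nc z == 0) = (z == 0).
Proof.
apply/eqP/eqP => [|->]; last exact: nc0.
exact: ComplexField.Normc.eq0_normc.
Qed.

Lemma nc_gt0 z : (0 < nc z) = (z != 0).
Proof. by rewrite lt_neqAle nc_ge0 andbT eq_sym nc_eq0. Qed.

Lemma nc_real x : nc (x%:C%C) = `|x|.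
Proof. by rewrite /= expr0n /= addr0 sqrtr_sqr. Qed.

Lemma nc2 : nc (2 : R[i]) = 2.
Proof. by rewrite -[2]/(2%:R) -(rmorph_nat (real_complex R)) nc_real ger0_norm. Qed.

Lemma nc_sqr z : nc z ^+ 2 = complex.Re z ^+ 2 + complex.Im z ^+ 2.
Proof. by case: z => a b /=; rewrite sqr_sqrtr// addr_ge0 ?sqr_ge0. Qed.

Lemma nc_Re z : `|complex.Re z| <= nc z.
Proof.
by rewrite -ler_sqr ?nnegrE ?nc_ge0// nc_sqr real_normK ?num_real// lerDl sqr_ge0.
Qed.

Lemma nc_Im z : `|complex.Im z| <= nc z.
Proof.
by rewrite -ler_sqr ?nnegrE ?nc_ge0// nc_sqr real_normK ?num_real// lerDr sqr_ge0.
Qed.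

Lemma nc_le_ReIm z : nc z <= `|complex.Re z| + `|complex.Im z|.
Proof.
rewrite -ler_sqr ?nnegrE ?nc_ge0 ?addr_ge0// nc_sqr sqrrD !real_normK ?num_real//.
by rewrite lerD2r lerDl mulrn_wge0// mulr_ge0.
Qed.

Lemma cReD z w : complex.Re (z + w) = complex.Re z + complex.Re w.
Proof. by case: z w => a b [c d]. Qed.
Lemma cImD z w : complex.Im (z + w) = complex.Im z + complex.Im w.
Proof. by case: z w => a b [c d]. Qed.
Lemma cReN z : complex.Re (- z) = - complex.Re z.
Proof. by case: z. Qed.
Lemma cImN z : complex.Im (- z) = - complex.Im z.
Proof. by case: z. Qed.
Lemma cReM z w :
  complex.Re (z * w) = complex.Re z * complex.Re w - complex.Im z * complex.Im w.
Proof. by case: z w => a b [c d]. Qed.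
Lemma cImM z w :
  complex.Im (z * w) = complex.Re z * complex.Im w + complex.Im z * complex.Re w.
Proof. by case: z w => a b [c d]. Qed.

End complex_modulus.

(** * Bisection of rectangles *)

Section bisection.
Context {R : realType}.

(** By contradiction: one quarter of a bad rectangle is bad, and iteration gives nested bad
    rectangles shrinking to a point, where the local hypothesis fails. All of them are similar to
    the given rectangle, so a corner [(a', c')] and a scale [s] describe them. *)
Lemma rectangle_bisection (p q a c : R) (P : R -> R -> R -> Prop) :
  0 <= p -> 0 <= q ->
  let sub a' c' s := [/\ a <= a', a' + s * p <= a + p, c <= c' &
                         c' + s * q <= c + q] in
  (forall a' c' s, 0 <= s -> sub a' c' s ->
    P a' c' (s / 2) -> P (a' + s / 2 * p) c' (s / 2) ->
    P a' (c' + s / 2 * q) (s / 2) -> P (a' + s / 2 * p) (c' + s / 2 * q) (s / 2) ->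
    P a' c' s) ->
  (forall x y, a <= x <= a + p -> c <= y <= c + q ->
    exists2 d, 0 < d & forall a' c' s, 0 <= s < d -> sub a' c' s ->
      a' <= x <= a' + s * p -> c' <= y <= c' + s * q -> P a' c' s) ->
  P a c 1.
Proof.
move=> p0 q0 sub quarter loc; apply: contrapT => nP.
pose bad (t : R * R * R) := [/\ 0 <= t.2, sub t.1.1 t.1.2 t.2 & ~ P t.1.1 t.1.2 t.2].
pose nested (t t' : R * R * R) := [/\ t.1.1 <= t'.1.1,
  t'.1.1 + t'.2 * p <= t.1.1 + t.2 * p, t.1.2 <= t'.1.2 &
  t'.1.2 + t'.2 * q <= t.1.2 + t.2 * q].
(* The implication stands under the existential so that [choice] yields a total function; a triple
   that is not bad is sent to itself. *)
have step t : exists t', bad t -> [/\ bad t', nested t t' & t'.2 = t.2 / 2].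
  have [bt|nb] := pselect (bad t); last by exists t => /nb.
  case: t bt => -[u v] s [/= s0 [h1 h2 h3 h4] nPt].
  have s20 : 0 <= s / 2 by rewrite divr_ge0.
  have sE : s = s / 2 + s / 2 by lra.
  have sp0 : 0 <= s / 2 * p by rewrite mulr_ge0.
  have sq0 : 0 <= s / 2 * q by rewrite mulr_ge0.
  have spE : s * p = s / 2 * p + s / 2 * p by rewrite {1}sE mulrDl.
  have sqE : s * q = s / 2 * q + s / 2 * q by rewrite {1}sE mulrDl.
  have [A|A] := pselect (P u v (s / 2)); last first.
    by exists ((u, v), s / 2) => _; split => //; split => //=; [split|..]; lra.
  have [B|B] := pselect (P (u + s / 2 * p) v (s / 2)); last first.
    by exists ((u + s / 2 * p, v), s / 2) => _; split => //; split => //=; [split|..]; lra.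
  have [D|D] := pselect (P u (v + s / 2 * q) (s / 2)); last first.
    by exists ((u, v + s / 2 * q), s / 2) => _; split => //; split => //=; [split|..]; lra.
  have [E|E] := pselect (P (u + s / 2 * p) (v + s / 2 * q) (s / 2)); last first.
    by exists ((u + s / 2 * p, v + s / 2 * q), s / 2) => _; split => //; split => //=; [split|..]; lra.
  by exfalso; apply: nPt; apply: quarter.
have [next nextP] := choice step.
pose t k := iter k next ((a, c), 1).
have bt k : bad (t k).
  elim: k => [|k /nextP[]//].
  by split => //=; rewrite ?ler01//; split; lra.
have tS k : nested (t k) (t k.+1) by case: (nextP _ (bt k)).
have t2 k : (t k).2 = 2^-1 ^+ k.
  elim: k => [|k IH]; first by rewrite expr0.
  by case: (nextP _ (bt k)) => _ _; rewrite -/(t k.+1) IH exprSr.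
have tN k j : nested (t k) (t (k + j)%N).
  elim: j => [|j [i1 i2 i3 i4]]; first by rewrite addn0; split.
  have [] := tS (k + j)%N; rewrite addnS => j1 j2 j3 j4; split.
  - exact: le_trans j1.
  - exact: le_trans i2.
  - exact: le_trans j3.
  - exact: le_trans i4.
have tx j k : (t j).1.1 <= (t k).1.1 + (t k).2 * p.
  have [jk|/ltnW kj] := leqP j k.
    have [h _ _ _] := tN j (k - j)%N; rewrite subnKC// in h.
    by rewrite (le_trans h)// lerDl mulr_ge0//; case: (bt k).
  have [_ h _ _] := tN k (j - k)%N; rewrite subnKC// in h.
  by rewrite (le_trans _ h)// lerDl mulr_ge0//; case: (bt j).
have ty j k : (t j).1.2 <= (t k).1.2 + (t k).2 * q.
  have [jk|/ltnW kj] := leqP j k.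
    have [_ _ h _] := tN j (k - j)%N; rewrite subnKC// in h.
    by rewrite (le_trans h)// lerDl mulr_ge0//; case: (bt k).
  have [_ _ _ h] := tN k (j - k)%N; rewrite subnKC// in h.
  by rewrite (le_trans _ h)// lerDl mulr_ge0//; case: (bt j).
(* The lower left corners increase to their suprema, and by nestedness the limit point lies in every
   rectangle of the sequence. *)
pose x := sup [set (t k).1.1 | k in setT].
pose y := sup [set (t k).1.2 | k in setT].
have xP k : (t k).1.1 <= x <= (t k).1.1 + (t k).2 * p.
  apply/andP; split.
    apply: ub_le_sup; last by exists k.
    by exists ((t 0%N).1.1 + (t 0%N).2 * p) => _ [j _ <-].
  by apply: ge_sup; [exists (t 0%N).1.1, 0%N | move=> _ [j _ <-]].
have yP k : (t k).1.2 <= y <= (t k).1.2 + (t k).2 * q.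
  apply/andP; split.
    apply: ub_le_sup; last by exists k.
    by exists ((t 0%N).1.2 + (t 0%N).2 * q) => _ [j _ <-].
  by apply: ge_sup; [exists (t 0%N).1.2, 0%N | move=> _ [j _ <-]].
have [|//|d d0 dP] := loc x y.
- by have := xP 0%N; rewrite /= mul1r.
- by have := yP 0%N; rewrite /= mul1r.
have [k kd] : exists k, (2^-1 : R) ^+ k < d.
  have /cvgrPdist_lt/(_ _ d0)[k _ /(_ k (leqnn k))] :
      (fun k => (2^-1 : R) ^+ k) @ \oo --> (0 : R).
    by apply: cvg_expr; rewrite ger0_norm ?invr_ge0// invf_lt1// ltr1n.
  by rewrite sub0r normrN ger0_norm ?exprn_ge0 ?invr_ge0//; exists k.
have [h1 h2 h3] := bt k.
by apply: h3; apply: dP => //; rewrite h1 t2.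
Qed.

End bisection.

(** * Complex differentiability in one variable and integrals along segments *)

Section one_variable.
Context {R : realType}.
Local Notation C := R[i].
Local Notation mu := (@lebesgue_measure R).
Implicit Types (a b c d x y e : R) (z w : C) (f g : C -> C) (h : R -> C).

Definition ccont f z := forall e, 0 < e ->
  exists2 r, 0 < r & forall w, nc (w - z) < r -> nc (f w - f z) <= e.

Definition cderiv f z (l : C) := forall e, 0 < e ->
  exists2 r, 0 < r &
    forall w, nc (w - z) < r -> nc (f w - f z - l * (w - z)) <= e * nc (w - z).

Definition cdiff f z := exists l, cderiv f z l.

Lemma cdiff_ccont f z : cdiff f z -> ccont f z.
Proof.
move=> [l fl] e e0; have [r r0 rP] := fl 1 ltr01.
have K0 : 0 < nc l + 1 by rewrite ltr_wpDl ?nc_ge0.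
exists (Num.min r (e / (nc l + 1))); first by rewrite lt_min r0 divr_gt0.
move=> w; rewrite lt_min => /andP[wr we].
have -> : f w - f z = (f w - f z - l * (w - z)) + l * (w - z) by rewrite subrK.
rewrite (le_trans (ncD _ _))// ncM (le_trans (lerD (rP w wr) (lexx _)))//.
by rewrite -mulrDl addrC -ler_pdivlMl// mulrC ltW.
Qed.

Lemma cdiff_cst k z : cdiff (fun=> k) z.
Proof.
by exists 0 => e e0; exists 1 => // w _; rewrite subrr mul0r subr0 nc0 mulr_ge0 ?nc_ge0 ?ltW.
Qed.

Lemma cdiff_id z : cdiff id z.
Proof.
by exists 1 => e e0; exists 1 => // w _; rewrite mul1r subrr nc0 mulr_ge0 ?nc_ge0 ?ltW.
Qed.

Lemma cdiffD f g z : cdiff f z -> cdiff g z -> cdiff (fun w => f w + g w) z.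
Proof.
move=> [l fl] [m gm]; exists (l + m) => e e0.
have e20 : 0 < e / 2 by rewrite divr_gt0.
have [r r0 rP] := fl _ e20; have [s s0 sP] := gm _ e20.
exists (Num.min r s); first by rewrite lt_min r0.
move=> w; rewrite lt_min => /andP[wr ws].
have -> : f w + g w - (f z + g z) - (l + m) * (w - z) =
  (f w - f z - l * (w - z)) + (g w - g z - m * (w - z)) by ring.
rewrite (le_trans (ncD _ _))// (le_trans (lerD (rP w wr) (sP w ws)))//.
by rewrite -mulrDl -splitr.
Qed.

Lemma cdiffM f g z : cdiff f z -> cdiff g z -> cdiff (fun w => f w * g w) z.
Proof.
move=> df dg; have cg := cdiff_ccont dg; move: df dg => [l fl] [m gm].
exists (l * g z + f z * m) => e e0.
pose A := nc (g z) + 1; pose B := nc (f z) + 1; pose D := nc l + 1.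
have A0 : 0 < A by rewrite ltr_wpDl ?nc_ge0.
have B0 : 0 < B by rewrite ltr_wpDl ?nc_ge0.
have D0 : 0 < D by rewrite ltr_wpDl ?nc_ge0.
have eA : 0 < e / 3 / A by rewrite !divr_gt0.
have eB : 0 < e / 3 / B by rewrite !divr_gt0.
have eD : 0 < e / 3 / D by rewrite !divr_gt0.
have [r r0 rP] := fl _ eA; have [s s0 sP] := gm _ eB.
have [t t0 tP] := cg _ eD; have [u u0 uP] := cg _ ltr01.
exists (Num.min (Num.min r s) (Num.min t u)); first by rewrite !lt_min r0 s0 t0.
move=> w; rewrite !lt_min => /andP[/andP[wr ws] /andP[wt wu]].
have -> : f w * g w - f z * g z - (l * g z + f z * m) * (w - z) =
  (f w - f z - l * (w - z)) * g w + f z * (g w - g z - m * (w - z)) +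
  l * (w - z) * (g w - g z) by ring.
have gA : nc (g w) <= A.
  by rewrite -[g w](subrK (g z)) (le_trans (ncD _ _))// addrC lerD2l uP.
have fB : nc (f z) <= B by rewrite lerDl.
have lD : nc l <= D by rewrite lerDl.
have n0 := nc_ge0 (w - z).
have T1 : nc ((f w - f z - l * (w - z)) * g w) <= e / 3 * nc (w - z).
  rewrite ncM (le_trans (ler_pM (nc_ge0 _) (nc_ge0 _) (rP w wr) gA))//.
  by rewrite mulrAC divfK ?gt_eqF.
have T2 : nc (f z * (g w - g z - m * (w - z))) <= e / 3 * nc (w - z).
  rewrite ncM (le_trans (ler_pM (nc_ge0 _) (nc_ge0 _) fB (sP w ws)))//.
  by rewrite mulrA mulrC [B * _]mulrC divfK ?gt_eqF// mulrC.
have T3 : nc (l * (w - z) * (g w - g z)) <= e / 3 * nc (w - z).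
  rewrite ncM ncM mulrAC ler_wpM2r//.
  rewrite (le_trans (ler_pM (nc_ge0 _) (nc_ge0 _) lD (tP w wt)))//.
  by rewrite mulrC divfK ?gt_eqF.
rewrite (le_trans (ncD _ _))// (le_trans (lerD (ncD _ _) (lexx _)))//.
lra.
Qed.

Lemma cdiffN f z : cdiff f z -> cdiff (fun w => - f w) z.
Proof.
move=> df; rewrite (_ : (fun w => - f w) = (fun w => (-1) * f w)).
  exact/cdiffM/df/cdiff_cst.
by apply/funext => w; rewrite mulN1r.
Qed.

Lemma cdiffB f g z : cdiff f z -> cdiff g z -> cdiff (fun w => f w - g w) z.
Proof. by move=> df dg; apply: cdiffD => //; exact: cdiffN. Qed.

Lemma cdiffX f z k : cdiff f z -> cdiff (fun w => f w ^+ k) z.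
Proof.
move=> df; elim: k => [|k IH]; first exact: cdiff_cst.
rewrite (_ : (fun w => _) = (fun w => f w * f w ^+ k)); first exact: cdiffM.
by apply/funext => w; rewrite exprS.
Qed.

Lemma cdiffV (p z : C) : z != p -> cdiff (fun w => (w - p)^-1) z.
Proof.
move=> zp; have zp0 : z - p != 0 by rewrite subr_eq0.
have N0 : 0 < nc (z - p) by rewrite nc_gt0.
set N := nc (z - p) in N0 *.
exists (- (z - p)^-2) => e e0.
(* The remainder is [(w - z)^2 / ((z - p)^2 (w - p))]. The bound [N / 2] keeps [w - p] at modulus at
   least [N / 2], and [N^3 / 2 = N^2 (N / 2)] then bounds the denominator from below. *)
exists (Num.min (N / 2) (e * (N ^+ 3 / 2))).
  by rewrite lt_min !(divr_gt0, mulr_gt0, exprn_gt0).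
move=> w; rewrite lt_min => /andP[w1 w2].
have wN : N / 2 <= nc (w - p).
  have : N <= nc (w - p) + nc (w - z).
    by rewrite [nc (w - z)]nc_distC (le_trans _ (ncD _ _))// addrC subrKA.
  by move: w1; lra.
have wp0 : w - p != 0 by rewrite -nc_gt0 (lt_le_trans _ wN)// divr_gt0.
have -> : (w - p)^-1 - (z - p)^-1 - - (z - p)^-2 * (w - z) =
  (w - z) ^+ 2 * (z - p)^-2 * (w - p)^-1.
  by field; rewrite wp0 zp0.
rewrite !ncM !ncV !ncM -/N.
have n0 := nc_ge0 (w - z).
rewrite -!mulrA [leRHS]mulrC ler_wpM2l//.
rewrite mulrA ler_pdivrMr ?nc_gt0// ler_pdivrMr ?mulr_gt0//.
rewrite (le_trans (ltW w2))//.
have -> : e * (N ^+ 3 / 2) = e * (N / 2) * (N * N) by field.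
by rewrite ler_wpM2r ?ler_pM2l// mulr_ge0// ltW.
Qed.

Definition cint a b h : C :=
  (Rintegral mu `[a, b] (fun x => complex.Re (h x)) +i*
   Rintegral mu `[a, b] (fun x => complex.Im (h x)))%C.

(** Continuity within the whole line at the points of the segment, endpoints included: [y] is not
    confined to [[a, b]]. A function of the plane that is continuous at the points of a side
    provides it. *)
Definition scont a b h := forall x, a <= x <= b -> forall e, 0 < e ->
  exists2 r, 0 < r & forall y, `|y - x| < r -> nc (h y - h x) <= e.

(** A 1-Lipschitz [p] covers the real part, the imaginary part and the modulus at once. *)
Lemma scont_integrable (p : C -> R) a b h :
  (forall z w, `|p z - p w| <= nc (z - w)) ->
  scont a b h -> mu.-integrable `[a, b] (EFin \o (p \o h)).
Proof.
move=> pl hc; apply: continuous_compact_integrable; first exact: segment_compact.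
apply: continuous_in_subspaceT => x; rewrite inE/= in_itv/= => xab.
apply/(@cvgrPdist_lt R R^o) => e e0.
have e20 : 0 < e / 2 by rewrite divr_gt0.
have [r r0 rP] := hc x xab _ e20.
near=> y; rewrite distrC (le_lt_trans (pl _ _))// (@le_lt_trans _ _ (e / 2))//.
  apply: rP; rewrite distrC; near: y.
  by apply/(@nbhs_ballP R R^o); exists r => //.
by rewrite gtr_pMr// invf_lt1// ltr1n.
Unshelve. all: by end_near. Qed.

Lemma scont_integrable_Re a b h : scont a b h ->
  mu.-integrable `[a, b] (EFin \o (fun x => complex.Re (h x))).
Proof.
by apply: scont_integrable => z w; rewrite -cReN -cReD nc_Re.
Qed.

Lemma scont_integrable_Im a b h : scont a b h ->
  mu.-integrable `[a, b] (EFin \o (fun x => complex.Im (h x))).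
Proof.
by apply: scont_integrable => z w; rewrite -cImN -cImD nc_Im.
Qed.

Lemma scont_integrable_nc a b h : scont a b h ->
  mu.-integrable `[a, b] (EFin \o (fun x => nc (h x))).
Proof.
apply: scont_integrable => z w; rewrite ler_norml lerNl opprB !lerBlDr.
by rewrite nc_distC -{1}[w](subrK z) ncD nc_distC -{1}[z](subrK w) ncD.
Qed.

Lemma cint_split a m b h : a <= m <= b -> scont a b h ->
  cint a b h = cint a m h + cint m b h.
Proof.
move=> /andP[am mb] hc; rewrite /cint.
have E (p : R -> R) : mu.-integrable `[a, b] (EFin \o p) ->
    Rintegral mu `[a, b] p = Rintegral mu `[a, m] p + Rintegral mu `[m, b] p.
  move=> ip; have := @Rintegral_itvB _ p (BLeft a) (BRight b) m ip.
  rewrite !bnd_simp => /(_ am mb) /eqP; rewrite subr_eq => /eqP ->.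
  rewrite addrC Rintegral_itv_obnd_cbnd//; apply: integrableS ip => //.
  by apply: subset_itvr; rewrite bnd_simp.
by rewrite (E _ (scont_integrable_Re _)) ?(E _ (scont_integrable_Im _)).
Qed.

Lemma eq_cint a b h h' : (forall x, a <= x <= b -> h x = h' x) ->
  cint a b h = cint a b h'.
Proof.
move=> hh; rewrite /cint; congr (_ +i* _)%C; apply: eq_Rintegral => x;
  by rewrite inE/= in_itv/= => /hh ->.
Qed.

Lemma scont_cst a b k : scont a b (fun=> k).
Proof. by move=> x _ e e0; exists 1 => // y _; rewrite subrr nc0 ltW. Qed.

Lemma cintD a b h h' : scont a b h -> scont a b h' ->
  cint a b (fun x => h x + h' x) = cint a b h + cint a b h'.
Proof.
move=> c1 c2; rewrite /cint.
under eq_Rintegral do rewrite cReD.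
under [X in (_ +i* X)%C]eq_Rintegral do rewrite cImD.
by rewrite !RintegralD//; [exact: scont_integrable_Im|exact: scont_integrable_Im|
  exact: scont_integrable_Re|exact: scont_integrable_Re].
Qed.

Lemma cintZ a b h (k : C) : scont a b h -> cint a b (fun x => k * h x) = k * cint a b h.
Proof.
move=> c1; rewrite {1}/cint.
under eq_Rintegral do rewrite cReM.
under [X in (_ +i* X)%C]eq_Rintegral do rewrite cImM.
have i1 := scont_integrable_Re c1; have i2 := scont_integrable_Im c1.
have Z (r : R) (p : R -> R) : mu.-integrable `[a, b] (EFin \o p) ->
    mu.-integrable `[a, b] (EFin \o (fun x => r * p x)).
  by move=> ip; rewrite (_ : _ \o _ = (fun x => r%:E * (EFin \o p) x)%E)//;
    exact: integrableZl.
rewrite RintegralB ?RintegralD ?RintegralZl//; [|exact: Z..].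
by rewrite /cint; case: k.
Qed.

Lemma fine_lebesgue_segment a b : a <= b -> fine (mu `[a, b]%classic) = b - a.
Proof.
move=> ab; rewrite lebesgue_measure_itv/= lte_fin.
by case: ltgtP ab => // -> _; rewrite subrr.
Qed.

Lemma cint_cst a b k : a <= b -> cint a b (fun=> k) = (b - a)%:C%C * k.
Proof.
move=> ab; rewrite /cint !Rintegral_cst//= fine_lebesgue_segment//.
by case: k => u v /=; rewrite mulrC [v * _]mulrC; simpc.
Qed.

(** Real and imaginary parts are bounded separately, whence the factor 2. It is harmless: the
    estimates built on it only need some constant. *)
Lemma cint_le_integral a b h : scont a b h ->
  nc (cint a b h) <= 2 * Rintegral mu `[a, b] (fun x => nc (h x)).
Proof.
move=> c1; rewrite (le_trans (nc_le_ReIm _))// /cint/= mulr2n mulrDl mul1r.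
have i1 := scont_integrable_Re c1; have i2 := scont_integrable_Im c1.
have i3 := scont_integrable_nc c1.
have L (p : R -> R) : mu.-integrable `[a, b] (EFin \o p) ->
    (forall x, `|p x| <= nc (h x)) ->
    `|Rintegral mu `[a, b] p| <= Rintegral mu `[a, b] (fun x => nc (h x)).
  move=> ip pn; rewrite (le_trans (le_normr_Rintegral _ ip))//.
  apply: le_Rintegral => //.
  by have := integrable_norm ip.
by apply: lerD; apply: L => // x; [exact: nc_Re|exact: nc_Im].
Qed.

Lemma cint_le a b h B : a <= b -> scont a b h ->
  (forall x, a <= x <= b -> nc (h x) <= B) -> nc (cint a b h) <= 2 * (B * (b - a)).
Proof.
move=> ab c1 hB; rewrite (le_trans (cint_le_integral c1))// ler_pM2l//.
have -> : B * (b - a) = Rintegral mu `[a, b] (fun=> B).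
  by rewrite Rintegral_cst//= fine_lebesgue_segment.
apply: le_Rintegral => //; first exact: scont_integrable_nc.
rewrite (_ : EFin \o _ = EFin \o ((@complex.Re R) \o (fun=> B%:C%C)))//.
exact: (scont_integrable_Re (@scont_cst a b B%:C%C)).
Qed.

End one_variable.

(** * Contour integrals over rectangles and Goursat's theorem *)

Section rectangle_integral.
Context {R : realType}.
Local Notation C := R[i].
Local Notation mu := (@lebesgue_measure R).
Implicit Types (a b c d x y e : R) (z w : C) (f g : C -> C).

Lemma le0_small (x K : R) : (forall e, 0 < e -> x <= e * K) -> x <= 0.
Proof.
move=> h; rewrite leNgt; apply/negP => x0.
have K0 : 0 < K.
  by have := h 1 ltr01; rewrite mul1r; exact: lt_le_trans.
have x2K : 0 < x / 2 / K by rewrite !divr_gt0.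
by have := h _ x2K; rewrite divfK ?gt_eqF// leNgt gtr_pMr// invf_lt1// ltr1n.
Qed.

Lemma complexEi x y : (x +i* y)%C = x%:C%C + 'i%C * y%:C%C.
Proof. by simpc. Qed.

Lemma nci : nc ('i%C : C) = 1.
Proof. by rewrite /= expr0n/= add0r expr1n sqrtr1. Qed.

(** The contour integral of [f dz] along the boundary of [[a, b] x [c, d]], counterclockwise: bottom
    minus top, plus [i] times right minus left. *)
Definition rectint f a b c d : C :=
  cint a b (fun x => f (x +i* c)%C) - cint a b (fun x => f (x +i* d)%C) +
  'i%C * (cint c d (fun y => f (b +i* y)%C) - cint c d (fun y => f (a +i* y)%C)).

Definition rcont f a b c d :=
  [/\ scont a b (fun x => f (x +i* c)%C), scont a b (fun x => f (x +i* d)%C),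
      scont c d (fun y => f (b +i* y)%C) & scont c d (fun y => f (a +i* y)%C)].

Lemma ccont_hscont f a b c : (forall x, a <= x <= b -> ccont f (x +i* c)%C) ->
  scont a b (fun x => f (x +i* c)%C).
Proof.
move=> fc x xab e e0; have [r r0 rP] := fc x xab e e0.
exists r => // y xy; apply: rP.
rewrite (_ : _ - _ = (y - x)%:C%C) ?nc_real//.
by apply/eqP; rewrite eq_complex /= subrr !eqxx.
Qed.

Lemma ccont_vscont f a c d : (forall y, c <= y <= d -> ccont f (a +i* y)%C) ->
  scont c d (fun y => f (a +i* y)%C).
Proof.
move=> fc x xab e e0; have [r r0 rP] := fc x xab e e0.
exists r => // y xy; apply: rP.
rewrite (_ : _ - _ = 'i%C * (y - x)%:C%C) ?ncM ?nci ?mul1r ?nc_real//.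
by apply/eqP; rewrite eq_complex /=; apply/andP; split; apply/eqP; ring.
Qed.

(** The disjunction singles out the four sides, so that [f] may be singular inside the rectangle. *)
Lemma cdiff_rcont f a b c d : a <= b -> c <= d ->
  (forall x y, a <= x <= b -> c <= y <= d ->
     [|| x == a, x == b, y == c | y == d] -> cdiff f (x +i* y)%C) ->
  rcont f a b c d.
Proof.
move=> ab cd h; split; [apply: ccont_hscont|apply: ccont_hscont|
  apply: ccont_vscont|apply: ccont_vscont] => x xx; apply: cdiff_ccont;
  by apply: h; rewrite ?eqxx ?orbT ?lexx ?ab ?cd.
Qed.

Lemma eq_rectint f g a b c d : a <= b -> c <= d ->
  (forall x y, a <= x <= b -> c <= y <= d ->
     [|| x == a, x == b, y == c | y == d] -> f (x +i* y)%C = g (x +i* y)%C) ->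
  rectint f a b c d = rectint g a b c d.
Proof.
move=> ab cd h; rewrite /rectint; congr (_ - _ + _ * (_ - _)); apply: eq_cint => x xx;
  by apply: h; rewrite ?eqxx ?orbT ?lexx ?ab ?cd.
Qed.

Lemma rectintD f g a b c d : rcont f a b c d -> rcont g a b c d ->
  rectint (fun z => f z + g z) a b c d = rectint f a b c d + rectint g a b c d.
Proof.
move=> [f1 f2 f3 f4] [g1 g2 g3 g4]; rewrite /rectint !cintD//.
ring.
Qed.

Lemma rectintZ f a b c d (k : C) : rcont f a b c d ->
  rectint (fun z => k * f z) a b c d = k * rectint f a b c d.
Proof. by move=> [f1 f2 f3 f4]; rewrite /rectint !cintZ//; ring. Qed.

Lemma rectint_le f a b c d B : a <= b -> c <= d -> rcont f a b c d ->
  (forall x y, a <= x <= b -> c <= y <= d ->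
     [|| x == a, x == b, y == c | y == d] -> nc (f (x +i* y)%C) <= B) ->
  nc (rectint f a b c d) <= 4 * (B * (b - a + (d - c))).
Proof.
move=> ab cd [f1 f2 f3 f4] h; rewrite /rectint.
rewrite (le_trans (ncD _ _))// ncM nci mul1r.
have -> : 4 * (B * (b - a + (d - c))) = 2 * (B * (b - a)) + 2 * (B * (b - a)) +
  (2 * (B * (d - c)) + 2 * (B * (d - c))) by ring.
by apply: lerD; rewrite (le_trans (ncB _ _))//; apply: lerD; apply: cint_le => // x xx;
  apply: h; rewrite ?eqxx ?orbT ?lexx ?ab ?cd.
Qed.

Lemma rectint_hsplit f a m b c d : a <= m <= b -> rcont f a b c d ->
  rectint f a b c d = rectint f a m c d + rectint f m b c d.
Proof.
by move=> amb [f1 f2 f3 f4]; rewrite /rectint !(cint_split amb)//; ring.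
Qed.

Lemma rectint_vsplit f a b c m d : c <= m <= d -> rcont f a b c d ->
  rectint f a b c d = rectint f a b c m + rectint f a b m d.
Proof.
by move=> amb [f1 f2 f3 f4]; rewrite /rectint !(cint_split amb)//; ring.
Qed.

Lemma rectint_cst k a b c d : rectint (fun=> k) a b c d = 0.
Proof. by rewrite /rectint !subrr mulr0 addr0. Qed.

Lemma rectint_id a b c d : a <= b -> c <= d -> rectint id a b c d = 0.
Proof.
move=> ab cd.
have cx : scont a b (fun x => x%:C%C).
  by apply: (@ccont_hscont id a b 0) => x _; apply/cdiff_ccont/cdiff_id.
have cy : scont c d (fun x => 'i%C * x%:C%C).
  rewrite (_ : (fun x => _) = (fun y => id (0 +i* y)%C)); last first.
    by apply/funext => x /=; simpc.
  by apply: (@ccont_vscont id) => x _; apply/cdiff_ccont/cdiff_id.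
have hE k : cint a b (fun x => (x +i* k)%C) =
    cint a b (fun x => x%:C%C) + (b - a)%:C%C * ('i%C * k%:C%C).
  rewrite -(cint_cst _ ab) -cintD//; last exact: scont_cst.
  by apply: eq_cint => x _; rewrite complexEi.
have vE k : cint c d (fun x => (k +i* x)%C) =
    cint c d (fun x => 'i%C * x%:C%C) + (d - c)%:C%C * k%:C%C.
  rewrite -(cint_cst _ cd) -cintD//; last exact: scont_cst.
  by apply: eq_cint => x _; rewrite complexEi addrC.
rewrite /rectint /id.
have G (X Y A B U V I : C) : X + (B - A) * (I * U) - (X + (B - A) * (I * V)) +
    I * (Y + (V - U) * B - (Y + (V - U) * A)) = 0 by ring.
by rewrite (hE c) (hE d) (vE a) (vE b) !rmorphB/= G.
Qed.

Lemma rectint_affine k l a b c d : a <= b -> c <= d ->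
  rectint (fun z => k + l * z) a b c d = 0.
Proof.
move=> ab cd.
have ci : rcont id a b c d by apply: cdiff_rcont => // x y _ _ _; exact: cdiff_id.
rewrite (@rectintD (fun=> k) (fun z => l * z)).
- by rewrite rectint_cst (rectintZ _ ci) rectint_id// mulr0 addr0.
- by apply: cdiff_rcont => // x y _ _ _; exact: cdiff_cst.
- by apply: cdiff_rcont => // x y _ _ _; apply/cdiffM/cdiff_id/cdiff_cst.
Qed.

(** The bound [4 e (s (p + q))^2] is homogeneous of degree 2 in the scale [s], so it passes from the
    four quarters to the whole. Near a point it holds after subtraction of the tangent affine map,
    whose integral vanishes. No continuity of the derivative enters. *)
Lemma goursat f a b c d : a <= b -> c <= d ->
  (forall x y, a <= x <= b -> c <= y <= d -> cdiff f (x +i* y)%C) ->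
  rectint f a b c d = 0.
Proof.
move=> ab cd fd; apply/eqP; rewrite -nc_eq0 eq_le nc_ge0 andbT.
set p := b - a; set q := d - c.
have p0 : 0 <= p by rewrite subr_ge0.
have q0 : 0 <= q by rewrite subr_ge0.
apply: (@le0_small _ (4 * (p + q) ^+ 2)) => e e0.
pose P a' c' s := nc (rectint f a' (a' + s * p) c' (c' + s * q)) <=
  e * (4 * (s * (p + q)) ^+ 2).
suff : P a c 1 by rewrite /P !mul1r /p /q !subrKC.
have bE : a + p = b by rewrite /p subrKC.
have dE : c + q = d by rewrite /q subrKC.
have subd a' b' c' d' : a <= a' -> b' <= b -> c <= c' -> d' <= d ->
    forall x y, a' <= x <= b' -> c' <= y <= d' -> cdiff f (x +i* y)%C.
  move=> h1 h2 h3 h4 x y /andP[x1 x2] /andP[y1 y2]; apply: fd.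
    by rewrite (le_trans h1)//= (le_trans x2).
  by rewrite (le_trans h3)//= (le_trans y2).
have := @rectangle_bisection R p q a c P p0 q0; rewrite /= bE dE; apply.
- move=> a' c' s s0 [h1 h2 h3 h4]; rewrite /P.
  have s20 : 0 <= s / 2 by rewrite divr_ge0.
  have s2p : 0 <= s / 2 * p by rewrite mulr_ge0.
  have s2q : 0 <= s / 2 * q by rewrite mulr_ge0.
  have spE : a' + s / 2 * p + s / 2 * p = a' + s * p by field.
  have sqE : c' + s / 2 * q + s / 2 * q = c' + s * q by field.
  rewrite spE sqE.
  have RC u v u' v' : a <= u -> u <= v -> v <= b -> c <= u' -> u' <= v' -> v' <= d ->
      rcont f u v u' v'.
    move=> k1 k2 k3 k4 k5 k6; apply: cdiff_rcont => // x y xx yy _.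
    exact: (subd _ _ _ _ k1 k3 k4 k6).
  have -> : rectint f a' (a' + s * p) c' (c' + s * q) =
    rectint f a' (a' + s / 2 * p) c' (c' + s / 2 * q) +
    rectint f a' (a' + s / 2 * p) (c' + s / 2 * q) (c' + s * q) +
    (rectint f (a' + s / 2 * p) (a' + s * p) c' (c' + s / 2 * q) +
     rectint f (a' + s / 2 * p) (a' + s * p) (c' + s / 2 * q) (c' + s * q)).
    move: s2p s2q spE sqE h2 h4; move: (s / 2 * p) (s / 2 * q) => P2 Q2.
    move: (a' + s * p) (c' + s * q) => A' C' P0 Q0 PE QE h2 h4.
    have k1 : a <= a' + P2 by rewrite (le_trans h1)// lerDl.
    have k2 : c <= c' + Q2 by rewrite (le_trans h3)// lerDl.
    have k3 : a' + P2 <= A' by rewrite -PE lerDl.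
    have k4 : c' + Q2 <= C' by rewrite -QE lerDl.
    have k5 : a' <= a' + P2 by rewrite lerDl.
    have k6 : c' <= c' + Q2 by rewrite lerDl.
    have k7 : a' <= A' by rewrite (le_trans k5).
    have k8 : c' <= C' by rewrite (le_trans k6).
    have k9 : a' + P2 <= b by rewrite (le_trans k3).
    rewrite (@rectint_hsplit _ _ (a' + P2)) ?k5//; last exact: RC.
    rewrite (@rectint_vsplit _ _ _ _ (c' + Q2)) ?k6//; last exact: RC.
    by rewrite [X in _ + X](@rectint_vsplit _ _ _ _ (c' + Q2)) ?k6//; exact: RC.
  move=> P1 P2 P3 P4.
  rewrite (le_trans (ncD _ _))// (le_trans (lerD (ncD _ _) (ncD _ _)))//.
  have -> : e * (4 * (s * (p + q)) ^+ 2) = e * (4 * (s / 2 * (p + q)) ^+ 2) +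
    e * (4 * (s / 2 * (p + q)) ^+ 2) + (e * (4 * (s / 2 * (p + q)) ^+ 2) +
    e * (4 * (s / 2 * (p + q)) ^+ 2)) by field.
  exact: (lerD (lerD P1 P3) (lerD P2 P4)).
- move=> x y xab ycd; have [l fl] := fd x y xab ycd.
  have [r r0 rP] := fl e e0; pose z := (x +i* y)%C.
  have L0 : 0 < p + q + 1 by rewrite ltr_wpDl//; exact: addr_ge0.
  (* A subrectangle of scale [s] has diameter at most [s (p + q)]; the added 1 covers the case
     [p = q = 0]. *)
  exists (r / (p + q + 1)); first by rewrite divr_gt0.
  move=> a' c' s /andP[s0 sr] [h1 h2 h3 h4] xs ys.
  have sp0 : 0 <= s * p by rewrite mulr_ge0.
  have sq0 : 0 <= s * q by rewrite mulr_ge0.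
  have ab' : a' <= a' + s * p by rewrite lerDl.
  have cd' : c' <= c' + s * q by rewrite lerDl.
  pose g w := f w - ((f z - l * z) + l * w).
  have gd x' y' : a' <= x' <= a' + s * p -> c' <= y' <= c' + s * q ->
      cdiff g (x' +i* y')%C.
    move=> xx yy; apply: cdiffB; first exact: (subd a' (a' + s * p) c' (c' + s * q)).
    by apply: cdiffD; [exact: cdiff_cst|apply/cdiffM/cdiff_id/cdiff_cst].
  have gR : rcont g a' (a' + s * p) c' (c' + s * q).
    by apply: cdiff_rcont => // x' y' xx yy _; exact: gd.
  rewrite /P (_ : f = fun w => g w + ((f z - l * z) + l * w)); last first.
    by apply/funext => w; rewrite subrK.
  rewrite rectintD//; last first.
    apply: cdiff_rcont => // x' y' _ _ _.
    by apply: cdiffD; [exact: cdiff_cst|apply/cdiffM/cdiff_id/cdiff_cst].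
  rewrite rectint_affine// addr0.
  have D x' y' : a' <= x' <= a' + s * p -> c' <= y' <= c' + s * q ->
      nc ((x' +i* y')%C - z) <= s * (p + q).
    move=> xx yy; rewrite (le_trans (nc_le_ReIm _))//= mulrDr.
    by apply: lerD; rewrite ler_norml; lra.
  rewrite (le_trans (rectint_le ab' cd' gR (B := e * (s * (p + q))) _))//.
    move=> x' y' xx yy _; rewrite /g.
    rewrite (_ : _ - _ = f (x' +i* y')%C - f z - l * ((x' +i* y')%C - z)); last by ring.
    rewrite (le_trans (rP _ _))//.
      rewrite (le_lt_trans (D _ _ xx yy))// -/z.
      rewrite (@le_lt_trans _ _ (s * (p + q + 1)))// ?ler_wpM2l ?lerDl//.
      by rewrite -ltr_pdivlMr.
    by rewrite ler_pM2l// D.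
  rewrite le_eqVlt; apply/orP; left; apply/eqP; ring.
Qed.

(** The four strips cut off around the inner rectangle contribute 0 by [goursat]. Differentiability
    is asked only off the open inner rectangle, where singularities may therefore lie. *)
Lemma rectint_frame f a a' b' b c c' d' d :
  a <= a' -> a' <= b' -> b' <= b -> c <= c' -> c' <= d' -> d' <= d ->
  (forall x y, a <= x <= b -> c <= y <= d -> ~ (a' < x < b' /\ c' < y < d') ->
    cdiff f (x +i* y)%C) ->
  rectint f a b c d = rectint f a' b' c' d'.
Proof.
move=> aa ab bb cc cd dd fd.
(* The coordinate of each side avoids the open interval [(a', b')] or [(c', d')], so the boundary of
   the subrectangle misses the open inner rectangle. *)
have RC u v u' v' : a <= u -> u <= v -> v <= b -> c <= u' -> u' <= v' -> v' <= d ->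
    (u <= a' \/ b' <= u) -> (v <= a' \/ b' <= v) ->
    (u' <= c' \/ d' <= u') -> (v' <= c' \/ d' <= v') ->
    rcont f u v u' v'.
  move=> k1 k2 k3 k4 k5 k6 h1 h2 h3 h4; apply: cdiff_rcont => // x y xx yy.
  move=> /or4P[] /eqP E; apply: fd; try lra; move=> [p1 p2];
  by case: h1 => ?; case: h2 => ?; case: h3 => ?; case: h4 => ?; lra.
have G u v u' v' : a <= u -> u <= v -> v <= b -> c <= u' -> u' <= v' -> v' <= d ->
    (v <= a' \/ b' <= u \/ v' <= c' \/ d' <= u') -> rectint f u v u' v' = 0.
  move=> k1 k2 k3 k4 k5 k6 h; apply: goursat => // x y xx yy.
  by apply: fd; try lra; move=> [p1 p2]; case: h => [?|[?|[?|?]]]; lra.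
rewrite (@rectint_hsplit _ _ a'); [|lra|by apply: RC; lra].
rewrite (G a a'); [|by lra..|by left]; rewrite add0r.
rewrite (@rectint_hsplit _ _ b'); [|lra|by apply: RC; lra].
rewrite (G b' b); [|by lra..|by right; left]; rewrite addr0.
rewrite (@rectint_vsplit _ _ _ _ c'); [|lra|by apply: RC; lra].
rewrite (G _ _ c c'); [|by lra..|by right; right; left]; rewrite add0r.
rewrite (@rectint_vsplit _ _ _ _ d'); [|lra|by apply: RC; lra].
by rewrite (G _ _ d' d) ?addr0//; [lra..|right; right; right].
Qed.

(** The contour shrinks to a square of half-side [D] around [w], on which the integral is at most
    [16 B D], and [D] is arbitrarily small. *)
Lemma rectint_removable f a b c d (w : C) B r :
  a < complex.Re w < b -> c < complex.Im w < d -> 0 < r ->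
  (forall x y, a <= x <= b -> c <= y <= d -> (x +i* y)%C != w -> cdiff f (x +i* y)%C) ->
  (forall z, z != w -> nc (z - w) < r -> nc (f z) <= B) ->
  rectint f a b c d = 0.
Proof.
case: w => u v /= uab vcd r0 fd fB.
apply/eqP; rewrite -nc_eq0 eq_le nc_ge0 andbT.
apply: (@le0_small _ (16 * `|B|)) => e e0.
(* The entry [r / 3] is there because points of the square are within [2 D] of [w], which must be
   less than [r]; the last four entries keep the square inside the rectangle. *)
pose D := Num.min (Num.min e (r / 3)) (Num.min (Num.min (u - a) (b - u)) (Num.min (v - c) (d - v))).
have D0 : 0 < D by rewrite !lt_min e0 divr_gt0//=; lra.
have : D <= D by []. rewrite {2}/D !le_min => /andP[/andP[De Dr] /andP[/andP[D1 D2] /andP[D3 D4]]].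
rewrite (@rectint_frame _ _ (u - D) (u + D) _ _ (v - D) (v + D)); try lra; last first.
  move=> x y xx yy h; apply: fd => //; apply/eqP => -[xu yv]; apply: h.
  by rewrite xu yv; lra.
have nw x y : u - D <= x <= u + D -> v - D <= y <= v + D ->
    [|| x == u - D, x == u + D, y == v - D | y == v + D] -> (x +i* y)%C != (u +i* v)%C.
  by move=> xx yy h; apply/eqP => -[xu yv]; move: h => /or4P[] /eqP; lra.
have RC : rcont f (u - D) (u + D) (v - D) (v + D).
  by apply: cdiff_rcont; try lra; move=> x y xx yy h; apply: fd; [lra|lra|exact: nw].
apply: (le_trans (rectint_le _ _ RC (B := B) _)); try lra.
  move=> x y xx yy h; apply: fB; first exact: nw.
  rewrite (le_lt_trans (nc_le_ReIm _))//=.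
  have : `|x - u| <= D by rewrite ler_norml; lra.
  have : `|y - v| <= D by rewrite ler_norml; lra.
  lra.
have -> : 4 * (B * (u + D - (u - D) + (v + D - (v - D)))) = D * (16 * B) by ring.
have B1 := ler_norm B.
rewrite (@le_trans _ _ (D * (16 * `|B|)))// ?ler_wpM2l ?ler_wpM2r//; lra.
Qed.

End rectangle_integral.

(** * Cauchy's formula on rectangles *)

Section cauchy_formula.
Context {R : realType}.
Local Notation C := R[i].
Local Notation mu := (@lebesgue_measure R).
Implicit Types (a b c d x y e s : R) (z w : C) (f g : C -> C).

(** The difference quotient [(g z - g w) / (z - w)] is bounded by [|l| + 1] near [w], so its
    singularity is removable. The integral of [1 / (z - w)] stays as a factor and is determined
    separately. *)
Lemma cauchy_formula g a b c d w :
  a < complex.Re w < b -> c < complex.Im w < d ->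
  (forall x y, a <= x <= b -> c <= y <= d -> cdiff g (x +i* y)%C) ->
  rectint (fun z => g z * (z - w)^-1) a b c d =
  g w * rectint (fun z => (z - w)^-1) a b c d.
Proof.
move=> wab wcd gd.
have ab : a <= b by case/andP: wab => h1 h2; apply/ltW/(lt_trans h1).
have cd : c <= d by case/andP: wcd => h1 h2; apply/ltW/(lt_trans h1).
have wE : w = (complex.Re w +i* complex.Im w)%C by case: (w).
have [l lP] : cdiff g w.
  rewrite wE; apply: gd.
    by case/andP: wab => h1 h2; rewrite !ltW.
  by case/andP: wcd => h1 h2; rewrite !ltW.
have [r r0 rP] := lP 1 ltr01.
have nw x y : [|| x == a, x == b, y == c | y == d] -> (x +i* y)%C != w.
  move=> h; apply/eqP => E; move: wab wcd h; rewrite -E /= => h1 h2.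
  by case/or4P => /eqP; lra.
have R1 : rcont (fun z => (z - w)^-1) a b c d.
  by apply: cdiff_rcont => // x y _ _ h; exact/cdiffV/nw.
have R2 : rcont (fun z => g z * (z - w)^-1) a b c d.
  by apply: cdiff_rcont => // x y xx yy h; apply: cdiffM; [exact: gd|exact/cdiffV/nw].
have R3 : rcont (fun z => - g w * (z - w)^-1) a b c d.
  apply: cdiff_rcont => // x y xx yy h.
  by apply: cdiffM; [exact: cdiff_cst|exact/cdiffV/nw].
have := @rectint_removable _ (fun z => (g z - g w) * (z - w)^-1) a b c d w (nc l + 1) r
  wab wcd r0.
have -> : rectint (fun z => (g z - g w) * (z - w)^-1) a b c d =
    rectint (fun z => g z * (z - w)^-1) a b c d +
    - g w * rectint (fun z => (z - w)^-1) a b c d.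
  rewrite (_ : (fun z => (g z - g w) * _) =
    (fun z => g z * (z - w)^-1 + - g w * (z - w)^-1)); last first.
    by apply/funext => z; rewrite mulrBl mulNr.
  by rewrite (rectintD R2 R3); congr (_ + _); exact: rectintZ R1.
move=> E; apply/eqP; rewrite -subr_eq0 -mulNr; apply/eqP; apply: E.
  move=> x y xx yy h; apply: cdiffM; last exact: cdiffV.
  by apply: cdiffB; [exact: gd|exact: cdiff_cst].
move=> z zw zr; have zw0 : z - w != 0 by rewrite subr_eq0.
rewrite ncM ncV ler_pdivrMr ?nc_gt0//.
rewrite -[g z - g w](subrK (l * (z - w))) (le_trans (ncD _ _))// ncM.
rewrite mulrDl mul1r addrC lerD2l.
by rewrite (le_trans (rP _ zr))// mul1r.
Qed.

(* Plays the role of [2 pi i]; only the lower bound [nc_kappa] is needed. *)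
Definition kappa : C := rectint (fun z => z^-1) (-1) 1 (-1) 1.

Lemma cdiff_inv z : z != 0 -> cdiff (@GRing.inv C) z.
Proof.
move=> z0; rewrite (_ : @GRing.inv _ = fun w : C => (w - 0)^-1); first exact: cdiffV.
by apply/funext => w; rewrite subr0.
Qed.

Lemma complex_neq0 x y : x != 0 \/ y != 0 -> (x +i* y)%C != 0.
Proof. by rewrite eq_complex/= negb_and => -[] ->; rewrite ?orbT. Qed.

(** Each side of the square contributes at least 1 to the imaginary part: there the relevant
    component is [1 / (1 + x^2) >= 1/2], over a length 2. *)
Lemma nc_kappa : 4 <= nc kappa.
Proof.
have N1 : (-1 : R) <= 1 by lra.
have rc : rcont (@GRing.inv C) (-1) 1 (-1) 1.
  apply: cdiff_rcont => // x y _ _ h; apply/cdiff_inv/complex_neq0.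
  by case/or4P: h => /eqP ->; rewrite ?oppr_eq0 ?oner_eq0; [left|left|right|right].
case: rc => c1 c2 c3 c4.
have ReV x y : complex.Re (x +i* y)%C^-1 = x / (x ^+ 2 + y ^+ 2) by [].
have ImV x y : complex.Im (x +i* y)%C^-1 = - (y / (x ^+ 2 + y ^+ 2)) by [].
have q1 x : -1 <= x <= 1 -> 2^-1 <= 1 / (x ^+ 2 + 1).
  move=> xx; have x1 : x ^+ 2 <= 1 by rewrite -real_normK ?num_real// exprn_ile1// ler_norml.
  by rewrite mul1r lef_pV2 ?posrE//; have := sqr_ge0 x; lra.
have cst (r : R) : mu.-integrable `[-1, 1] (EFin \o (fun=> r)).
  rewrite (_ : EFin \o _ = EFin \o ((@complex.Re R) \o (fun=> r%:C%C)))//.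
  exact: (scont_integrable_Re (@scont_cst _ (-1) 1 r%:C%C)).
have ge1 (p : R -> R) : mu.-integrable `[-1, 1] (EFin \o p) ->
    (forall x, -1 <= x <= 1 -> 2^-1 <= p x) -> 1 <= Rintegral mu `[-1, 1] p.
  move=> ip pl; have E : Rintegral mu `[-1, 1] (fun=> 2^-1) = 1.
    by rewrite Rintegral_cst//= fine_lebesgue_segment//; lra.
  rewrite -[leLHS]E; apply: le_Rintegral; [by []|exact: cst|exact: ip|].
  by move=> x; rewrite /= in_itv/= => /pl.
have le1 (p : R -> R) : mu.-integrable `[-1, 1] (EFin \o p) ->
    (forall x, -1 <= x <= 1 -> p x <= - 2^-1) -> Rintegral mu `[-1, 1] p <= -1.
  move=> ip pl; have E : Rintegral mu `[-1, 1] (fun=> - 2^-1) = -1.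
    by rewrite Rintegral_cst//= fine_lebesgue_segment//; lra.
  rewrite -[leRHS]E; apply: le_Rintegral; [by []|exact: ip|exact: cst|].
  by move=> x; rewrite /= in_itv/= => /pl.
rewrite (le_trans _ (nc_Im _))// (le_trans _ (ler_norm _))//.
rewrite /kappa /rectint cImD cImD cImN cImM cReD cReN /= mul0r add0r mul1r.
have b1 := ge1 _ (scont_integrable_Im c1).
have b2 := le1 _ (scont_integrable_Im c2).
have b3 := ge1 _ (scont_integrable_Re c3).
have b4 := le1 _ (scont_integrable_Re c4).
have {b1} := b1 _; have {b2} := b2 _; have {b3} := b3 _; have {b4} := b4 _.
move=> b4 b3 b2 b1.
have -> : 4 = 1 - -1 + (1 - -1) :> R by ring.
apply: lerD; apply: lerB.
- by apply: b1 => x xx; rewrite ImV mulNr opprK sqrrN expr1n q1.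
- by apply: b2 => x xx; rewrite ImV expr1n lerN2 q1.
- by apply: b3 => x xx; rewrite ReV expr1n addrC q1.
- by apply: b4 => x xx; rewrite ReV mulNr sqrrN expr1n addrC lerN2 q1.
Qed.

Lemma complex_ext (z : C) : (complex.Re z +i* complex.Im z)%C = z.
Proof. by case: z. Qed.

Lemma nc_ge_edge s x y : 0 <= s -> -s <= x <= s -> -s <= y <= s ->
  [|| x == -s, x == s, y == -s | y == s] -> s <= nc (x +i* y)%C.
Proof.
move=> s0 xx yy h.
have := nc_Re (x +i* y)%C; have := nc_Im (x +i* y)%C => /= h1 h2.
by case/or4P: h => /eqP E; [move: h2|move: h2|move: h1|move: h1];
  rewrite E ?normrN ger0_norm.
Qed.

Lemma rectint_inv0 a b c d : a < 0 < b -> c < 0 < d ->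
  rectint (fun z => z^-1) a b c d = kappa.
Proof.
move=> ab cd.
pose D := Num.min (Num.min 1 (- a)) (Num.min b (Num.min (- c) d)).
have D0 : 0 < D by rewrite !lt_min; lra.
have : D <= D by []. rewrite {2}/D !le_min.
move=> /andP[/andP[D1 D2] /and3P[D3 D4 D5]].
have nz x y : ~ (- D < x < D /\ - D < y < D) -> cdiff (@GRing.inv C) (x +i* y)%C.
  move=> h; apply: cdiff_inv; apply/eqP => -[x0 y0]; apply: h.
  by rewrite x0 y0; lra.
have F p q p' q' : p <= - D -> D <= q -> p' <= - D -> D <= q' ->
    rectint (fun z => z^-1) p q p' q' = rectint (fun z => z^-1) (- D) D (- D) D.
  by move=> h1 h2 h3 h4; apply: rectint_frame => //; [lra|lra|move=> x y _ _ /nz].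
rewrite /kappa (F a) ?(F (-1)) ?lerN2//; lra.
Qed.

(** The difference [1/(z - w) - 1/z = w / (z (z - w))] decays like [|z|^-2]: its integral over the
    square of half-side [S] is independent of [S >= s] by [rectint_frame], and tends to 0 like
    [1/S]. *)
Lemma rectint_inv s w : 0 < s -> nc w <= s / 2 ->
  rectint (fun z => (z - w)^-1) (-s) s (-s) s = kappa.
Proof.
move=> s0 ws.
have sN : -s <= s by lra.
rewrite -(@rectint_inv0 (-s) s (-s) s); [|lra..].
apply/eqP; rewrite -subr_eq0 -nc_eq0 eq_le nc_ge0 andbT.
pose h z : C := w * (z^-1 * (z - w)^-1).
have hd z : z != 0 -> z != w -> cdiff h z.
  move=> z0 zw; apply: cdiffM; first exact: cdiff_cst.
  by apply: cdiffM; [exact: cdiff_inv|exact: cdiffV].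
have wR := nc_Re w; have wI := nc_Im w.
have wR' : - s < complex.Re w < s.
  by rewrite -ltr_norml; lra.
have wI' : - s < complex.Im w < s.
  by rewrite -ltr_norml; lra.
have e0 S x y : s <= S -> [|| x == -S, x == S, y == -S | y == S] -> (x +i* y)%C != 0.
  by move=> sS h0; apply/eqP => -[x0 y0]; move: h0; rewrite x0 y0 => /or4P[] /eqP; lra.
have ew S x y : s <= S -> [|| x == -S, x == S, y == -S | y == S] -> (x +i* y)%C != w.
  move=> sS h0; apply/eqP => E; move: wR' wI' h0; rewrite -E /=.
  by move=> h1 h2 /or4P[] /eqP; lra.
have rh S : s <= S -> rcont h (-S) S (-S) S.
  move=> sS; apply: cdiff_rcont; try lra; move=> x y _ _ h0.
  by apply: hd; [exact: e0 h0|exact: ew h0].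
have -> : rectint (fun z => (z - w)^-1) (-s) s (-s) s -
    rectint (fun z => z^-1) (-s) s (-s) s = rectint h (-s) s (-s) s.
  apply/eqP; rewrite subr_eq addrC -rectintD//; last first.
  - exact: rh.
  - by apply: cdiff_rcont => // x y _ _ h0; apply: cdiff_inv; exact: e0 h0.
  apply/eqP; apply: eq_rectint => // x y _ _ h0; rewrite /h.
  have z0 := e0 s x y (lexx s) h0; have zw := ew s x y (lexx s) h0.
  by field; rewrite z0 subr_eq0 zw.
apply: (@le0_small _ _ (64 * nc w)) => e ep.
pose S := Num.max s e^-1.
have sS : s <= S by rewrite le_max lexx.
have eS : e^-1 <= S by rewrite le_max lexx orbT.
have S0 : 0 < S by lra.
have -> : rectint h (-s) s (-s) s = rectint h (-S) S (-S) S.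
  symmetry; apply: rectint_frame; try lra.
  move=> x y _ _ h0; apply: hd; apply/eqP => E; apply: h0.
    by case: E => -> ->; split; lra.
  by split; [have := wR'|have := wI']; rewrite -E /=.
have SN : - S <= S by lra.
rewrite (le_trans (rectint_le SN SN (rh _ sS) (B := nc w * (S^-1 * (S / 2)^-1)) _))//.
  move=> x y xx yy h0; rewrite /h !ncM !ncV ler_wpM2l ?nc_ge0//.
  have zS := nc_ge_edge (ltW S0) xx yy h0.
  have zwS : S / 2 <= nc ((x +i* y)%C - w).
    have := ncD ((x +i* y)%C - w) w; rewrite subrK; lra.
  rewrite ler_pM ?invr_ge0 ?nc_ge0// lef_pV2 ?posrE//; lra.
have -> : 4 * (nc w * (S^-1 * (S / 2)^-1) * (S - - S + (S - - S))) =
   S^-1 * (32 * nc w) by field; rewrite gt_eqF.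
have : S^-1 <= e by rewrite invf_ple ?posrE.
have w0 := nc_ge0 w; have : 0 <= S^-1 by rewrite invr_ge0 ltW.
move=> h1 h2; rewrite ler_pM//; lra.
Qed.

(** The rectangle and the square of half-side [2 |w| + 1], which is large enough for [rectint_inv],
    both shrink to one small square around [w]. *)
Lemma rectint_inv_gen a b c d w :
  a < complex.Re w < b -> c < complex.Im w < d ->
  rectint (fun z => (z - w)^-1) a b c d = kappa.
Proof.
move=> wab wcd; set s := 2 * nc w + 1.
have n0 := nc_ge0 w; have wR := nc_Re w; have wI := nc_Im w.
have s0 : 0 < s by rewrite /s; lra.
have ws : nc w <= s / 2 by rewrite /s; lra.
rewrite -(rectint_inv s0 ws).
have wR' : - s < complex.Re w < s by rewrite -ltr_norml /s; lra.
have wI' : - s < complex.Im w < s by rewrite -ltr_norml /s; lra.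
move: (complex.Re w) (complex.Im w) (complex_ext w) wab wcd wR' wI' {wR wI} => u v wE.
move=> wab wcd wR wI.
pose D := Num.min (Num.min (Num.min (u - a) (b - u)) (Num.min (v - c) (d - v)))
  (Num.min (Num.min (u + s) (s - u)) (Num.min (v + s) (s - v))).
have D0 : 0 < D by rewrite !lt_min; lra.
have : D <= D by []. rewrite {2}/D !le_min.
move=> /andP[/andP[/andP[D1 D2] /andP[D3 D4]] /andP[/andP[D5 D6] /andP[D7 D8]]].
move: D D0 D1 D2 D3 D4 D5 D6 D7 D8 => D D0 D1 D2 D3 D4 D5 D6 D7 D8.
move: s s0 {ws} wR wI D5 D6 D7 D8 => s s0 wR wI D5 D6 D7 D8.
have nz x y : ~ (u - D < x < u + D /\ v - D < y < v + D) ->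
    cdiff (fun z => (z - w)^-1) (x +i* y)%C.
  move=> h; apply: cdiffV; apply/eqP; rewrite -wE => -[x0 y0]; apply: h.
  by rewrite x0 y0; lra.
have F p q p' q' : p <= u - D -> u + D <= q -> p' <= v - D -> v + D <= q' ->
    rectint (fun z => (z - w)^-1) p q p' q' =
    rectint (fun z => (z - w)^-1) (u - D) (u + D) (v - D) (v + D).
  by move=> h1 h2 h3 h4; apply: rectint_frame => //; [lra|lra|move=> x y _ _ /nz].
have FR := F (- s) s (- s) s.
rewrite FR; [|lra..].
by apply: F; lra.
Qed.

End cauchy_formula.

(** * Taylor remainder and submean inequality in one variable *)

Section cauchy_estimates.
Context {R : realType}.
Local Notation C := R[i].
Local Notation mu := (@lebesgue_measure R).
Local Notation mR := (measurableTypeR R).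

Implicit Types (a b c d x y e s : R) (z w : C) (f g : C -> C).

(** Insert [1/(z - w) = 1/z + w/z^2 + w^2/(z^2 (z - w))] in Cauchy's formula: the terms give [g 0],
    the linear part and the remainder. On the boundary [|z| >= s] and [|z - w| >= s/2], so the last
    integral is at most [32 M / s^2]; dividing by [|kappa| >= 4] leaves the constant 8. *)
Lemma second_order_estimate g s M : 0 < s ->
  (forall x y, -s <= x <= s -> -s <= y <= s -> cdiff g (x +i* y)%C) ->
  (forall x y, -s <= x <= s -> -s <= y <= s -> nc (g (x +i* y)%C) <= M) ->
  exists l, forall w, nc w <= s / 2 ->
    nc (g w - g 0 - l * w) <= 8 * M / s ^+ 2 * nc w ^+ 2.
Proof.
move=> s0 gd gM; have sN : -s <= s by lra.
have k4 := @nc_kappa R.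
have k0 : kappa != 0 :> C by rewrite -nc_gt0; lra.
have bd0 x y : [|| x == -s, x == s, y == -s | y == s] -> (x +i* y)%C != 0.
  by move=> h0; apply/eqP => -[x0 y0]; move: h0; rewrite x0 y0 => /or4P[] /eqP; lra.
pose g1 z : C := g z * z^-1.
pose g2 z : C := g z * (z^-1 * z^-1).
have R1 : rcont g1 (-s) s (-s) s.
  apply: cdiff_rcont => // x y xx yy h0; apply: cdiffM; first exact: gd.
  exact/cdiff_inv/bd0.
have R2 : rcont g2 (-s) s (-s) s.
  apply: cdiff_rcont => // x y xx yy h0; apply: cdiffM; first exact: gd.
  by apply: cdiffM; exact/cdiff_inv/bd0.
have E0 : rectint g1 (-s) s (-s) s = g 0 * kappa.
  have e0 : (fun z : C => (z - 0)^-1) = (fun z => z^-1).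
    by apply/funext => z; rewrite subr0.
  have := @cauchy_formula _ g (-s) s (-s) s 0.
  rewrite (_ : (fun z => g z * (z - 0)^-1) = g1); last first.
    by apply/funext => z; rewrite subr0.
  rewrite e0 rectint_inv0; [|lra..].
  by apply=> //=; lra.
exists (rectint g2 (-s) s (-s) s / kappa) => w ws.
have wR := nc_Re w; have wI := nc_Im w.
have wR' : - s < complex.Re w < s by rewrite -ltr_norml; lra.
have wI' : - s < complex.Im w < s by rewrite -ltr_norml; lra.
have bdw x y : [|| x == -s, x == s, y == -s | y == s] -> (x +i* y)%C != w.
  move=> h0; apply/eqP => E; move: wR' wI' h0; rewrite -E /=.
  by move=> h1 h2 /or4P[] /eqP; lra.
pose g3 z : C := g z * (z^-1 * z^-1 * (z - w)^-1).
have R3 : rcont g3 (-s) s (-s) s.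
  apply: cdiff_rcont => // x y xx yy h0; apply: cdiffM; first exact: gd.
  apply: cdiffM; last exact/cdiffV/bdw.
  by apply: cdiffM; exact/cdiff_inv/bd0.
have E1 : g w * kappa = rectint g1 (-s) s (-s) s + w * rectint g2 (-s) s (-s) s +
    w ^+ 2 * rectint g3 (-s) s (-s) s.
  rewrite -(rectint_inv s0 ws) -cauchy_formula//.
  have R2' : rcont (fun z => w * g2 z) (-s) s (-s) s.
    apply: cdiff_rcont => // x y xx yy h0; apply: cdiffM; first exact: cdiff_cst.
    apply: cdiffM; first exact: gd.
    by apply: cdiffM; exact/cdiff_inv/bd0.
  have R3' : rcont (fun z => w ^+ 2 * g3 z) (-s) s (-s) s.
    apply: cdiff_rcont => // x y xx yy h0; apply: cdiffM; first exact: cdiff_cst.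
    apply: cdiffM; first exact: gd.
    apply: cdiffM; last exact/cdiffV/bdw.
    by apply: cdiffM; exact/cdiff_inv/bd0.
  have R12 : rcont (fun z => g1 z + w * g2 z) (-s) s (-s) s.
    apply: cdiff_rcont => // x y xx yy h0; apply: cdiffD.
      by apply: cdiffM; [exact: gd|exact/cdiff_inv/bd0].
    apply: cdiffM; first exact: cdiff_cst.
    apply: cdiffM; first exact: gd.
    by apply: cdiffM; exact/cdiff_inv/bd0.
  rewrite -(rectintZ w R2) -(rectintZ (w ^+ 2) R3) -(rectintD R1 R2') -(rectintD R12 R3').
  apply: eq_rectint => // x y xx yy h0; rewrite /g1 /g2 /g3.
  have z0 := bd0 x y h0; have zw := bdw x y h0.
  by field; rewrite z0 subr_eq0 zw.
have E2 : g w - g 0 - rectint g2 (-s) s (-s) s / kappa * w =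
    w ^+ 2 * rectint g3 (-s) s (-s) s / kappa.
  apply: (mulIf k0); rewrite [RHS]divfK// !mulrBl E1 E0.
  have G (K A B U W : C) : K != 0 -> A + W * B + U - A - B / K * W * K = U.
    by move=> K0; field.
  exact: G.
rewrite E2 ncM ncV ncM ncX.
have M0 : 0 <= M by rewrite (le_trans (nc_ge0 _) (gM 0 0 _ _))//; lra.
have B3 : nc (rectint g3 (-s) s (-s) s) <= 32 * M / s ^+ 2.
  apply: (le_trans (rectint_le sN sN R3 (B := M * (s^-1 * s^-1 * (s / 2)^-1)) _)).
    move=> x y xx yy h0; rewrite /g3 !ncM !ncV.
    have zs := nc_ge_edge (ltW s0) xx yy h0.
    have zws : s / 2 <= nc ((x +i* y)%C - w).
      by have := ncD ((x +i* y)%C - w) w; rewrite subrK; lra.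
    have i1 : (nc (x +i* y)%C)^-1 <= s^-1 by rewrite lef_pV2 ?posrE//; lra.
    have i2 : (nc ((x +i* y)%C - w))^-1 <= (s / 2)^-1 by rewrite lef_pV2 ?posrE//; lra.
    by do ![apply: ler_pM => //; rewrite ?mulr_ge0 ?invr_ge0 ?nc_ge0//]; exact: gM.
  by rewrite le_eqVlt; apply/orP; left; apply/eqP; field; rewrite gt_eqF.
have kV : (nc (kappa : C))^-1 <= 4^-1 by rewrite lef_pV2 ?posrE//; lra.
have -> : 8 * M / s ^+ 2 * nc w ^+ 2 = nc w ^+ 2 * (32 * M / s ^+ 2) / 4 by field; rewrite gt_eqF.
rewrite ler_pM ?mulr_ge0 ?exprn_ge0 ?invr_ge0 ?nc_ge0//.
by rewrite ler_wpM2l ?exprn_ge0 ?nc_ge0.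
Qed.

(** Markov's inequality: otherwise [phi] would exceed [(X + e) / (b - a)] on the whole segment. The
    slack [e] avoids discussing the case of equality. *)
Lemma exists_le_mean a b (phi : mR -> \bar R) (X : \bar R) e : a < b -> 0 < e ->
  measurable_fun setT phi -> (forall x, 0 <= phi x)%E ->
  (\int[mu]_x phi x <= X)%E ->
  exists2 x, a <= x <= b & ((b - a)%:E * phi x <= X + e%:E)%E.
Proof.
move=> ab e0 mphi phi0 phiX; apply: contrapT => /forall2NP h.
have ba0 : 0 < b - a by rewrite subr_gt0.
have X0 : (0 <= X)%E by rewrite (le_trans _ phiX)// integral_ge0.
have Xfin : X \is a fin_num.
  rewrite ge0_fin_numE// ltey; apply/eqP => Xoo; case: (h a) => [|[]].
    by rewrite lexx ltW.
  by rewrite Xoo addye// leey.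
have big x : a <= x <= b -> (((b - a)^-1 * (fine X + e))%:E <= phi x)%E.
  move=> xx; case: (h x) => // /negP; rewrite -ltNge -[X in (X + _)%E]fineK// => /ltW.
  by move=> hx; rewrite EFinM lee_pdivrMl// EFinD.
have : ((fine X + e)%:E <= (fine X)%:E)%E.
  apply: (@le_trans _ _ (\int[mu]_(x in `[a, b]) ((b - a)^-1 * (fine X + e))%:E)%E).
    rewrite integral_cst//= lebesgue_measure_itv/= lte_fin ab -EFinB -EFinM lee_fin.
    by rewrite mulrAC mulVf ?mul1r ?gt_eqF.
  rewrite fineK//; apply: le_trans phiX.
  apply: (@le_trans _ _ (\int[mu]_(x in `[a, b]) phi x)%E).
    apply: ge0_le_integral => //.
    - move=> x _; rewrite lee_fin mulr_ge0//; first by rewrite invr_ge0 ltW.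
      by rewrite addr_ge0 ?fine_ge0// ltW.
    - exact: measurable_funTS.
  have mI : measurable (`[a, b]%classic : set mR) by exact: measurable_itv.
  exact: (ge0_subset_integral mu mI measurableT mphi (fun x _ => phi0 x) (@subsetT _ _)).
by rewrite lee_fin gerDl leNgt e0.
Qed.

(* Cauchy's formula on a rectangle each of whose sides is chosen, by
   [exists_le_mean], so that the integral of [phi] along it is at most its mean. *)
Lemma submean_square g x0 y0 r (phi : mR * mR -> \bar R) : 0 < r ->
  (forall x y, x0 - r <= x <= x0 + r -> y0 - r <= y <= y0 + r -> cdiff g (x +i* y)%C) ->
  measurable_fun setT phi -> (forall p, 0 <= phi p)%E ->
  (forall x y, x0 - r <= x <= x0 + r -> y0 - r <= y <= y0 + r -> ((nc (g (x +i* y)%C))%:E <= phi (x, y))%E) ->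
  ((nc (g (x0 +i* y0)%C))%:E <= (8 / r ^+ 2)%:E * \int[mu]_x \int[mu]_y phi (x, y))%E.
Proof.
move=> r0 gd mphi phi0 gphi; set w0 := (x0 +i* y0)%C; set X := (\int[mu]_x _)%E.
have X0 : (0 <= X)%E by apply: integral_ge0 => x _; apply: integral_ge0.
have K0 : 0 < 8 / r ^+ 2 by rewrite divr_gt0// exprn_gt0.
have [Xoo|] := eqVneq X +oo%E; first by rewrite Xoo gt0_muley ?leey// lte_fin.
move=> Xoo; have Xfin : X \is a fin_num by rewrite ge0_fin_numE// ltey.
rewrite -(fineK Xfin) -EFinM lee_fin -subr_le0.
apply: (@le0_small _ _ (8 / r ^+ 2)) => e e0; rewrite lerBlDr [e * _]mulrC -mulrDr [e + _]addrC.
have m1 : measurable_fun setT (fun x => \int[mu]_y phi (x, y))%E.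
  exact: (measurable_fun_fubini_tonelli_F (m2 := mu)).
have m2 : measurable_fun setT (fun y => \int[mu]_x phi (x, y))%E.
  exact: (measurable_fun_fubini_tonelli_G (m1 := mu)).
have p1 x : (0 <= \int[mu]_y phi (x, y))%E by apply: integral_ge0.
have p2 y : (0 <= \int[mu]_x phi (x, y))%E by apply: integral_ge0.
have XE : X = (\int[mu]_y \int[mu]_x phi (x, y))%E by rewrite /X fubini_tonelli.
have h1 : x0 - r < x0 - r / 2 by lra.
have h2 : x0 + r / 2 < x0 + r by lra.
have h3 : y0 - r < y0 - r / 2 by lra.
have h4 : y0 + r / 2 < y0 + r by lra.
(* The four sides are chosen in the outer strips of width [r / 2], hence at distance at least
   [r / 2] from the centre. *)
have [u u1 uX] := exists_le_mean h1 e0 m1 p1 (lexx X).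
have [v v1 vX] := exists_le_mean h2 e0 m1 p1 (lexx X).
have X' : (\int[mu]_y \int[mu]_x phi (x, y) <= X)%E by rewrite XE.
have [p pp1 pX] := exists_le_mean h3 e0 m2 p2 X'.
have [q q1 qX] := exists_le_mean h4 e0 m2 p2 X'.
have r2 t : t - r / 2 - (t - r) = r / 2 by field.
have r2' t : t + r - (t + r / 2) = r / 2 by field.
rewrite r2 in uX; rewrite r2 in pX; rewrite r2' in vX; rewrite r2' in qX.
have rr : 0 < r / 2 by rewrite divr_gt0.
have uv : u <= v by lra.
have pq : p <= q by lra.
have bd x y : u <= x <= v -> p <= y <= q -> [|| x == u, x == v, y == p | y == q] ->
    r / 2 <= nc ((x +i* y)%C - w0).
  move=> xx yy h; have := nc_Re ((x +i* y)%C - w0); have := nc_Im ((x +i* y)%C - w0) => /= i1 i2.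
  have A (t : R) : r / 2 <= t \/ t <= - (r / 2) -> r / 2 <= `|t|.
    by case=> tt; [rewrite (le_trans tt)// ler_norm|rewrite -normrN (le_trans _ (ler_norm _))// lerNr].
  have i1' := le_trans (A (y - y0) _) i1; have i2' := le_trans (A (x - x0) _) i2.
  case/or4P: h => /eqP E.
  - by apply: i2'; right; lra.
  - by apply: i2'; left; lra.
  - by apply: i1'; right; lra.
  - by apply: i1'; left; lra.
have box x y : u <= x <= v -> p <= y <= q -> (x0 - r <= x <= x0 + r) /\ (y0 - r <= y <= y0 + r) by lra.
pose g1 z : C := g z * (z - w0)^-1.
have nz x y : u <= x <= v -> p <= y <= q -> [|| x == u, x == v, y == p | y == q] ->
    (x +i* y)%C - w0 != 0.
  by move=> xx yy h; rewrite -nc_gt0 (lt_le_trans rr)// bd.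
have gd1 x y : u <= x <= v -> p <= y <= q -> [|| x == u, x == v, y == p | y == q] ->
    cdiff g1 (x +i* y)%C.
  move=> xx yy h; apply: cdiffM; last by apply: cdiffV; rewrite -subr_eq0 nz.
  by have [? ?] := box x y xx yy; exact: gd.
have [c1 c2 c3 c4] : rcont g1 u v p q by apply: cdiff_rcont.
have gk : rectint g1 u v p q = g w0 * kappa.
  have w1 : u < complex.Re w0 < v by rewrite /=; lra.
  have w2 : p < complex.Im w0 < q by rewrite /=; lra.
  rewrite cauchy_formula// ?rectint_inv_gen// => x y xx yy.
  by have [? ?] := box x y xx yy; exact: gd.
(* One factor [r / 2] is the width of the strip, the other the lower bound of [|z - w0|]. With the 2
   of [cint_le_integral], each side is at most [8 / r^2 (X + e)], and the four sides together are
   compared with [|kappa| >= 4]. *)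
have side (a b : R) (h : R -> C) (psi : mR -> \bar R) : a <= b -> scont a b h ->
    measurable_fun setT psi -> (forall x, 0 <= psi x)%E ->
    (forall x, a <= x <= b -> ((r / 2 * nc (h x))%:E <= psi x)%E) ->
    ((r / 2)%:E * \int[mu]_x psi x <= X + e%:E)%E ->
    nc (cint a b h) <= 8 / r ^+ 2 * (fine X + e).
  move=> ab hc mpsi psi0 hpsi psiX.
  have ih := scont_integrable_nc hc.
  have : ((r / 2 * (r / 2) * Rintegral mu `[a, b] (fun x => nc (h x)))%:E <=
      (fine X + e)%:E)%E.
    rewrite EFinD fineK//; apply: le_trans psiX.
    rewrite -mulrA EFinM; apply: lee_wpmul2l; first by rewrite lee_fin ltW.
    rewrite EFinM fineK; last exact: integrable_fin_num.
    rewrite -ge0_integralZl//.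
    - apply: (@le_trans _ _ (\int[mu]_(x in `[a, b]) psi x)%E).
        apply: ge0_le_integral => //.
        + by move=> x _; rewrite -EFinM lee_fin mulr_ge0 ?nc_ge0// ltW.
        + by apply: measurable_funeM; exact: measurable_int ih.
        + exact: measurable_funTS.
      have mI : measurable (`[a, b]%classic : set mR) by exact: measurable_itv.
      exact: (ge0_subset_integral mu mI measurableT mpsi (fun x _ => psi0 x) (@subsetT _ _)).
    - exact: measurable_int ih.
    - by move=> x _; rewrite lee_fin nc_ge0.
    - by rewrite lee_fin ltW.
  rewrite lee_fin => hI; rewrite (le_trans (cint_le_integral hc))//.
  have -> : 8 / r ^+ 2 * (fine X + e) = 2 * ((r / 2 * (r / 2))^-1 * (fine X + e)).
    by field; rewrite gt_eqF.
  by rewrite ler_pM2l// ler_pdivlMl// mulr_gt0.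
have g1le x y : u <= x <= v -> p <= y <= q -> [|| x == u, x == v, y == p | y == q] ->
    ((r / 2 * nc (g1 (x +i* y)%C))%:E <= phi (x, y))%E.
  move=> xx yy h; have [b1 b2] := box x y xx yy; apply: le_trans (gphi x y b1 b2).
  rewrite lee_fin /g1 ncM ncV mulrA ler_pdivrMr; last by rewrite nc_gt0 nz.
  by rewrite mulrC ler_wpM2l ?nc_ge0// bd.
have mp1 y : measurable_fun setT (fun x => phi (x, y)).
  by apply: measurableT_comp => //; exact: measurable_pair2.
have mp2 x : measurable_fun setT (fun y => phi (x, y)).
  by apply: measurableT_comp => //; exact: measurable_pair1.
have S1 : nc (cint u v (fun x => g1 (x +i* p)%C)) <= 8 / r ^+ 2 * (fine X + e).
  apply: (side _ _ _ (fun x => phi (x, p)) uv c1 (mp1 p) (fun x => phi0 (x, p)) _ pX) => x xx.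
  by apply: g1le => //; rewrite ?lexx ?pq// eqxx !orbT.
have S2 : nc (cint u v (fun x => g1 (x +i* q)%C)) <= 8 / r ^+ 2 * (fine X + e).
  apply: (side _ _ _ (fun x => phi (x, q)) uv c2 (mp1 q) (fun x => phi0 (x, q)) _ qX) => x xx.
  by apply: g1le => //; rewrite ?lexx ?pq// eqxx !orbT.
have S3 : nc (cint p q (fun y => g1 (v +i* y)%C)) <= 8 / r ^+ 2 * (fine X + e).
  apply: (side _ _ _ (fun y => phi (v, y)) pq c3 (mp2 v) (fun y => phi0 (v, y)) _ vX) => x xx.
  by apply: g1le => //; rewrite ?lexx ?uv// eqxx !orbT.
have S4 : nc (cint p q (fun y => g1 (u +i* y)%C)) <= 8 / r ^+ 2 * (fine X + e).
  apply: (side _ _ _ (fun y => phi (u, y)) pq c4 (mp2 u) (fun y => phi0 (u, y)) _ uX) => x xx.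
  by apply: g1le => //; rewrite ?lexx ?uv// eqxx.
have k4 := @nc_kappa R.
have : nc (g w0) * 4 <= 4 * (8 / r ^+ 2 * (fine X + e)).
  apply: (@le_trans _ _ (nc (g w0 * kappa))); first by rewrite ncM ler_wpM2l ?nc_ge0.
  rewrite -gk /rectint (le_trans (ncD _ _))// ncM nci mul1r.
  have := ncB (cint u v (fun x => g1 (x +i* p)%C)) (cint u v (fun x => g1 (x +i* q)%C)).
  have := ncB (cint p q (fun y => g1 (v +i* y)%C)) (cint p q (fun y => g1 (u +i* y)%C)).
  move=> n1 n2; rewrite (le_trans (lerD n2 n1))//.
  apply: (le_trans (lerD (lerD S1 S2) (lerD S3 S4))); set T := 8 / _ * _.
  by rewrite le_eqVlt; apply/orP; left; apply/eqP; ring.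
by rewrite mulrC ler_pM2l.
Qed.

End cauchy_estimates.

(** * Iterated integrals over tuples *)

Section tuple_integrals.
Context d (T : measurableType d) (R : realType).
Variable m : {sigma_finite_measure set T -> \bar R}.
Local Open Scope ereal_scope.

Definition tcons p (x : T) (X : p.-tuple T) : p.+1.-tuple T := [the p.+1.-tuple T of x :: X].

Definition tcat p q (X : p.-tuple T) (Y : q.-tuple T) : (p + q).-tuple T :=
  [tuple of X ++ Y].

Lemma measurable_tcons d' (U : measurableType d') p (f : U -> T) (g : U -> p.-tuple T) :
  measurable_fun setT f -> measurable_fun setT g ->
  measurable_fun setT (fun u => tcons (f u) (g u)).
Proof. by move=> mf mg; exact: measurable_cons. Qed.

Lemma measurable_tcat d' (U : measurableType d') p q (f : U -> p.-tuple T) (g : U -> q.-tuple T) :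
  measurable_fun setT f -> measurable_fun setT g ->
  measurable_fun setT (fun u => tcat (f u) (g u)).
Proof.
move=> mf mg; apply/measurable_fun_tnthP => i.
case: (split_ordP i) => j ->.
  rewrite (_ : _ \o _ = (fun t => tnth t j) \o f); last first.
    by apply/funext => u /=; rewrite tnth_lshift.
  by apply: measurableT_comp => //; exact: measurable_tnth.
rewrite (_ : _ \o _ = (fun t => tnth t j) \o g); last first.
  by apply/funext => u /=; rewrite tnth_rshift.
by apply: measurableT_comp => //; exact: measurable_tnth.
Qed.

Lemma integral_tuple0 (F : 0.-tuple T -> \bar R) : measurable_fun setT F ->
  \int[tuple_measure m 0]_t F t = F [tuple].
Proof.
by move=> mF; rewrite /= integral_dirac// diracE mem_set// mul1e.
Qed.

Lemma integral_tupleS p (F : p.+1.-tuple T -> \bar R) :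
  measurable_fun setT F -> (forall t, 0 <= F t) ->
  \int[tuple_measure m p.+1]_t F t =
  \int[m]_x \int[tuple_measure m p]_t F (tcons x t).
Proof.
move=> mF F0.
transitivity (\int[(m \x tuple_measure m p)%E]_z (F \o @tuple_cons_pair T p) z).
  exact: (ge0_integral_pushforward (@measurable_tuple_cons_pair _ T p)
    (m \x tuple_measure m p) measurableT mF (fun t _ => F0 t)).
rewrite fubini_tonelli1//; last by move=> z; exact: F0.
by apply: measurableT_comp => //; exact: measurable_tuple_cons_pair.
Qed.

Lemma measurable_integral d' (U : measurableType d') p (F : U -> p.-tuple T -> \bar R) :
  measurable_fun setT (fun z : U * p.-tuple T => F z.1 z.2) ->
  (forall u t, 0 <= F u t) ->
  measurable_fun setT (fun u => \int[tuple_measure m p]_t F u t).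
Proof.
move=> mF F0.
exact: (measurable_fun_fubini_tonelli_F (m2 := tuple_measure m p)
  (fun z : U * p.-tuple T => F z.1 z.2) mF (fun z => F0 z.1 z.2)).
Qed.

Lemma measurable_curry_comp d1 d2 d3 (U : measurableType d1) (V : measurableType d2)
    (W : measurableType d3) (F : V -> W -> \bar R) (f : U -> V) (g : U -> W) :
  measurable_fun setT (fun z : V * W => F z.1 z.2) ->
  measurable_fun setT f -> measurable_fun setT g ->
  measurable_fun setT (fun u => F (f u) (g u)).
Proof.
move=> mF mf mg.
have H : measurable_fun setT ((fun z : V * W => F z.1 z.2) \o (fun u => (f u, g u))).
  by apply: measurableT_comp => //; exact: measurable_fun_pair.
exact: H.
Qed.

(** Used with [p = q = n], to separate the real parts from the imaginary parts in [R^2n]. *)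
Lemma integral_tuple_cat p q (F : (p + q).-tuple T -> \bar R) :
  measurable_fun setT F -> (forall t, 0 <= F t) ->
  \int[tuple_measure m (p + q)]_t F t =
  \int[tuple_measure m p]_X \int[tuple_measure m q]_Y F (tcat X Y).
Proof.
elim: p F => [|p IH] F mF F0.
  rewrite integral_tuple0.
    by apply: eq_integral => Y _; congr F; exact: val_inj.
  apply: measurable_integral => //; apply: measurableT_comp => //.
  by apply: measurable_tcat; [exact: measurable_fst|exact: measurable_snd].
have mG : measurable_fun setT (fun X : p.+1.-tuple T =>
    \int[tuple_measure m q]_Y F (tcat X Y)).
  apply: measurable_integral => //; apply: measurableT_comp => //.
  by apply: measurable_tcat; [exact: measurable_fst|exact: measurable_snd].
rewrite [RHS](integral_tupleS mG); last by move=> X; apply: integral_ge0.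
rewrite (@integral_tupleS (p + q)%N F mF F0).
apply: eq_integral => x _; rewrite (IH (fun t => F (tcons x t)))//; last first.
  by apply: (measurableT_comp mF); exact: measurable_tcons.
apply: eq_integral => X _; apply: eq_integral => Y _.
by congr F; exact: val_inj.
Qed.

Definition tupd p (X : p.-tuple T) (j : 'I_p) (x : T) : p.-tuple T :=
  [tuple if i == j then x else tnth X i | i < p].

Lemma tupd0 p (a x : T) (X : p.-tuple T) : tupd (tcons a X) ord0 x = tcons x X.
Proof.
apply: eq_from_tnth => i; rewrite tnth_mktuple.
case: (unliftP ord0 i) => [j|] ->; last by rewrite eqxx.
by rewrite eq_sym (negbTE (neq_lift _ _)) !tnthS.
Qed.

Lemma tupdS p (a x : T) (X : p.-tuple T) j :
  tupd (tcons a X) (lift ord0 j) x = tcons a (tupd X j x).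
Proof.
apply: eq_from_tnth => i; rewrite tnth_mktuple.
case: (unliftP ord0 i) => [k|] ->.
  by rewrite (inj_eq lift_inj) !tnthS tnth_mktuple.
by rewrite (negbTE (neq_lift _ _)).
Qed.

(* A submean inequality in each pair of coordinates iterates, the order of
   integration being restored by Tonelli's theorem. *)
Lemma submean_tuple p (F : p.-tuple T -> p.-tuple T -> \bar R) (A B : p.-tuple T)
    (K : R) : (0 <= K)%R ->
  measurable_fun setT (fun z : p.-tuple T * p.-tuple T => F z.1 z.2) ->
  (forall X Y, 0 <= F X Y) ->
  (forall j X Y, tnth X j = tnth A j -> tnth Y j = tnth B j ->
    F X Y <= K%:E * \int[m]_x \int[m]_y F (tupd X j x) (tupd Y j y)) ->
  F A B <= (K ^+ p)%:E *
    \int[tuple_measure m p]_X \int[tuple_measure m p]_Y F X Y.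
Proof.
move=> K0; elim: p F A B => [|p IH] F A B mF F0 H.
  rewrite expr0 mul1e integral_tuple0; last exact: measurable_integral.
  rewrite integral_tuple0; first by rewrite (tuple0 A) (tuple0 B).
  exact: (measurable_curry_comp mF).
have mFc d1 (U : measurableType d1) (f g : U -> T) (X Y : U -> p.-tuple T) :
    measurable_fun setT f -> measurable_fun setT g ->
    measurable_fun setT X -> measurable_fun setT Y ->
    measurable_fun setT (fun u => F (tcons (f u) (X u)) (tcons (g u) (Y u))).
  by move=> m1 m2 m3 m4; apply: (measurable_curry_comp mF); exact: measurable_tcons.
have AE : A = tcons (thead A) [tuple of behead A] by rewrite {1}(tuple_eta A); exact: val_inj.
have BE : B = tcons (thead B) [tuple of behead B] by rewrite {1}(tuple_eta B); exact: val_inj.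
move: (thead A) [tuple of behead A] (thead B) [tuple of behead B] AE BE => a A' b B' AE BE.
subst A B.
(* The integral over all pairs of coordinates but the first. The induction hypothesis bounds [F] by
   it with the first pair frozen, and [H ord0] integrates that pair. *)
pose I x y := \int[tuple_measure m p]_X \int[tuple_measure m p]_Y F (tcons x X) (tcons y Y).
have I0 x y : 0 <= I x y by do 2 apply: integral_ge0 => ? _.
have mI d1 (U : measurableType d1) (f g : U -> T) :
    measurable_fun setT f -> measurable_fun setT g ->
    measurable_fun setT (fun u => I (f u) (g u)).
  move=> m1 m2; apply: measurable_integral; last by move=> *; apply: integral_ge0.
  apply: measurable_integral => //; apply: mFc => //.
  - by apply: (measurableT_comp m1); exact: measurableT_comp.
  - by apply: (measurableT_comp m2); exact: measurableT_comp.
  - by apply: measurableT_comp.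
have IHI x y : F (tcons x A') (tcons y B') <= (K ^+ p)%:E * I x y.
  apply: (IH (fun X Y => F (tcons x X) (tcons y Y))) => //.
    exact: mFc.
  move=> j X Y XA YB; have := H (lift ord0 j) (tcons x X) (tcons y Y).
  rewrite !tnthS => /(_ XA YB) h; apply: (le_trans h).
  rewrite lee_wpmul2l// ?lee_fin// le_eqVlt; apply/orP; left; apply/eqP.
  by apply: eq_integral => u _; apply: eq_integral => v _; rewrite !tupdS.
have := H ord0 (tcons a A') (tcons b B') (erefl _) (erefl _).
move=> h; apply: (le_trans h); under eq_integral do under eq_integral do rewrite !tupd0.
have Kp0 : (0 <= K ^+ p)%R by rewrite exprn_ge0.
rewrite exprS EFinM -muleA; apply: lee_wpmul2l; first by rewrite lee_fin.
have E : \int[tuple_measure m p.+1]_X \int[tuple_measure m p.+1]_Y F X Y =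
    \int[m]_x \int[m]_y I x y.
  rewrite integral_tupleS; last 2 first.
  - exact: measurable_integral.
  - by move=> X; apply: integral_ge0.
  apply: eq_integral => x _.
  transitivity (\int[tuple_measure m p]_X \int[m]_y \int[tuple_measure m p]_Y
      F (tcons x X) (tcons y Y)).
    apply: eq_integral => X _; rewrite integral_tupleS//.
    exact: (measurable_curry_comp mF).
  rewrite -(@fubini_tonelli _ _ _ _ _ m (tuple_measure m p) (fun z =>
    \int[tuple_measure m p]_Y F (tcons x z.2) (tcons z.1 Y)))//.
    apply: measurable_integral => //; apply: mFc => //.
      by apply: (measurableT_comp measurable_fst); exact: measurable_fst.
    by apply: (measurableT_comp measurable_snd); exact: measurable_fst.
  by move=> z; apply: integral_ge0.
have mJ : measurable_fun setT (fun x => \int[m]_y I x y).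
  apply: (measurable_fun_fubini_tonelli_F (m2 := m) (fun z => I z.1 z.2)) => //.
  exact: mI.
have J0 x : 0 <= \int[m]_y I x y by apply: integral_ge0.
have KE : (0%R <= (K ^+ p)%:E)%E by rewrite lee_fin.
rewrite E -(ge0_integralZl m measurableT mJ (fun x _ => J0 x) KE).
apply: ge0_le_integral => //.
- by move=> x _; apply: integral_ge0.
- apply: (measurable_fun_fubini_tonelli_F (m2 := m)
    (fun z => F (tcons z.1 A') (tcons z.2 B'))) => //.
  exact: mFc.
- exact: measurable_funeM.
move=> x _; have mIx : measurable_fun setT (I x) by exact: mI.
rewrite -(ge0_integralZl m measurableT mIx (fun y _ => I0 x y) KE).
apply: ge0_le_integral => //; first exact: mFc.
exact: measurable_funeM.
Qed.

End tuple_integrals.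

(** * Complex differentiability in several variables *)

Section frechet.
Context {R : realType} {n : nat}.
Local Notation C := R[i].
Local Notation Cn := 'rV[C]_n.
Implicit Types (f g : Cn -> C) (z h u : Cn).

(* The norm of [Cn] takes its values in [C]. *)
Definition mxn h : R := complex.Re (`|h| : C).

Lemma mxnE h : (`|h| : C) = (mxn h)%:C%C.
Proof. by rewrite /mxn RRe_real// realE normr_ge0. Qed.

Lemma mxn_ge0 h : 0 <= mxn h.
Proof. by rewrite -ler0c -mxnE normr_ge0. Qed.

Lemma mxnZ (a : C) h : mxn (a *: h) = nc a * mxn h.
Proof. by apply: (@complexI R); rewrite rmorphM/= -!mxnE normrZ -nc_norm. Qed.

Lemma mxnN h : mxn (- h) = mxn h.
Proof. by rewrite /mxn normrN. Qed.

Lemma mxnD h u : mxn (h + u) <= mxn h + mxn u.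
Proof. by rewrite -lecR rmorphD/= -!mxnE ler_normD. Qed.

Lemma mxn0 : mxn 0 = 0.
Proof. by rewrite /mxn normr0. Qed.

Lemma mxn_eq0 h : (mxn h == 0) = (h == 0).
Proof. by rewrite -[RHS]normr_eq0 mxnE eq_complex/= eqxx andbT. Qed.

Lemma nc_le_mxn h j : nc (h 0 j) <= mxn h.
Proof.
rewrite leNgt; apply/negP => hj.
have : ball (0 : Cn) (nc (h 0 j))%:C%C h.
  by rewrite -ball_normE /= sub0r normrN mxnE ltcR.
by move=> [_ /(_ 0 j)]; rewrite -ball_normE/= mxE sub0r normrN nc_norm ltxx.
Qed.

Lemma mxn_le h (B : R) : 0 <= B -> (forall j, nc (h 0 j) <= B) -> mxn h <= B.
Proof.
move=> B0 hB; have [h0|h0] := eqVneq (mxn h) 0; first by rewrite h0.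
have N0 : mx_norm h != 0.
  rewrite -[mx_norm h]/(`|h| : C) mxnE; apply: contra h0.
  by rewrite eq_complex/= eqxx andbT.
have [[i j] /= E] := mx_norm_neq0 N0.
rewrite -lecR -mxnE -[`|h|]/(mx_norm h) E ord1 nc_norm lecR.
exact: hB.
Qed.

Lemma nbhs_mxn (x : Cn) (P : set Cn) :
  nbhs x P <-> exists2 r : R, 0 < r & forall h, mxn h < r -> P (x + h).
Proof.
split=> [/nbhs_normP[e /= e0 eP]|[r r0 rP]].
  have eR : e = (complex.Re e)%:C%C by rewrite RRe_real// realE ltW.
  exists (complex.Re e); first by rewrite -ltcR -eR.
  move=> h hr; apply: eP; rewrite /= opprD addrA subrr sub0r normrN.
  by rewrite eR mxnE ltcR.
apply/nbhs_ballP; exists r%:C%C; first by rewrite /= ltcR.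
move=> y; rewrite -ball_normE /= -normrN opprB mxnE ltcR => /rP.
by rewrite subrKC.
Qed.

(** Differentiability restated with real radii and a bare function [L] subject to a linearity law,
    so that [L] can be produced as a pointwise limit of derivatives. *)
Definition frechet f z (L : Cn -> C) :=
  (forall a u v, L (a *: u + v) = a * L u + L v) /\
  forall e : R, 0 < e -> exists2 r : R, 0 < r &
    forall h, mxn h < r -> nc (f (z + h) - f z - L h) <= e * mxn h.

Lemma differentiable_frechet f z : differentiable f z -> exists L, frechet f z L.
Proof.
move=> df; exists ('d f z); split; first by move=> a u v; exact: linearP.
move=> e e0; have /diff_locallyP[_ /eqaddoP] := df.
move=> /(_ e%:C%C); rewrite ltcR => /(_ e0) /(nbhs_mxn 0)[r r0 rP].
exists r => // h /rP /=; rewrite add0r !fctE /= mxnE nc_norm -rmorphM lecR.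
by rewrite [h + z]addrC opprD addrA.
Qed.

Lemma linear_le_mxn (L : Cn -> C) : (forall a u v, L (a *: u + v) = a * L u + L v) ->
  exists2 K : R, 0 <= K & forall h, nc (L h) <= K * mxn h.
Proof.
move=> Llin.
have L0 : L 0 = 0.
  have := Llin 1 0 0; rewrite scale1r addr0 mul1r => /eqP.
  by rewrite -subr_eq0 opprD addNKr oppr_eq0 => /eqP.
have LD (I : Type) (s : seq I) (F : I -> Cn) (c : I -> C) :
    L (\sum_(i <- s) c i *: F i) = \sum_(i <- s) c i * L (F i).
  elim: s => [|i s IH]; first by rewrite !big_nil.
  by rewrite !big_cons Llin IH.
exists (\sum_(j < n) nc (L (delta_mx 0 j))).
  by apply: sumr_ge0 => j _; exact: nc_ge0.
move=> h; rewrite {1}(row_sum_delta h) LD mulr_suml.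
have ncs (I : Type) (s : seq I) (F : I -> C) :
    nc (\sum_(i <- s) F i) <= \sum_(i <- s) nc (F i).
  elim: s => [|i s IH]; first by rewrite !big_nil nc0.
  by rewrite !big_cons (le_trans (ncD _ _))// lerD2l.
rewrite (le_trans (ncs _ _ _))//; apply: ler_sum => j _.
by rewrite ncM mulrC ler_wpM2l ?nc_ge0// nc_le_mxn.
Qed.

Lemma frechet_differentiable f z L : frechet f z L -> differentiable f z.
Proof.
move=> [Llin Lf].
pose LL := GRing.isLinear.Build C Cn C *%R L Llin.
pose Lin : {linear Cn -> C} := HB.pack L LL.
have [K K0 LK] := linear_le_mxn Llin.
have Lcont : continuous Lin.
  move=> x; apply/(@cvgrPdist_lt C C^o Cn (nbhs x) (nbhs_filter x) Lin (Lin x)) => e e0.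
  have eR : e = (complex.Re e)%:C%C by rewrite RRe_real// realE ltW.
  have e1 : 0 < complex.Re e by rewrite -ltcR -eR.
  have K1 : 0 < K + 1 by rewrite ltr_wpDl.
  suff : nbhs x (fun t => `|Lin x - Lin t| < e) by [].
  apply/nbhs_mxn; exists (complex.Re e / (K + 1)); first by rewrite divr_gt0.
  move=> h; rewrite ltr_pdivlMr// => xy.
  rewrite -linearB opprD addrA subrr sub0r /= nc_norm eR ltcR.
  rewrite (le_lt_trans (LK _))// mxnN.
  by rewrite (le_lt_trans _ xy)// mulrC ler_wpM2l ?mxn_ge0// lerDl.
have fo : f \o shift z = cst (f z) + Lin +o_ (0 : Cn) id.
  apply/eqaddoP => e e0.
  have eR : e = (complex.Re e)%:C%C by rewrite RRe_real// realE ltW.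
  have e1 : 0 < complex.Re e by rewrite -ltcR -eR.
  have [r r0 rP] := Lf _ e1.
  apply/(nbhs_mxn 0); exists r => // h /rP /=; rewrite add0r !fctE/= mxnE nc_norm.
  by rewrite eR -rmorphM lecR [h + z]addrC opprD addrA.
have dE := diff_unique Lcont fo.
by apply/diff_locallyP; rewrite dE; split.
Qed.

(** The bridge to the one-variable theory. Radii are divided by [mxn u + 1], which is positive even
    for [u = 0]. *)
Lemma frechet_slice f z u (l : C) L : frechet f (z + l *: u) L ->
  cderiv (fun w => f (z + w *: u)) l (L u).
Proof.
move=> [Llin Lf] e e0; have K0 : 0 < mxn u + 1 by rewrite ltr_wpDl ?mxn_ge0.
have L0 : L 0 = 0.
  have := Llin 1 0 0; rewrite scale1r addr0 mul1r => /eqP.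
  by rewrite -subr_eq0 opprD addNKr oppr_eq0 => /eqP.
have [r r0 rP] := Lf _ (divr_gt0 e0 K0).
exists (r / (mxn u + 1)); first by rewrite divr_gt0.
move=> w wl; have := rP ((w - l) *: u).
have -> : z + l *: u + (w - l) *: u = z + w *: u by rewrite -addrA -scalerDl subrKC.
rewrite -[(w - l) *: u]addr0 Llin L0 !addr0 mulrC mxnZ => h.
rewrite (le_trans (h _))//.
  rewrite (@le_lt_trans _ _ (nc (w - l) * (mxn u + 1)))// -?ltr_pdivlMr//.
  by rewrite ler_wpM2l ?nc_ge0// lerDl.
rewrite mulrCA mulrC ler_wpM2r ?nc_ge0// mulrAC ler_pdivrMr//.
by rewrite ler_pM2l// lerDl.
Qed.

Lemma open_mxn (U : set Cn) z : open U -> U z ->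
  exists2 r : R, 0 < r & forall h, mxn h < r -> U (z + h).
Proof.
by rewrite openE => Uo /Uo; rewrite /interior /= => /nbhs_mxn.
Qed.

Lemma mxn_open (U : set Cn) :
  (forall z, U z -> exists2 r : R, 0 < r & forall h, mxn h < r -> U (z + h)) -> open U.
Proof.
by move=> hU; rewrite openE => z /hU ?; apply/nbhs_mxn.
Qed.

Lemma frechet_continuous f z L : frechet f z L -> forall e : R, 0 < e ->
  exists2 r : R, 0 < r & forall h, mxn h < r -> nc (f (z + h) - f z) < e.
Proof.
move=> [Llin Lf] e e0; have [K K0 LK] := linear_le_mxn Llin.
have [r r0 rP] := Lf 1 ltr01; have K1 : 0 < K + 1 by rewrite ltr_wpDl.
exists (Num.min r (e / (K + 1))); first by rewrite lt_min r0 divr_gt0.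
move=> h; rewrite lt_min ltr_pdivlMr// => /andP[/rP h1 h2].
rewrite -[f (z + h) - f z](subrK (L h)) (le_lt_trans (ncD _ _))//.
rewrite (le_lt_trans (lerD h1 (LK h)))// mul1r (le_lt_trans _ h2)//.
by rewrite mulrDr mulr1 addrC mulrC.
Qed.

End frechet.

(** * Borel sets of the complex space and integration on it *)

Section Cn_borel.
Context {R : realType} {n : nat}.
Local Notation C := R[i].
Local Notation Cn := 'rV[C]_n.
Local Notation mR := (measurableTypeR R).
Local Notation mu := (@lebesgue_measure R).
Implicit Types (f : Cn -> C) (z h u : Cn) (U : set Cn).

Lemma measurable_Re_coord j : measurable_fun [set: Cn] (fun z : Cn => complex.Re (z 0 j)).
Proof.
move=> _ B mB; rewrite setTI.
have := @measurable_tnth _ mR (n + n)%N (lshift n j) measurableT B mB; rewrite setTI.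
rewrite [X in _ -> X](_ : _ = measurable (Cn_of_R2n @^-1`
  ((fun z : Cn => complex.Re (z 0 j)) @^-1` B)))//.
by congr measurable; apply/seteqP; split => t /=; rewrite mxE.
Qed.

Lemma measurable_Im_coord j : measurable_fun [set: Cn] (fun z : Cn => complex.Im (z 0 j)).
Proof.
move=> _ B mB; rewrite setTI.
have := @measurable_tnth _ mR (n + n)%N (rshift n j) measurableT B mB; rewrite setTI.
rewrite [X in _ -> X](_ : _ = measurable (Cn_of_R2n @^-1`
  ((fun z : Cn => complex.Im (z 0 j)) @^-1` B)))//.
by congr measurable; apply/seteqP; split => t /=; rewrite mxE.
Qed.

Definition cbox (a b : 'I_n -> R) (r : R) : set Cn :=
  [set z | forall j, a j - r <= complex.Re (z 0 j) <= a j + r /\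
                     b j - r <= complex.Im (z 0 j) <= b j + r].

Lemma measurable_cbox a b r : measurable (cbox a b r).
Proof.
rewrite (_ : cbox a b r = \bigcap_(j in [set: 'I_n])
   (((fun z : Cn => complex.Re (z 0 j)) @^-1` `[a j - r, a j + r]) `&`
    ((fun z : Cn => complex.Im (z 0 j)) @^-1` `[b j - r, b j + r]))).
  apply: fin_bigcap_measurable; first exact: finite_finset.
  move=> j _; apply: measurableI.
    by rewrite -[X in measurable X]setTI; apply: measurable_Re_coord => //; exact: measurable_itv.
  by rewrite -[X in measurable X]setTI; apply: measurable_Im_coord => //; exact: measurable_itv.
apply/seteqP; split => z hz j.
  by move=> _; have [h1 h2] := hz j; split; rewrite /= in_itv.
by have := hz j I; rewrite /= !in_itv.
Qed.

(** The Borel sets being transported from [R^2n], openness has to be expressed by boxes: an open set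
    is the union of the countably many closed boxes with rational centre and half-side [1/(k + 1)]
    that it contains. *)
Lemma open_Cn_measurable U : open U -> measurable U.
Proof.
move=> oU.
pose I := ({ffun 'I_n -> rat} * {ffun 'I_n -> rat} * nat)%type.
pose B (i : I) := cbox (fun j => ratr (i.1.1 j)) (fun j => ratr (i.1.2 j)) (i.2.+1%:R^-1).
pose F i := if pselect (B i `<=` U) then B i else set0.
suff -> : U = \bigcup_(i in [set: I]) F i.
  apply: countable_bigcupT_measurable; first exact: countableP.
  by move=> i; rewrite /F; case: pselect => h; [exact: measurable_cbox|exact: measurable0].
apply/seteqP; split => [z Uz|z [i _]]; last by rewrite /F; case: pselect => // h /h.
have [r r0 rP] := open_mxn oU Uz.
(* A point of the box differs from [z] by at most [2 e] in each real coordinate, [e] being the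
   half-side, hence by at most [4 e] in the sup norm. *)
have [k kr] : exists k : nat, 4 * k.+1%:R^-1 < r.
  have r4 : 0 < r / 4 by rewrite divr_gt0.
  have := near_infty_natSinv_lt (PosNum r4) => -[k _ /(_ k (leqnn k)) /= hk].
  by exists k; rewrite mulrC -ltr_pdivlMr.
set e := k.+1%:R^-1 in kr *; have e0 : 0 < e by rewrite invr_gt0 ltr0n.
have ex (x : R) : exists q : rat, x - e <= ratr q <= x + e.
  have [|q] := @rat_in_itvoo R (x - e) (x + e); first by lra.
  by rewrite in_itv/= => /andP[h1 h2]; exists q; rewrite !ltW.
have [a aP] := choice (fun j => ex (complex.Re (z 0 j))).
have [b bP] := choice (fun j => ex (complex.Im (z 0 j))).
pose i : I := ([ffun j => a j], [ffun j => b j], k).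
have Bi : B i = cbox (fun j => ratr (a j)) (fun j => ratr (b j)) e.
  by apply/seteqP; split => w hw j; have := hw j; rewrite /= !ffunE.
exists i => //; rewrite /F; case: pselect => [hBU|nBU].
  suff : B i z by [].
  rewrite Bi => j; have := aP j; have := bP j.
  by move=> /andP[h1 h2] /andP[h3 h4]; split; apply/andP; split; lra.
exfalso; apply: nBU; rewrite Bi => w hw.
rewrite -[w](subrKC z); apply: rP; apply: le_lt_trans kr.
apply: mxn_le => [|j]; first by rewrite mulr_ge0// ltW.
rewrite (le_trans (nc_le_ReIm _))// !mxE cReD cReN cImD cImN.
have [/andP[h1 h2] /andP[h3 h4]] := hw j.
have /andP[h5 h6] := aP j; have /andP[h7 h8] := bP j.
have -> : 4 * e = 2 * e + 2 * e by ring.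
by apply: lerD; rewrite ler_norml; lra.
Qed.

Lemma real_continuous_measurable U (g : Cn -> R) : open U ->
  (forall z, U z -> forall e : R, 0 < e ->
    exists2 r : R, 0 < r & forall h, mxn h < r -> `|g (z + h) - g z| < e) ->
  measurable_fun U g.
Proof.
move=> oU gc mU; apply: (measurability _ (RGenOInfty.measurableE R)) => //.
move=> _ [_ [x ->] <-]; apply: open_Cn_measurable; apply: mxn_open => z [Uz].
rewrite /= in_itv/= andbT => xg; have [r r0 rP] := open_mxn oU Uz.
have gx : 0 < g z - x by rewrite subr_gt0.
have [s s0 sP] := gc z Uz _ gx.
exists (Num.min r s); first by rewrite lt_min r0.
move=> h; rewrite lt_min => /andP[hr hs]; split; first exact: rP.
have := sP h hs; rewrite /= in_itv/= andbT ltr_norml => /andP[h1 _]; lra.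
Qed.

Definition holo U f := forall z, U z -> exists L, frechet f z L.

Lemma holo_measurable U f (p : C -> R) : open U -> holo U f ->
  (forall v w : C, `|p v - p w| <= nc (v - w)) -> measurable_fun U (fun z => p (f z)).
Proof.
move=> oU hf pl; apply: real_continuous_measurable => // z Uz e e0.
have [L fL] := hf z Uz; have [r r0 rP] := frechet_continuous fL e0.
by exists r => // h /rP; exact: le_lt_trans.
Qed.

Lemma nc_lipschitz (v w : C) : `|nc v - nc w| <= nc (v - w).
Proof.
rewrite ler_norml lerNl opprB !lerBlDr.
by rewrite nc_distC -{1}[w](subrK v) ncD nc_distC -{1}[v](subrK w) ncD.
Qed.

Lemma holo_measurable_sqr U f : open U -> holo U f ->
  measurable_fun U (fun z => (nc (f z) ^+ 2)%:E).
Proof.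
move=> oU hf; apply/measurable_EFinP.
have m1 : measurable_fun U (fun z => nc (f z)).
  exact: (holo_measurable oU hf nc_lipschitz).
by apply: measurable_funX.
Qed.

Lemma measurable_Cn_of_R2n_cat d' (T : measurableType d') (X Y : T -> n.-tuple mR) :
  measurable_fun setT X -> measurable_fun setT Y ->
  measurable_fun setT (fun t => Cn_of_R2n (tcat (X t) (Y t)) : Cn).
Proof.
move=> mX mY; have mc := measurable_tcat mX mY.
exact: (@measurableT_comp _ _ _ _ _ _ _ _ _ (@measurable_Cn_of_R2n R n) mc).
Qed.

Lemma integral_lebesgue_Cn (G : Cn -> \bar R) :
  measurable_fun setT G -> (forall z, 0 <= G z)%E ->
  (\int[@lebesgue_Cn R n]_z G z = \int[tuple_measure mu n]_X
     \int[tuple_measure mu n]_Y G (Cn_of_R2n (tcat X Y)))%E.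
Proof.
move=> mG G0.
transitivity (\int[tuple_measure mu (n + n)]_t (G \o Cn_of_R2n) t)%E.
  exact: (ge0_integral_pushforward (@measurable_Cn_of_R2n R n)
    (tuple_measure mu (n + n)) measurableT mG (fun t _ => G0 t)).
by rewrite integral_tuple_cat//; move=> t; exact: G0.
Qed.

End Cn_borel.

(** * The pointwise bound by the L^2 norm, and finiteness of volumes *)

Section pointwise_bound.
Context {R : realType} {n : nat}.
Local Notation C := R[i].
Local Notation Cn := 'rV[C]_n.
Local Notation mR := (measurableTypeR R).
Local Notation mu := (@lebesgue_measure R).
Implicit Types (f : Cn -> C) (z h u : Cn) (U : set Cn).

Lemma Cn_of_R2n_catE (X Y : n.-tuple mR) j :
  (Cn_of_R2n (tcat X Y) : Cn) 0 j = (tnth X j +i* tnth Y j)%C.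
Proof. by rewrite mxE tnth_lshift tnth_rshift. Qed.

(** Varying one pair of real coordinates moves the point along a complex line: this is how
    [submean_square] supplies the hypothesis of [submean_tuple]. *)
Lemma Cn_of_R2n_upd (X Y : n.-tuple mR) j (x y : R) :
  Cn_of_R2n (tcat (tupd X j x) (tupd Y j y)) =
  (Cn_of_R2n (tcat X Y) - (Cn_of_R2n (tcat X Y) : Cn) 0 j *: delta_mx 0 j) +
  (x +i* y)%C *: delta_mx 0 j :> Cn.
Proof.
apply/rowP => k; rewrite Cn_of_R2n_catE !mxE !tnth_mktuple.
rewrite tnth_lshift tnth_rshift tnth_lshift tnth_rshift eqxx /=.
by case: eqP => [->|_]; rewrite ?mulr1 ?mulr0 ?subrr ?add0r ?subr0 ?addr0.
Qed.

Lemma cbox_sub (z : Cn) r U : 0 < r -> (forall h, mxn h < 4 * r -> U (z + h)) ->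
  cbox (fun j => complex.Re (z 0 j)) (fun j => complex.Im (z 0 j)) r `<=` U.
Proof.
move=> r0 zU w hw; rewrite -[w](subrKC z); apply: zU.
apply: (@le_lt_trans _ _ (2 * r)); last by lra.
apply: mxn_le => [|j]; first by rewrite mulr_ge0// ltW.
rewrite (le_trans (nc_le_ReIm _))// !mxE cReD cReN cImD cImN.
have [/andP[h1 h2] /andP[h3 h4]] := hw j.
rewrite mulr2n mulrDl mul1r.
by apply: lerD; rewrite ler_norml; lra.
Qed.

(** The one-variable inequality concerns the modulus of a holomorphic function; it is applied to
    [f^2] on each coordinate line, to reach [|f|^2]. Each of the [n] pairs of coordinates costs a
    factor [8 / r^2]. *)
Lemma pointwise_bound U z r f : open U -> 0 < r ->
  (forall h, mxn h < 4 * r -> U (z + h)) -> holo U f ->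
  ((nc (f z) ^+ 2)%:E <= ((8 / r ^+ 2) ^+ n)%:E *
     \int[@lebesgue_Cn R n]_(w in U) (nc (f w) ^+ 2)%:E)%E.
Proof.
move=> oU r0 zU hf.
pose a j := complex.Re (z 0 j); pose b j := complex.Im (z 0 j).
have BU : cbox a b r `<=` U by exact: cbox_sub.
have mB : measurable (cbox a b r) by exact: measurable_cbox.
have mU : measurable U by exact: open_Cn_measurable.
have mf := holo_measurable_sqr oU hf.
(* The cut-off to a box makes the integrand measurable everywhere and the submean inequality trivial
   at points outside. If a point of the box has its j-th coordinate at the centre, the square swept
   by that coordinate stays in the box. *)
pose G := (fun w => (nc (f w) ^+ 2)%:E) \_ (cbox a b r).
have G0 w : (0 <= G w)%E.
  by apply: erestrict_ge0 => x _; rewrite lee_fin exprn_ge0 ?nc_ge0.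
have mG : measurable_fun setT G.
  exact: ((measurable_restrictT (fun w => (nc (f w) ^+ 2)%:E) mB).1 (measurable_funS mU BU mf)).
have GE w : cbox a b r w -> G w = (nc (f w) ^+ 2)%:E.
  by move=> Bw; rewrite /G patchE mem_set.
pose F (X Y : n.-tuple mR) := G (Cn_of_R2n (tcat X Y)).
have mF : measurable_fun setT (fun p : n.-tuple mR * n.-tuple mR => F p.1 p.2).
  apply: measurableT_comp => //.
  by apply: measurable_Cn_of_R2n_cat; [exact: measurable_fst|exact: measurable_snd].
pose A : n.-tuple mR := [tuple a j | j < n].
pose B : n.-tuple mR := [tuple b j | j < n].
have AB : Cn_of_R2n (tcat A B) = z.
  by apply/rowP => j; rewrite Cn_of_R2n_catE !tnth_mktuple; exact: complex_ext.
have zB : cbox a b r z by move=> j; rewrite /a /b; split; lra.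
have K0 : 0 <= 8 / r ^+ 2 by rewrite divr_ge0// exprn_ge0// ltW.
have := @submean_tuple _ mR R mu n F A B (8 / r ^+ 2) K0 mF (fun X Y => G0 _).
have FAB : F A B = (nc (f z) ^+ 2)%:E by rewrite /F AB GE.
rewrite -integral_lebesgue_Cn// -integral_mkcond FAB => main.
apply: (le_trans (main _)); last first.
  apply: lee_wpmul2l; first by rewrite lee_fin exprn_ge0.
  by apply: ge0_subset_integral => // w _; rewrite lee_fin exprn_ge0 ?nc_ge0.
move=> j X Y XA YB; set W : Cn := Cn_of_R2n (tcat X Y).
have [BW|nBW] := pselect (cbox a b r W); last first.
  rewrite {1}/F /G patchE memNset//.
  apply: mule_ge0; first by rewrite lee_fin.
  by apply: integral_ge0 => x _; apply: integral_ge0 => y _; exact: G0.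
rewrite {1}/F GE// -/W.
pose z' : Cn := W - W 0 j *: delta_mx 0 j.
have WE : z' + (a j +i* b j)%C *: delta_mx 0 j = W.
  have -> : (a j +i* b j)%C = W 0 j.
    by rewrite Cn_of_R2n_catE XA YB !tnth_mktuple.
  by rewrite /z' subrK.
have VB x y : a j - r <= x <= a j + r -> b j - r <= y <= b j + r ->
    cbox a b r (z' + (x +i* y)%C *: delta_mx 0 j).
  move=> hx hy k; rewrite /z' !mxE eqxx /=.
  case: eqP => [->|_]; last first.
    by rewrite !mulr0 subr0 addr0; have := BW k; rewrite mxE.
  by rewrite !mulr1 subrr add0r.
pose g (w : C) := f (z' + w *: delta_mx 0 j) ^+ 2.
have := @submean_square R g (a j) (b j) r
  (fun p => F (tupd X j p.1) (tupd Y j p.2)) r0.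
have gW : nc (g (a j +i* b j)%C) = nc (f W) ^+ 2 by rewrite /g WE ncX.
rewrite gW; apply.
- move=> x y hx hy; apply: cdiffX.
  have [L fL] := hf _ (BU _ (VB x y hx hy)).
  by exists (L (delta_mx 0 j)); exact: frechet_slice fL.
- have mtu (T : n.-tuple mR) : measurable_fun setT (fun x : mR => tupd T j x).
    apply/measurable_fun_tnthP => k.
    rewrite (_ : _ \o _ = fun x => if k == j then x else tnth T k); last first.
      by apply/funext => x /=; rewrite tnth_mktuple.
    by case: (k == j).
  apply: (measurable_curry_comp mF (f := fun p : mR * mR => tupd X j p.1)
    (g := fun p : mR * mR => tupd Y j p.2)).
    by apply: (measurableT_comp (mtu X)); exact: measurable_fst.
  by apply: (measurableT_comp (mtu Y)); exact: measurable_snd.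
- by move=> p; exact: G0.
- move=> x y hx hy; rewrite /F Cn_of_R2n_upd -/W -/z' GE; last exact: VB.
  by rewrite /g ncX.
Qed.

Definition segind (a b x : R) : R := \1_(`[a, b]%classic : set R) x.

Lemma segind_ge0 (a b x : R) : 0 <= segind a b x.
Proof. by rewrite /segind indicE. Qed.

Lemma measurable_segind (a b : R) : measurable_fun [set: mR] (segind a b : mR -> R).
Proof. by apply: measurable_indic; exact: measurable_itv. Qed.

(** A cube has finite volume. The indicator is written as a product over the coordinates so that the
    integral factors by induction. *)
Lemma tuple_measure_box_fin (a b : R) p :
  (\int[tuple_measure mu p]_t (\prod_(j < p) segind a b (tnth t j))%:E < +oo)%E.
Proof.
have h0 := segind_ge0 a b.
have mh := @measurable_segind a b.
have mprod q : measurable_fun setT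
    (fun t : q.-tuple mR => (\prod_(j < q) segind a b (tnth t j))%:E).
  suff mp : measurable_fun [set: q.-tuple mR]
      (fun t => \prod_(j < q) segind a b (tnth t j)).
    exact/measurable_EFinP.
  apply: (@measurable_prod _ _ R) => j _.
  have mt : measurable_fun [set: q.-tuple mR] (fun t : q.-tuple mR => tnth t j).
    exact: measurable_tnth.
  exact: (measurableT_comp mh mt).
have p0 q (t : q.-tuple mR) : (0 <= (\prod_(j < q) segind a b (tnth t j))%:E)%E.
  by rewrite lee_fin; apply: prodr_ge0.
elim: p => [|p IH].
  by rewrite integral_tuple0// big_ord0 ltry.
rewrite (integral_tupleS _ (mprod p.+1) (p0 p.+1)).
have E x : (\int[tuple_measure mu p]_t
   (\prod_(j < p.+1) segind a b (tnth (tcons x t) j))%:E =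
   (segind a b x)%:E *
   \int[tuple_measure mu p]_t (\prod_(j < p) segind a b (tnth t j))%:E)%E.
  have x0 : (0 <= (segind a b x)%:E)%E by rewrite lee_fin.
  rewrite -(ge0_integralZl _ measurableT (mprod p) (fun t _ => p0 p t) x0).
  apply: eq_integral => t _; rewrite -EFinM big_ord_recl; congr (_ * _)%:E.
  by apply: eq_bigr => j _; rewrite tnthS.
under eq_integral do rewrite E.
set c := (\int[tuple_measure mu p]_t _)%E in IH *.
have c0 : (0 <= c)%E by apply: integral_ge0.
have cfin : c \is a fin_num by rewrite ge0_fin_numE.
under eq_integral do rewrite muleC.
have msE : measurable_fun [set: mR] (fun x => (segind a b x)%:E).
  exact/measurable_EFinP.
have sE0 (x : mR) : [set: mR] x -> (0 <= (segind a b x)%:E)%E by rewrite lee_fin.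
rewrite (ge0_integralZl _ measurableT msE sE0 c0).
rewrite /segind integral_indic//= setIT lebesgue_measure_itv/= -(fineK cfin).
by case: ifP => _; rewrite ?mule0 ?ltry// -EFinB -EFinM ltry.
Qed.

Lemma lebesgue_Cn_bounded_fin U (M : R) : measurable U -> (forall z, U z -> mxn z <= M) ->
  (lebesgue_Cn U < +oo)%E.
Proof.
move=> mU UM.
have mB : measurable (cbox (fun=> 0) (fun=> 0) M : set Cn) by exact: measurable_cbox.
apply: (@le_lt_trans _ _ (lebesgue_Cn (cbox (fun=> 0) (fun=> 0) M : set Cn))).
  apply: le_measure; rewrite ?inE// => z /UM zM j.
  have := nc_Re (z 0 j); have := nc_Im (z 0 j); have := nc_le_mxn z j.
  move=> h1 h2 h3; rewrite -!ler_distl !subr0.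
  by split; [rewrite (le_trans h3)// (le_trans h1)|rewrite (le_trans h2)// (le_trans h1)].
rewrite -[X in lebesgue_Cn X]setIT -integral_indic//.
have mI : measurable_fun [set: Cn]
    (fun z => (\1_(cbox (fun=> 0) (fun=> 0) M : set Cn) z : R)%:E).
  by apply/measurable_EFinP; exact: measurable_indic.
rewrite (integral_lebesgue_Cn mI); last by move=> z; rewrite lee_fin indicE.
pose P (t : n.-tuple mR) := \prod_(j < n) segind (-M) M (tnth t j).
have P0 t : 0 <= P t by apply: prodr_ge0 => j _; exact: segind_ge0.
have mP : measurable_fun setT (fun t => (P t)%:E).
  suff mp : measurable_fun [set: n.-tuple mR] P by exact/measurable_EFinP.
  apply: (@measurable_prod _ _ R) => j _.
  have mh := @measurable_segind (-M) M.
  have mt : measurable_fun [set: n.-tuple mR] (fun t : n.-tuple mR => tnth t j).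
    exact: measurable_tnth.
  exact: (measurableT_comp mh mt).
have fin := tuple_measure_box_fin (-M) M n.
have fP : (\int[tuple_measure mu n]_t (P t)%:E)%E \is a fin_num.
  by rewrite ge0_fin_numE//; apply: integral_ge0 => t _; rewrite lee_fin.
have boxE (X Y : n.-tuple mR) : (\1_(cbox (fun=> 0) (fun=> 0) M : set Cn)
    (Cn_of_R2n (tcat X Y)) = P X * P Y :> R)%R.
  rewrite indicE; have [h|h] := boolP (_ \in _).
    rewrite /P !big1 ?mulr1// => j _; rewrite /segind indicE mem_set//= in_itv/=.
      by have [_] := set_mem h j; rewrite Cn_of_R2n_catE /= sub0r add0r.
    by have [+ _] := set_mem h j; rewrite Cn_of_R2n_catE /= sub0r add0r.
  have [/eqP|PX] := eqVneq (P X) 0; first by move=> /eqP ->; rewrite mul0r.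
  have [/eqP|PY] := eqVneq (P Y) 0; first by move=> /eqP ->; rewrite mulr0.
  exfalso; move/negP: h; apply; rewrite inE => j; rewrite Cn_of_R2n_catE /= sub0r add0r.
  have I (t : n.-tuple mR) : P t != 0 -> -M <= tnth t j <= M.
    rewrite /P (bigD1 j)//= mulf_eq0 negb_or => /andP[+ _].
    rewrite /segind indicE; have [h _|] := boolP (_ \in _); last by rewrite eqxx.
    by move/set_mem: h; rewrite /= in_itv.
  by split; exact: I.
under eq_integral do under eq_integral do rewrite boxE EFinM.
have PE0 (t : n.-tuple mR) : (0 <= (P t)%:E)%E by rewrite lee_fin.
under eq_integral => X _.
  rewrite (ge0_integralZl _ measurableT mP (fun t _ => PE0 t) (PE0 X)) muleC.
  over.
rewrite (ge0_integralZl _ measurableT mP (fun t _ => PE0 t)); last exact: integral_ge0.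
by rewrite -(fineK fP) -EFinM ltry.
Qed.

End pointwise_bound.

(** * Convergence of almost minimal elements *)

Section near_minimizers.
Context {R : realType}.

(* The parallelogram identity makes near-minimizers over a decreasing sequence
   of midpoint-convex sets a Cauchy sequence. *)
Lemma near_minimizers (X : Type) (P : nat -> X -> Prop) (S : X -> R) (D : X -> X -> R)
    (mid : X -> X -> X) (c : R) :
  (forall M, exists2 f, P M f & S f <= c) ->
  (forall M f, P M.+1 f -> P M f) ->
  (forall M f, P M f -> 0 <= S f) ->
  (forall M f g, P M f -> P M g -> P M (mid f g)) ->
  (forall M f g, P M f -> P M g -> D f g = 2 * S f + 2 * S g - 4 * S (mid f g)) ->
  exists F : nat -> X,
    [/\ forall M, P M (F M),
        forall M g, P M g -> S (F M) <= S g + M.+1%:R^-1 &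
        forall e, 0 < e -> exists K : nat,
          forall j k, (K <= j)%N -> (K <= k)%N -> D (F j) (F k) <= e].
Proof.
move=> Pne Pdec S0 Pmid DE.
have PS M j f : (M <= j)%N -> P j f -> P M f.
  move=> /subnKC <-; elim: (j - M)%N => [|i IH]; first by rewrite addn0.
  by rewrite addnS => /Pdec.
pose E M := [set S f | f in P M].
have lbE M : has_lbound (E M) by exists 0 => _ [f Pf <-]; exact: S0 Pf.
have E0 M : E M !=set0 by have [f Pf _] := Pne M; exists (S f), f.
pose d M := inf (E M).
have dS M f : P M f -> d M <= S f by move=> Pf; apply: ge_inf => //; exists f.
have dmono M j : (M <= j)%N -> d M <= d j.
  by move=> Mj; apply: lb_le_inf => // _ [f Pf <-]; exact/dS/(PS _ _ _ Mj).
have dc M : d M <= c by have [f Pf fc] := Pne M; rewrite (le_trans (dS _ _ Pf)).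
have exF M : exists f, P M f /\ S f < d M + M.+1%:R^-1.
  have M0 : 0 < M.+1%:R^-1 :> R by rewrite invr_gt0 ltr0n.
  have [_ [f Pf <-] fd] := inf_adherent M0 (conj (E0 M) (lbE M)).
  by exists f.
have [F FP] := choice exF.
exists F; split.
- by move=> M; case: (FP M).
- move=> M g Pg; have [_ h] := FP M.
  by rewrite (le_trans (ltW h))// lerD2r dS.
(* The infima [d M] increase and stay below [c]; beyond [K1] they are within [e / 16] of their
   supremum. The midpoint of [F j] and [F k] lies in [P K1], so [S] is at least [d K1] there, and
   the identity for [D] leaves at most [e / 2]. *)
move=> e e0; pose T := [set d M | M in [set: nat]].
have hT : has_sup T by split; [exists (d 0%N), 0%N|exists c => _ [M _ <-]].
have e8 : 0 < e / 16 by rewrite divr_gt0.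
have [_ [K1 _ <-] hK1] := sup_adherent e8 hT.
have dsup M : d M <= sup T by apply: ub_le_sup; [case: hT|exists M].
have [K2 hK2] : exists K2 : nat, forall k, (K2 <= k)%N -> k.+1%:R^-1 < e / 16 :> R.
  have := near_infty_natSinv_lt (PosNum e8) => -[K2 _ h].
  by exists K2 => k /h.
exists (maxn K1 K2) => j k; rewrite !geq_max => /andP[j1 j2] /andP[k1 k2].
have [Pj Sj] := FP j; have [Pk Sk] := FP k.
have Qj := PS _ _ _ j1 Pj; have Qk := PS _ _ _ k1 Pk.
rewrite (DE K1)//; have := dS _ _ (Pmid _ _ _ Qj Qk).
have := dsup j; have := dsup k; have := hK2 _ j2; have := hK2 _ k2.
move: Sj Sk hK1; move: (j.+1%:R^-1 : R) (k.+1%:R^-1 : R) (sup T) (d j) (d k) (d K1).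
move: (S (F j)) (S (F k)) (S (mid (F j) (F k))) => *; lra.
Qed.

End near_minimizers.

(** * A minimax bound by descent on a penalty *)

Section minimax.
Context {R : realType}.

(** Second-order upper bound for the function [max(x, 0)^2], whose derivative is [2 max(x, 0)]. *)
Lemma sqr_max0 (x y : R) :
  Num.max (x + y) 0 ^+ 2 <= Num.max x 0 ^+ 2 + 2 * Num.max x 0 * y + y ^+ 2.
Proof.
have [h1|h1] := leP (x + y) 0; have [h2|h2] := leP x 0; nra.
Qed.

(* The penalty [\sum_i max (w i - 2c) 0 ^ 2] decreases at a definite rate along
   the segment to the element provided by the weights proportional to
   [max (w i - 2c) 0], so its infimum over W is 0. *)
Lemma minimax_bound (m : nat) (W : ('I_m.+1 -> R) -> Prop) (c : R) :
  0 <= c ->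
  (forall w i, W w -> 0 <= w i) ->
  (forall u w (t : R), 0 <= t <= 1 -> W u -> W w ->
     W (fun i => (1 - t) * u i + t * w i)) ->
  (forall theta : 'I_m.+1 -> R, (forall i, 0 < theta i) -> \sum_i theta i = 1 ->
     exists2 w, W w & \sum_i theta i * w i <= c) ->
  exists2 w, W w & forall i, w i <= 2 * c + 1.
Proof.
move=> c0 W0 Wconv Wtheta.
have m0 : 0 < m.+1%:R :> R by rewrite ltr0n.
pose b := 2 * c.
pose p (w : 'I_m.+1 -> R) i := Num.max (w i - b) 0.
have p0 w i : 0 <= p w i by rewrite le_max lexx orbT.
pose Phi w := \sum_i p w i ^+ 2.
have Phi0 w : 0 <= Phi w by apply: sumr_ge0 => i _; rewrite exprn_ge0.
have unif : \sum_(i < m.+1) (m.+1%:R^-1 : R) = 1.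
  by rewrite sumr_const card_ord -[LHS]mulr_natl divff// gt_eqF.
have [w0 Ww0 _] : exists2 w, W w & \sum_i m.+1%:R^-1 * w i <= c.
  by apply: Wtheta => [i|]; rewrite ?invr_gt0.
pose E := [set Phi w | w in W].
have hE : has_inf E.
  by split; [exists (Phi w0), w0|exists 0 => _ [w _ <-]].
have dPhi w : W w -> inf E <= Phi w by move=> Ww; apply: ge_inf; [case: hE|exists w].
pose d := inf E.
have d0 : 0 <= d by apply: lb_le_inf; [case: hE|move=> _ [w _ <-]].
suff d00 : d <= 0.
  have [_ [w Ww <-] hw] := inf_adherent ltr01 hE.
  exists w => // i; rewrite -/b.
  have : p w i ^+ 2 < 1.
    apply: (@le_lt_trans _ _ (Phi w)); last by move: hw; rewrite -/d; lra.
    by rewrite /Phi (bigD1 i)//= lerDl; apply: sumr_ge0 => j _; rewrite exprn_ge0.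
  rewrite expr_lt1// => pw; have : w i - b <= p w i by rewrite le_max lexx.
  move: pw; lra.
rewrite leNgt; apply/negP => dpos.
(* [Q] will bound [(u i - w i)^2]: a penalty below [d + 1] gives [w i <= b + (d + 1) + 1], and the
   uniform half of the weights gives [u i <= 2 (m + 1) c]. *)
pose Q := (b + (d + 1) + 1 + 2 * m.+1%:R * c) ^+ 2.
pose B := m.+1%:R * Q + 1.
have Q0 : 0 <= Q by rewrite exprn_ge0// !addr_ge0// ?mulr_ge0// ltW.
have B0 : 0 < B by rewrite ltr_wpDl// mulr_ge0// ltW.
(* This step makes the quadratic term at most [t d], while the linear term lowers the penalty by
   [2 t Phi w >= 2 t d]. Starting from [Phi w < d + t d / 2], the penalty falls below [d], a
   contradiction. *)
pose t := Num.min 1 (d / B).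
have t0 : 0 < t by rewrite lt_min ltr01 divr_gt0.
have t1 : t <= 1 by rewrite ge_min lexx.
have tB : t * B <= d by rewrite -ler_pdivlMr// ge_min lexx orbT.
pose eta := Num.min 1 (t * d / 2).
have eta0 : 0 < eta by rewrite lt_min ltr01 divr_gt0// mulr_gt0.
have [_ [w Ww <-] hw] := inf_adherent eta0 hE.
have wd1 : Phi w < d + 1 by rewrite (lt_le_trans hw)// lerD2l ge_min lexx.
have wd2 : Phi w < d + t * d / 2 by rewrite (lt_le_trans hw)// lerD2l ge_min lexx orbT.
have dw : d <= Phi w by exact: dPhi.
pose s := \sum_i p w i.
have s0 : 0 < s.
  rewrite lt_neqAle sumr_ge0 ?andbT//; apply/eqP => s00.
  have pz i : p w i = 0.
    by have /psumr_eq0P := esym s00; apply.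
  by have : Phi w = 0; [apply: big1 => i _; rewrite pz expr0n|lra].
(* The uniform half makes the weights strictly positive and bounds every [u i]. The other half
   yields only [\sum_i p w i * u i <= 2 c s], which is why the threshold is [b = 2 c]. *)
pose theta i := 2^-1 * (p w i / s) + 2^-1 * m.+1%:R^-1.
have ps0 i : 0 <= 2^-1 * (p w i / s) by rewrite mulr_ge0// divr_ge0// ltW.
have pm0 : 0 < 2^-1 * m.+1%:R^-1 :> R by rewrite mulr_gt0 ?invr_gt0.
have th0 i : 0 < theta i by apply: ltr_wpDl.
have th1 : \sum_i theta i = 1.
  rewrite big_split/= -!mulr_sumr unif -mulr_suml -/s divff ?gt_eqF//; lra.
have [u Wu uc] := Wtheta theta th0 th1.
have uc1 : \sum_i p w i * u i <= s * b.
  have : \sum_i 2^-1 * (p w i / s) * u i <= c.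
    apply: le_trans uc; apply: ler_sum => i _; rewrite ler_wpM2r ?W0// lerDl.
    exact: ltW.
  have -> : \sum_i 2^-1 * (p w i / s) * u i = (2 * s)^-1 * \sum_i p w i * u i.
    by rewrite mulr_sumr; apply: eq_bigr => i _; field; rewrite gt_eqF.
  by rewrite ler_pdivrMl ?mulr_gt0// /b => h; rewrite (le_trans h)// mulrCA mulrA.
have ub i : u i <= 2 * m.+1%:R * c.
  have : 2^-1 * m.+1%:R^-1 * u i <= c.
    apply: le_trans uc; rewrite (bigD1 i)//= -[leLHS]addr0 lerD//.
      by rewrite ler_wpM2r ?W0// lerDr.
    by apply: sumr_ge0 => j _; apply: mulr_ge0; [exact: ltW|exact: W0].
  by rewrite -invfM ler_pdivrMl// mulr_gt0.
have wb i : w i <= b + (d + 1) + 1.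
  have h1 : p w i ^+ 2 <= d + 1.
    rewrite (le_trans _ (ltW wd1))// /Phi (bigD1 i)//= lerDl.
    by apply: sumr_ge0 => j _; rewrite exprn_ge0.
  have h2 : w i - b <= p w i by rewrite le_max lexx.
  have := p0 w i; move: h1 h2; set q := p w i; nra.
have duw i : (u i - w i) ^+ 2 <= Q.
  rewrite -[leLHS]real_normK ?num_real// ler_sqr ?nnegrE ?normr_ge0//; last first.
    by rewrite !addr_ge0// ?mulr_ge0// ltW.
  have := W0 _ i Wu; have := W0 _ i Ww; have := ub i; have := wb i => k1 k2 k3 k4.
  by rewrite ler_norml; apply/andP; split; lra.
have t01 : 0 <= t <= 1 by rewrite ltW.
have := dPhi _ (Wconv w u t t01 Ww Wu); rewrite -/d.
have step : Phi (fun i => (1 - t) * w i + t * u i) <=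
    Phi w + 2 * t * (\sum_i p w i * (u i - w i)) + t ^+ 2 * (m.+1%:R * Q).
  have -> : t ^+ 2 * (m.+1%:R * Q) = \sum_(i < m.+1) t ^+ 2 * Q.
    by rewrite sumr_const card_ord -[RHS]mulr_natl mulrCA.
  rewrite mulr_sumr -!big_split/=; apply: ler_sum => i _.
  rewrite {1}/p (_ : (1 - t) * w i + t * u i - b = (w i - b) + t * (u i - w i)); last by ring.
  rewrite (le_trans (sqr_max0 _ _))// -/(p w i) exprMn.
  rewrite lerD ?ler_wpM2l ?exprn_ge0 ?(ltW t0)//.
  by rewrite lerD2l le_eqVlt; apply/orP; left; apply/eqP; ring.
have inner : \sum_i p w i * (u i - w i) <= - Phi w.
  have E1 : \sum_i p w i * (u i - w i) = \sum_i p w i * u i - s * b -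
      \sum_i p w i * (w i - b).
    rewrite mulr_suml -!sumrB; apply: eq_bigr => i _; ring.
  have E2 : \sum_i p w i * (w i - b) = Phi w.
    apply: eq_bigr => i _; rewrite /p expr2.
    by have [h|h] := leP (w i - b) 0; rewrite ?mul0r.
  by rewrite E1 E2; move: uc1; lra.
have h3 : 2 * t * (\sum_i p w i * (u i - w i)) <= 2 * t * (- Phi w).
  by rewrite ler_wpM2l// mulr_ge0// ltW.
have h4 : t ^+ 2 * (m.+1%:R * Q) <= t * d.
  by rewrite expr2 -mulrA ler_wpM2l ?(ltW t0)// (le_trans _ tB)// ler_wpM2l ?(ltW t0)// lerDl.
have h5 : t * d <= t * Phi w by rewrite ler_wpM2l// ltW.
have td0 : 0 < t * d by rewrite mulr_gt0.
move=> h6; have := le_trans h6 step.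
have -> : Phi w + 2 * t * (\sum_i p w i * (u i - w i)) + t ^+ 2 * (m.+1%:R * Q) =
  Phi w + (2 * t * (\sum_i p w i * (u i - w i)) + t ^+ 2 * (m.+1%:R * Q)) by rewrite addrA.
have h7 := lerD h3 h4.
have E3 : 2 * t * - Phi w = - (t * Phi w) - t * Phi w by ring.
rewrite E3 in h7; move: h5 h7 wd2 td0; move: (t * d) (t * Phi w) (_ + t ^+ 2 * _) (Phi w).
by move=> a1 a2 a3 a4 ? ? ? ? ?; lra.
Qed.

End minimax.

(** * Limits of complex sequences and Taylor estimates in several variables *)

Section complex_limits.
Context {R : realType} {n : nat}.
Local Notation C := R[i].
Local Notation Cn := 'rV[C]_n.

Definition cvC (u : nat -> C) (l : C) := forall e : R, 0 < e ->
  exists K : nat, forall k, (K <= k)%N -> nc (u k - l) <= e.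

(** The limit is the supremum of the eventual lower bounds, that is, the lower limit. *)
Lemma real_cauchy (u : nat -> R) :
  (forall e, 0 < e -> exists K : nat, forall j k, (K <= j)%N -> (K <= k)%N ->
     `|u j - u k| <= e) ->
  exists l, forall e, 0 < e -> exists K : nat, forall k, (K <= k)%N -> `|u k - l| <= e.
Proof.
move=> uc; pose T := [set x | exists K : nat, forall k, (K <= k)%N -> x <= u k].
have up e K : (forall j k, (K <= j)%N -> (K <= k)%N -> `|u j - u k| <= e) ->
    ubound T (u K + e).
  move=> hK x [K' hK']; have := hK' (maxn K K') (leq_maxr _ _).
  have := hK (maxn K K') K (leq_maxl _ _) (leqnn _).
  by rewrite ler_norml; lra.
have lo e K : (forall j k, (K <= j)%N -> (K <= k)%N -> `|u j - u k| <= e) ->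
    T (u K - e).
  move=> hK; exists K => k Kk; have := hK K k (leqnn _) Kk.
  by rewrite ler_norml; lra.
exists (sup T) => e e0; have e2 : 0 < e / 2 by rewrite divr_gt0.
have [K hK] := uc _ e2; exists K => k Kk.
have h1 : sup T <= u K + e / 2.
  by apply: ge_sup; [exists (u K - e / 2); exact: lo|exact: up].
have h2 : u K - e / 2 <= sup T.
  by apply: ub_le_sup; [exists (u K + e / 2); exact: up|exact: lo].
have := hK k K Kk (leqnn _); rewrite !ler_norml; lra.
Qed.

Lemma cvC_cauchy (u : nat -> C) :
  (forall e, 0 < e -> exists K : nat, forall j k, (K <= j)%N -> (K <= k)%N ->
     nc (u j - u k) <= e) ->
  exists l, cvC u l.
Proof.
move=> uc.
have [|a ha] := @real_cauchy (fun k => complex.Re (u k)).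
  move=> e /uc[K hK]; exists K => j k hj hk.
  by rewrite -cReN -cReD (le_trans (nc_Re _))// hK.
have [|b hb] := @real_cauchy (fun k => complex.Im (u k)).
  move=> e /uc[K hK]; exists K => j k hj hk.
  by rewrite -cImN -cImD (le_trans (nc_Im _))// hK.
exists (a +i* b)%C => e e0; have e2 : 0 < e / 2 by rewrite divr_gt0.
have [K1 h1] := ha _ e2; have [K2 h2] := hb _ e2.
exists (maxn K1 K2) => k; rewrite geq_max => /andP[k1 k2].
rewrite (le_trans (nc_le_ReIm _))// cReD cReN cImD cImN/=.
by rewrite [leRHS]splitr lerD ?h1 ?h2.
Qed.

Lemma cvC_le u l (B : R) (K : nat) : cvC u l -> (forall k, (K <= k)%N -> nc (u k) <= B) ->
  nc l <= B.
Proof.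
move=> ul uB; apply/ler_addgt0Pr => e e0; have [K' hK'] := ul e e0.
have -> : l = u (maxn K K') - (u (maxn K K') - l) by rewrite subKr.
by rewrite (le_trans (ncB _ _))// lerD ?uB ?leq_maxl// hK' ?leq_maxr.
Qed.

Lemma cvC_cst l : cvC (fun=> l) l.
Proof. by move=> e e0; exists 0%N => k _; rewrite subrr nc0 ltW. Qed.

Lemma cvCD u v l m : cvC u l -> cvC v m -> cvC (fun k => u k + v k) (l + m).
Proof.
move=> ul vm e e0; have e2 : 0 < e / 2 by rewrite divr_gt0.
have [K1 h1] := ul _ e2; have [K2 h2] := vm _ e2.
exists (maxn K1 K2) => k; rewrite geq_max => /andP[k1 k2].
by rewrite opprD addrACA (le_trans (ncD _ _))// [leRHS]splitr lerD ?h1 ?h2.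
Qed.

Lemma cvCZ u l (a : C) : cvC u l -> cvC (fun k => a * u k) (a * l).
Proof.
move=> ul e e0; have K0 : 0 < nc a + 1 by rewrite ltr_wpDl ?nc_ge0.
have [K h] := ul _ (divr_gt0 e0 K0); exists K => k /h hk.
have a1 : nc a <= nc a + 1 by rewrite lerDl.
rewrite -mulrBr ncM (le_trans (ler_pM (nc_ge0 _) (nc_ge0 _) a1 hk))//.
by rewrite mulrC divfK// gt_eqF.
Qed.

Lemma cvCN u l : cvC u l -> cvC (fun k => - u k) (- l).
Proof.
move=> /(cvCZ (-1)); rewrite mulN1r; congr cvC.
by apply/funext => k; rewrite mulN1r.
Qed.

Lemma cvC_uniq u l m : cvC u l -> cvC u m -> l = m.
Proof.
move=> ul um; apply/eqP; rewrite -subr_eq0 -nc_eq0 eq_le nc_ge0 andbT.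
have := cvCD ul (cvCN um); rewrite (_ : (fun k => _) = fun=> 0); last first.
  by apply/funext => k; rewrite subrr.
by move=> /(cvC_le (B := 0) (K := 0)); apply => k _; rewrite nc0.
Qed.

(* Taylor's formula of order two along complex lines, uniformly in the direction. *)
Lemma slice_estimate (f : Cn -> C) (z : Cn) L (r M : R) : 0 < r ->
  (forall h, mxn h < r -> exists L', frechet f (z + h) L') ->
  (forall h, mxn h < r -> nc (f (z + h)) <= M) ->
  frechet f z L ->
  (forall h, mxn h <= r / 8 ->
     nc (f (z + h) - f z - L h) <= 128 * M / r ^+ 2 * mxn h ^+ 2) /\
  (forall h, nc (L h) <= 32 * M / r * mxn h).
Proof.
move=> r0 fd fM [Llin Lf].
have M0 : 0 <= M by rewrite (le_trans (nc_ge0 _) (fM 0 _))// mxn0.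
have L0 : L 0 = 0.
  have := Llin 1 0 0; rewrite scale1r addr0 mul1r => /eqP.
  by rewrite -subr_eq0 opprD addNKr oppr_eq0 => /eqP.
have LZ a u : L (a *: u) = a * L u by rewrite -[a *: u]addr0 Llin L0 addr0.
have main u : mxn u = 1 -> forall w : C, nc w <= r / 8 ->
    nc (f (z + w *: u) - f z - w * L u) <= 128 * M / r ^+ 2 * nc w ^+ 2.
  move=> u1; pose g (w : C) := f (z + w *: u).
  have wr (w : C) : nc w < r -> mxn (w *: u) < r by rewrite mxnZ u1 mulr1.
  (* The square of half-side [r / 4] lies in the disc of radius [r], and [8 M / (r / 4)^2] is the
     constant [128 M / r^2]. *)
  have s0 : 0 < r / 4 by rewrite divr_gt0.
  have sq x y : - (r / 4) <= x <= r / 4 -> - (r / 4) <= y <= r / 4 ->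
      nc (x +i* y)%C < r.
    move=> hx hy; rewrite (le_lt_trans (nc_le_ReIm _))//=.
    have : `|x| <= r / 4 by rewrite ler_norml.
    have : `|y| <= r / 4 by rewrite ler_norml.
    lra.
  have gd x y : - (r / 4) <= x <= r / 4 -> - (r / 4) <= y <= r / 4 ->
      cdiff g (x +i* y)%C.
    move=> hx hy; have [L' fL'] := fd _ (wr _ (sq x y hx hy)).
    by exists (L' u); exact: frechet_slice fL'.
  have gM x y : - (r / 4) <= x <= r / 4 -> - (r / 4) <= y <= r / 4 ->
      nc (g (x +i* y)%C) <= M.
    by move=> hx hy; exact/fM/wr/sq.
  have [l hl] := second_order_estimate s0 gd gM.
  have g0 : g 0 = f z by rewrite /g scale0r addr0.
  have gL : cderiv g 0 (L u).
    by apply: frechet_slice; rewrite scale0r addr0.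
  set A := 8 * M / (r / 4) ^+ 2 in hl.
  have AE : A = 128 * M / r ^+ 2 by rewrite /A; field; rewrite gt_eqF.
  have r8 : r / 4 / 2 = r / 8 by field.
  (* The coefficient from Cauchy's formula is the derivative: both give the first order of [g] at
     small real [t], so [|l - L u| t <= A t^2 + e t]. *)
  suff lE : l = L u by move=> w wr8; rewrite -AE -g0 mulrC -lE; apply: hl; rewrite r8.
  apply/eqP; rewrite -subr_eq0 -nc_eq0 eq_le nc_ge0 andbT.
  apply: (@le0_small _ _ (1 + A)) => e e0; have [q q0 qP] := gL e e0.
  pose t := Num.min (Num.min e (q / 2)) (r / 4 / 2).
  have t0 : 0 < t by rewrite !lt_min e0 !divr_gt0.
  have te : t <= e by rewrite !ge_min lexx.
  have tq : t < q.
    by rewrite (@le_lt_trans _ _ (q / 2))// ?ge_min ?lexx ?orbT//; lra.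
  have tr : t <= r / 4 / 2 by rewrite ge_min lexx orbT.
  have nt : nc t%:C%C = t by rewrite nc_real gtr0_norm.
  have h1 := hl t%:C%C; rewrite nt in h1; have {}h1 := h1 tr.
  have h2 := qP t%:C%C; rewrite subr0 nt in h2; have {}h2 := h2 tq.
  have : nc ((l - L u) * t%:C%C) <= A * t ^+ 2 + e * t.
    have -> : (l - L u) * t%:C%C = (g t%:C%C - g 0 - L u * t%:C%C) -
      (g t%:C%C - g 0 - l * t%:C%C) by ring.
    by rewrite (le_trans (ncB _ _))// addrC lerD.
  rewrite ncM nt expr2 mulrA -mulrDl ler_pM2r// => h3; rewrite (le_trans h3)//.
  have A0 : 0 <= A.
    by apply: divr_ge0; [exact: mulr_ge0|apply: exprn_ge0; exact: ltW].
  by rewrite mulrDr mulr1 addrC lerD2l mulrC ler_wpM2r.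
have unit (h : Cn) : h != 0 -> exists u : Cn, mxn u = 1 /\ h = (mxn h)%:C%C *: u.
  move=> h0; have mh : mxn h != 0 by rewrite mxn_eq0.
  exists ((mxn h)^-1%:C%C *: h); split.
    by rewrite mxnZ nc_real ger0_norm ?invr_ge0 ?mxn_ge0// mulVf.
  by rewrite scalerA -rmorphM/= divff// scale1r.
split=> h.
  move=> hr; have [->|h0] := eqVneq h 0.
    by rewrite addr0 L0 subrr subr0 nc0 mxn0 expr0n /= mulr0.
  have [u [u1 hE]] := unit h h0.
  have nh : nc (mxn h)%:C%C = mxn h by rewrite nc_real ger0_norm ?mxn_ge0.
  by have := main u u1 (mxn h)%:C%C; rewrite nh -LZ -hE; exact.
have [->|h0] := eqVneq h 0; first by rewrite L0 nc0 mxn0 mulr0.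
have [u [u1 hE]] := unit h h0.
have r80 : 0 < r / 8 by rewrite divr_gt0.
have nr : nc (r / 8)%:C%C = r / 8 by rewrite nc_real gtr0_norm.
have -> : L h = (mxn h)%:C%C * L u by rewrite -LZ -hE.
rewrite ncM nc_real ger0_norm ?mxn_ge0// mulrC ler_wpM2r ?mxn_ge0//.
have hm := main u u1 (r / 8)%:C%C; rewrite nr lexx in hm; have {}hm := hm isT.
(* At [|w| = r / 8] the increment of [f] and the remainder are each at most [2 M]; dividing by
   [r / 8] gives [32 M / r]. *)
have : nc ((r / 8)%:C%C * L u) <= 4 * M.
  have -> : (r / 8)%:C%C * L u = f (z + (r / 8)%:C%C *: u) - f z -
     (f (z + (r / 8)%:C%C *: u) - f z - (r / 8)%:C%C * L u) by rewrite subKr.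
  rewrite (le_trans (ncB _ _))//.
  have k1 : nc (f (z + (r / 8)%:C%C *: u)) <= M.
    by apply: fM; rewrite mxnZ u1 mulr1 nr; lra.
  have k2 : nc (f z) <= M by rewrite -[z]addr0; apply: fM; rewrite mxn0.
  have k3 : 128 * M / r ^+ 2 * (r / 8) ^+ 2 = 2 * M by field; rewrite gt_eqF.
  rewrite k3 in hm.
  by have := ncB (f (z + (r / 8)%:C%C *: u)) (f z); lra.
rewrite ncM nr mulrC -ler_pdivlMr// => hLu; rewrite (le_trans hLu)//.
by rewrite le_eqVlt; apply/orP; left; apply/eqP; field; rewrite gt_eqF.
Qed.

End complex_limits.

(** * The Bergman space and its norm *)

Section bergman.
Context {R : realType} {n : nat} (Omega : set 'rV[R[i]]_n).
Local Notation C := R[i].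
Local Notation Cn := 'rV[C]_n.
Implicit Types (f g : Cn -> C) (z h u : Cn).

Lemma frechet_lin f g z L L' (t : C) : frechet f z L -> frechet g z L' ->
  frechet (fun w => f w + t * g w) z (fun h => L h + t * L' h).
Proof.
move=> [Llin Lf] [Llin' Lf']; split=> [a u v|e e0]; first by rewrite Llin Llin'; ring.
have T0 : 0 < nc t + 1 by rewrite ltr_wpDl ?nc_ge0.
have e2 : 0 < e / 2 by rewrite divr_gt0.
have eT : 0 < e / 2 / (nc t + 1) by rewrite !divr_gt0.
have [r r0 rP] := Lf _ e2; have [s s0 sP] := Lf' _ eT.
exists (Num.min r s); first by rewrite lt_min r0.
move=> h; rewrite lt_min => /andP[/rP h1 /sP h2].
have -> : f (z + h) + t * g (z + h) - (f z + t * g z) - (L h + t * L' h) =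
  (f (z + h) - f z - L h) + t * (g (z + h) - g z - L' h) by ring.
rewrite (le_trans (ncD _ _))// ncM.
have h3 : nc t * nc (g (z + h) - g z - L' h) <= e / 2 * mxn h.
  have t1 : nc t <= nc t + 1 by rewrite lerDl.
  rewrite (le_trans (ler_pM (nc_ge0 _) (nc_ge0 _) t1 h2))//.
  by rewrite mulrA [(nc t + 1) * _]mulrC divfK// gt_eqF.
by rewrite (le_trans (lerD h1 h3))// -mulrDl -splitr.
Qed.

Lemma holomorphic_holo f : holomorphic_on Omega f <-> holo Omega f.
Proof.
split=> hf z Oz; first exact: differentiable_frechet (hf z Oz).
by have [L] := hf z Oz; exact: frechet_differentiable.
Qed.

Lemma holo_lin f g (t : C) : holo Omega f -> holo Omega g ->
  holo Omega (fun w => f w + t * g w).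
Proof.
move=> hf hg z Oz; have [L fL] := hf z Oz; have [L' gL] := hg z Oz.
by exists (fun h => L h + t * L' h); exact: frechet_lin.
Qed.

Lemma holo_cst (k : C) : holo Omega (fun=> k).
Proof.
move=> z _; exists (fun=> 0); split=> [a u v|e e0]; first by rewrite mulr0 addr0.
by exists 1 => // h _; rewrite subrr subr0 nc0 mulr_ge0 ?mxn_ge0 ?ltW.
Qed.

Lemma holoM f g : holo Omega f -> holo Omega g -> holo Omega (fun w => f w * g w).
Proof.
move=> /holomorphic_holo hf /holomorphic_holo hg; apply/holomorphic_holo => z Oz.
exact: (differentiableM (hf z Oz) (hg z Oz)).
Qed.

Context (oO : open Omega) (O0 : Omega !=set0) (bO : bounded_set Omega).

Let mO : measurable Omega := open_Cn_measurable oO.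
Let vol := fine (lebesgue_Cn Omega).
Local Notation mu := (normalized_lebesgue Omega).

Lemma bounded_mxn : exists M : R, forall z, Omega z -> mxn z <= M.
Proof.
have [M [Mreal HM]] := bO; have := HM (M + 1); rewrite ltrDl ltr01 => /(_ isT) h.
exists (complex.Re (M + 1)) => z /h /=; rewrite mxnE lecE => /andP[_].
by [].
Qed.

Lemma volE : lebesgue_Cn Omega = vol%:E.
Proof.
have [M hM] := bounded_mxn.
by rewrite /vol fineK// ge0_fin_numE// (lebesgue_Cn_bounded_fin mO hM).
Qed.

(** For the constant function 1 the pointwise bound reads [1 <= K vol]. *)
Lemma vol_gt0 : 0 < vol.
Proof.
have [z Oz] := O0; have [r r0 rP] := open_mxn oO Oz.
have r40 : 0 < r / 4 by rewrite divr_gt0.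
have H h : mxn h < 4 * (r / 4) -> Omega (z + h) by rewrite mulrC divfK// => /rP.
have := pointwise_bound oO r40 H (holo_cst 1).
have E : (\int[@lebesgue_Cn R n]_(_ in Omega) (nc (1 : C) ^+ 2)%:E = vol%:E)%E.
  by rewrite integral_cst// nc1 expr1n mul1e; exact: volE.
rewrite E nc1 expr1n -EFinM lee_fin => h1.
have v0 : 0 <= vol by exact: fine_ge0.
rewrite lt_neqAle v0 andbT; apply/eqP => v00.
by move: h1; rewrite -v00 mulr0 leNgt ltr01.
Qed.

Lemma integral_mu (p : Cn -> \bar R) : measurable_fun Omega p ->
  (forall z, Omega z -> 0 <= p z)%E ->
  (\int[mu]_(z in Omega) p z = (vol^-1)%:E * \int[@lebesgue_Cn R n]_(z in Omega) p z)%E.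
Proof. by move=> mp p0; rewrite ge0_integral_mscale. Qed.

Lemma mu_Omega : mu Omega = 1%E.
Proof.
transitivity ((vol^-1)%:E * lebesgue_Cn Omega)%E; first by [].
by rewrite volE -EFinM mulVf// gt_eqF// vol_gt0.
Qed.

(** Membership in A^2 is decided by the extended-valued [sqn], while identities are computed with
    the real [nrm2]; [sqnE] relates them. *)
Definition sqn f : \bar R := (\int[mu]_(z in Omega) (nc (f z) ^+ 2)%:E)%E.
Definition berg f := holo Omega f /\ (sqn f < +oo)%E.
Definition nrm2 f : R := Rintegral mu Omega (fun z => nc (f z) ^+ 2).

Lemma BergmanP f : Bergman Omega f <-> berg f.
Proof.
have E : weighted_sqnorm Omega (fun=> 1) f = sqn f.
  by apply: eq_integral => z _; rewrite mulr1.
rewrite /Bergman E; split=> -[h1 h2]; split=> //; exact/holomorphic_holo.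
Qed.

Local Notation int p := (mu.-integrable Omega (EFin \o p)).
Local Notation I := (Rintegral mu Omega).

Lemma int_ge0 (p : Cn -> R) : measurable_fun Omega p -> (forall z, Omega z -> 0 <= p z) ->
  (\int[mu]_(z in Omega) (p z)%:E < +oo)%E -> int p.
Proof.
move=> mp p0 poo; apply/integrableP; split; first exact/measurable_EFinP.
rewrite (eq_integral (fun z => (p z)%:E))// => z /set_mem Oz.
by rewrite /= ger0_norm// p0.
Qed.

Lemma sqn_ge0 f : (0 <= sqn f)%E.
Proof. by apply: integral_ge0 => z _; rewrite lee_fin exprn_ge0 ?nc_ge0. Qed.

Lemma nrm2_ge0 f : 0 <= nrm2 f.
Proof. by apply: Rintegral_ge0 => z _; rewrite exprn_ge0 ?nc_ge0. Qed.

Lemma berg_int f : berg f -> int (fun z => nc (f z) ^+ 2).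
Proof.
move=> [hf foo]; apply: int_ge0 => //.
  by apply/measurable_EFinP; exact: holo_measurable_sqr.
by move=> z _; rewrite exprn_ge0 ?nc_ge0.
Qed.

Lemma sqnE f : berg f -> sqn f = (nrm2 f)%:E.
Proof. by move=> [hf foo]; rewrite /nrm2 fineK// ge0_fin_numE// sqn_ge0. Qed.

Lemma int_berg f : holo Omega f -> int (fun z => nc (f z) ^+ 2) -> berg f.
Proof. by move=> hf fi; split=> //; exact: integrable_lty fi. Qed.

Definition dotRe f g z : R := complex.Re (f z * (g z)^*).
Definition dotIm f g z : R := complex.Im (f z * (g z)^*).

Lemma cRe_conj (w : C) : complex.Re w^* = complex.Re w.
Proof. by case: w. Qed.
Lemma cIm_conj (w : C) : complex.Im w^* = - complex.Im w.
Proof. by case: w. Qed.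
Lemma nc_conj (w : C) : nc w^* = nc w.
Proof. by apply: (@complexI R); rewrite -!nc_norm norm_conjC. Qed.

Lemma dotReE f g z : dotRe f g z =
  complex.Re (f z) * complex.Re (g z) + complex.Im (f z) * complex.Im (g z).
Proof. by rewrite /dotRe cReM cRe_conj cIm_conj mulrN opprK. Qed.

Lemma dotImE f g z : dotIm f g z =
  complex.Im (f z) * complex.Re (g z) - complex.Re (f z) * complex.Im (g z).
Proof. by rewrite /dotIm cImM cRe_conj cIm_conj mulrN addrC. Qed.

Lemma measurable_ReIm f : holo Omega f ->
  measurable_fun Omega (fun z => complex.Re (f z)) /\
  measurable_fun Omega (fun z => complex.Im (f z)).
Proof.
move=> hf; split.
  by apply: (holo_measurable oO hf) => v w; rewrite -cReN -cReD nc_Re.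
by apply: (holo_measurable oO hf) => v w; rewrite -cImN -cImD nc_Im.
Qed.

Lemma int_dom (p q : Cn -> R) : measurable_fun Omega p -> int q ->
  (forall z, Omega z -> `|p z| <= q z) -> int p.
Proof.
move=> mp iq pq; apply: (le_integrable mO _ _ iq); first exact/measurable_EFinP.
by move=> z Oz; rewrite /= lee_fin (le_trans (pq z Oz))// ler_norm.
Qed.

Lemma intD (p q : Cn -> R) : int p -> int q -> int (fun z => p z + q z).
Proof. by move=> ip iq; have := integrableD mO ip iq. Qed.

Lemma intZ (k : R) (p : Cn -> R) : int p -> int (fun z => k * p z).
Proof. by move=> ip; have := integrableZl mO k ip. Qed.

Lemma int_dot f g : berg f -> berg g -> int (dotRe f g) /\ int (dotIm f g).
Proof.
move=> bf bg; have [m1 m2] := measurable_ReIm bf.1; have [m3 m4] := measurable_ReIm bg.1.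
have iq := intD (berg_int bf) (berg_int bg).
have B (w : R) z : w <= nc (f z * (g z)^*) -> w <= nc (f z) ^+ 2 + nc (g z) ^+ 2.
  move=> h; rewrite (le_trans h)// ncM nc_conj.
  have := sqr_ge0 (nc (f z) - nc (g z)); rewrite sqrrB.
  by have := nc_ge0 (f z); have := nc_ge0 (g z); nra.
split.
  apply: (int_dom _ iq) => [|z _]; last by apply: B; exact: nc_Re.
  rewrite (_ : dotRe f g = fun z => complex.Re (f z) * complex.Re (g z) +
     complex.Im (f z) * complex.Im (g z)); last by apply/funext => z; exact: dotReE.
  by apply: measurable_funD; exact: measurable_funM.
apply: (int_dom _ iq) => [|z _]; last by apply: B; exact: nc_Im.
rewrite (_ : dotIm f g = fun z => complex.Im (f z) * complex.Re (g z) -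
   complex.Re (f z) * complex.Im (g z)); last by apply/funext => z; exact: dotImE.
by apply: measurable_funB; exact: measurable_funM.
Qed.

Lemma nc_sqr_lin (a b t : C) : nc (a + t * b) ^+ 2 = nc a ^+ 2 +
  2 * (complex.Re t * complex.Re (a * b^*) + complex.Im t * complex.Im (a * b^*)) +
  nc t ^+ 2 * nc b ^+ 2.
Proof.
rewrite !nc_sqr cReD cImD !cReM !cImM cRe_conj cIm_conj; ring.
Qed.

(** The source of the Hilbert space identities: [t = 1] and [t = -1] give the parallelogram
    identity, and [t] proportional to a scalar product gives Bessel's inequality and
    orthogonality. *)
Lemma nrm2_lin f g (t : C) : berg f -> berg g ->
  berg (fun z => f z + t * g z) /\
  nrm2 (fun z => f z + t * g z) = nrm2 f +
    2 * (complex.Re t * I (dotRe f g) + complex.Im t * I (dotIm f g)) +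
    nc t ^+ 2 * nrm2 g.
Proof.
move=> bf bg; have [i1 i2] := int_dot bf bg.
have i3 := berg_int bf; have i4 := berg_int bg.
have i5 := intD (intZ (complex.Re t) i1) (intZ (complex.Im t) i2).
have i6 := intD i3 (intZ 2 i5); have i7 := intD i6 (intZ (nc t ^+ 2) i4).
have E : (fun z => nc (f z + t * g z) ^+ 2) = fun z => nc (f z) ^+ 2 +
   2 * (complex.Re t * dotRe f g z + complex.Im t * dotIm f g z) +
   nc t ^+ 2 * nc (g z) ^+ 2.
  by apply/funext => z; exact: nc_sqr_lin.
split.
  by apply: int_berg; [exact: holo_lin bf.1 bg.1|rewrite E].
rewrite /nrm2 E (RintegralD mO i6 (intZ _ i4)) (RintegralD mO i3 (intZ 2 i5)).
rewrite (RintegralZl 2 mO i5) (RintegralD mO (intZ _ i1) (intZ _ i2)).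
by rewrite !RintegralZl.
Qed.

Lemma nrm2_scale f (t : C) : berg f ->
  berg (fun z => t * f z) /\ nrm2 (fun z => t * f z) = nc t ^+ 2 * nrm2 f.
Proof.
move=> bf; have i1 := berg_int bf.
have E : (fun z => nc (t * f z) ^+ 2) = fun z => nc t ^+ 2 * nc (f z) ^+ 2.
  by apply/funext => z; rewrite ncM exprMn.
split; last by rewrite /nrm2 E RintegralZl.
apply: int_berg; last by rewrite E; exact: intZ.
by apply: holoM; [exact: holo_cst|exact: bf.1].
Qed.

(** The factors [1] here and [-1] in [dif] make the sums literal instances of [nrm2_lin]. *)
Definition mid f g z : C := 2^-1 * (f z + 1 * g z).
Definition dif f g z : C := f z + -1 * g z.

Lemma berg_mid f g : berg f -> berg g -> berg (mid f g).
Proof. by move=> bf bg; apply: (nrm2_scale _ _).1; exact: (nrm2_lin 1 bf bg).1. Qed.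

Lemma nrm2_dif f g : berg f -> berg g ->
  nrm2 (dif f g) = 2 * nrm2 f + 2 * nrm2 g - 4 * nrm2 (mid f g).
Proof.
move=> bf bg; have [b1 e1] := nrm2_lin 1 bf bg; have [b2 e2] := nrm2_lin (-1) bf bg.
have [_ e3] := nrm2_scale 2^-1 b1.
rewrite /dif /mid e2 e3 e1 ncN nc1 ncV nc2.
have -> : complex.Re (1 : C) = 1 by []. have -> : complex.Im (1 : C) = 0 by [].
have -> : complex.Re (-1 : C) = -1 by []. have -> : complex.Im (-1 : C) = 0 by rewrite /= oppr0.
by field.
Qed.

Lemma berg_bounded f (B : R) : holo Omega f -> (forall z, Omega z -> nc (f z) <= B) -> berg f.
Proof.
move=> hf fB; apply: int_berg => //.
apply: (int_dom (q := fun=> B ^+ 2)).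
- by apply/measurable_EFinP; exact: holo_measurable_sqr.
- apply: int_ge0 => //; first by move=> z _; exact: sqr_ge0.
  by rewrite integral_cst// mu_Omega mule1 ltry.
- move=> z Oz; rewrite ger0_norm ?exprn_ge0 ?nc_ge0//.
  by rewrite ler_sqr ?nnegrE ?nc_ge0 ?fB// (le_trans (nc_ge0 _) (fB z Oz)).
Qed.

(** Point evaluations are bounded uniformly near [z] and over all [f]. Of the radius of a ball in
    [Omega], one half is left for [h] and the other is the room [4 (r / 8)] that [pointwise_bound]
    asks around [z + h]. *)
Lemma berg_bound z : Omega z -> exists r A : R, [/\ 0 < r, 0 <= A,
  forall h, mxn h < r -> Omega (z + h) &
  forall f, berg f -> forall h, mxn h < r -> nc (f (z + h)) ^+ 2 <= A * nrm2 f].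
Proof.
move=> Oz; have [r r0 rP] := open_mxn oO Oz.
have r80 : 0 < r / 8 by rewrite divr_gt0.
exists (r / 2), ((8 / (r / 8) ^+ 2) ^+ n * vol); split.
- by rewrite divr_gt0.
- by rewrite mulr_ge0 ?(ltW vol_gt0)// exprn_ge0// divr_ge0// exprn_ge0// ltW.
- by move=> h hr; apply: rP; lra.
move=> f bf h hr.
have H h' : mxn h' < 4 * (r / 8) -> Omega (z + h + h').
  by move=> hr'; rewrite -addrA; apply: rP; rewrite (le_lt_trans (mxnD _ _))//; lra.
have := pointwise_bound oO r80 H bf.1.
have -> : (\int[@lebesgue_Cn R n]_(w in Omega) (nc (f w) ^+ 2)%:E = (vol * nrm2 f)%:E)%E.
  rewrite EFinM -(sqnE bf) /sqn integral_mu.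
  - by rewrite muleA -EFinM divff ?mul1e// gt_eqF// vol_gt0.
  - exact: holo_measurable_sqr bf.1.
  - by move=> w _; rewrite lee_fin exprn_ge0 ?nc_ge0.
by rewrite -EFinM lee_fin mulrA.
Qed.

End bergman.

(** * Completeness of the Bergman space and existence of its kernel *)

Section bergman_kernel.
Context {R : realType} {n : nat} (Omega : set 'rV[R[i]]_n).
Local Notation C := R[i].
Local Notation Cn := 'rV[C]_n.
Implicit Types (f g : Cn -> C) (z h u : Cn).
Context (oO : open Omega) (O0 : Omega !=set0) (bO : bounded_set Omega).
Local Notation mu := (normalized_lebesgue Omega).
Local Notation berg := (berg Omega).
Local Notation N := (nrm2 Omega).
Local Notation I := (Rintegral mu Omega).

Let mO : measurable Omega := open_Cn_measurable oO.

(** Applied to [F j - F k], [slice_estimate] makes the derivatives [L k] a Cauchy sequence; applied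
    to [F k], it gives a quadratic remainder uniform in [k], which survives the passage to the
    limit. *)
Lemma berg_limit_frechet (F : nat -> Cn -> C) (f : Cn -> C) (c : R) z :
  (forall k, berg (F k)) -> (forall k, N (F k) <= c) ->
  (forall e, 0 < e -> exists K : nat, forall j k, (K <= j)%N -> (K <= k)%N ->
     N (dif (F j) (F k)) <= e) ->
  (forall w, Omega w -> cvC (F^~ w) (f w)) ->
  Omega z -> exists L, frechet f z L.
Proof.
move=> bF Fc FC Ff Oz.
have [r [A [r0 A0 rO rA]]] := berg_bound oO O0 bO Oz.
have bD j k : berg (dif (F j) (F k)) by exact: (nrm2_lin oO _ (bF j) (bF k)).1.
have [L LP] := choice (fun k => (bF k).1 z Oz).
have x2 (x y : R) : 0 <= x -> 0 <= y -> x ^+ 2 <= y ^+ 2 -> x <= y.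
  by move=> hx hy; rewrite ler_sqr.
have unif e : 0 < e -> exists K : nat, forall j k, (K <= j)%N -> (K <= k)%N ->
    forall h, nc (L j h - L k h) <= e * mxn h.
  move=> e0; pose e' := e * r / 32.
  have e'0 : 0 < e' by rewrite divr_gt0// mulr_gt0.
  have A1 : 0 < A + 1 by rewrite ltr_wpDl.
  have [K hK] := FC (e' ^+ 2 / (A + 1)) (divr_gt0 (exprn_gt0 2 e'0) A1).
  exists K => j k hj hk h.
  have hM h' : mxn h' < r -> nc (dif (F j) (F k) (z + h')) <= e'.
    move=> hr; apply: x2; rewrite ?nc_ge0 ?(ltW e'0)//.
    rewrite (le_trans (rA _ (bD j k) h' hr))//.
    rewrite (@le_trans _ _ (A * (e' ^+ 2 / (A + 1))))// ?ler_wpM2l ?hK//.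
    by rewrite mulrA ler_pdivrMr// mulrC ler_wpM2l ?sqr_ge0// lerDl.
  have fd h' : mxn h' < r -> exists L', frechet (dif (F j) (F k)) (z + h') L'.
    by move=> /rO; exact: (bD j k).1.
  have [_ /(_ h)] := slice_estimate r0 fd hM (frechet_lin (-1) (LP j) (LP k)).
  rewrite mulN1r (_ : 32 * e' / r = e)//.
  by rewrite /e'; field; rewrite gt_eqF.
have exL h : exists l, cvC (L^~ h) l.
  apply: cvC_cauchy => e e0.
  have K0 : 0 < mxn h + 1 by rewrite ltr_wpDl ?mxn_ge0.
  have [K hK] := unif _ (divr_gt0 e0 K0); exists K => j k hj hk.
  rewrite (le_trans (hK _ _ hj hk h))// mulrAC ler_pdivrMr// ler_pM2l//.
  by rewrite lerDl.
have [L0 L0P] := choice exL.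
(* From [|F k|^2 <= A c] follows [|F k| <= A c + 1], which saves a square root. *)
pose M := A * c + 1.
have N0 k : 0 <= N (F k) by exact: nrm2_ge0.
have c0 : 0 <= c by exact: le_trans (Fc 0%N).
have M0 : 0 <= M by rewrite addr_ge0// mulr_ge0.
have FM k h : mxn h < r -> nc (F k (z + h)) <= M.
  move=> hr; have := rA _ (bF k) h hr.
  have : A * N (F k) <= A * c by rewrite ler_wpM2l.
  rewrite /M; have := nc_ge0 (F k (z + h)); have := mulr_ge0 A0 c0.
  move: (nc _) (A * N (F k)) (A * c) => x y w; nra.
pose B := 128 * M / r ^+ 2.
have B0 : 0 <= B by apply: divr_ge0; [exact: mulr_ge0|exact: sqr_ge0].
exists L0; split.
  move=> a u v; apply: (cvC_uniq (L0P (a *: u + v))).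
  rewrite (_ : L^~ _ = fun k => a * L k u + L k v).
    by apply: cvCD => //; exact: cvCZ.
  by apply/funext => k; have [+ _] := LP k; apply.
move=> e e0; have B1 : 0 < B + 1 by rewrite ltr_wpDl.
exists (Num.min (r / 8) (e / (B + 1))); first by rewrite lt_min !divr_gt0.
move=> h; rewrite lt_min => /andP[h8 he]; rewrite ltr_pdivlMr// in he.
have hr : mxn h < r by lra.
have est k : nc (F k (z + h) - F k z - L k h) <= B * mxn h ^+ 2.
  have fd h' : mxn h' < r -> exists L', frechet (F k) (z + h') L'.
    by move=> /rO; exact: (bF k).1.
  by have [+ _] := slice_estimate r0 fd (FM k) (LP k); apply; exact: ltW.
have lim : cvC (fun k => F k (z + h) - F k z - L k h) (f (z + h) - f z - L0 h).
  by apply: cvCD; [apply: cvCD; [exact/Ff/rO|exact/cvCN/Ff]|exact/cvCN/L0P].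
rewrite (le_trans (cvC_le (K := 0%N) lim (fun k _ => est k)))//.
rewrite expr2 mulrA ler_wpM2r ?mxn_ge0// (le_trans _ (ltW he))// mulrC.
by rewrite ler_wpM2l ?mxn_ge0// lerDl.
Qed.

(** Fatou's lemma, for the sequence shifted by [K0] because the norms are bounded by [b] only from
    there on. *)
Lemma berg_limit_fatou (F : nat -> Cn -> C) (f : Cn -> C) (b : R) (K0 : nat) :
  (forall k, berg (F k)) -> holo Omega f ->
  (forall w, Omega w -> cvC (F^~ w) (f w)) ->
  (forall k, (K0 <= k)%N -> N (F k) <= b) -> (sqn Omega f <= b%:E)%E.
Proof.
move=> bF hf Ff Fb.
pose G (k : nat) z := (nc (F (K0 + k)%N z) ^+ 2)%:E.
have mG k : measurable_fun Omega (G k).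
  by apply: holo_measurable_sqr => //; exact: (bF _).1.
have G0 k z : Omega z -> (0 <= G k z)%E.
  by move=> _; rewrite lee_fin exprn_ge0 ?nc_ge0.
have lim z : Omega z -> limn_einf (G^~ z) = (nc (f z) ^+ 2)%:E.
  move=> Oz.
  have c1 : (fun k => nc (F (K0 + k)%N z)) @ \oo --> nc (f z).
    apply/cvgrPdist_le => e e0; have [K hK] := Ff z Oz e e0.
    exists K => // k /= Kk; rewrite distrC (le_trans (nc_lipschitz _ _))// hK//.
    by rewrite (leq_trans Kk)// leq_addl.
  have c2 := cvgM c1 c1.
  have c3 : (fun k => G k z) @ \oo --> (nc (f z) ^+ 2)%:E.
    by rewrite expr2; apply: cvg_EFin; [exact: nearW|exact: c2].
  by have [] := cvg_limn_einf_sup c3.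
have := fatou mu mO mG G0.
rewrite (eq_integral (fun z => (nc (f z) ^+ 2)%:E)); last first.
  by move=> z /set_mem Oz; exact: lim.
move=> h; apply: (le_trans h); rewrite limn_einf_lim.
apply: lime_le; first exact: is_cvg_einfs.
apply: nearW => k.
have ek : (einfs (fun k => \int[mu]_(z in Omega) G k z) k <=
    \int[mu]_(z in Omega) G k z)%E.
  by apply: ereal_inf_lbound; exists k => //=.
apply: (le_trans ek).
rewrite -[X in (X <= _)%E]/(sqn Omega (F (K0 + k)%N)) sqnE// lee_fin.
by apply: Fb; exact: leq_addr.
Qed.

(** Completeness of A^2 with a pointwise limit. The last clause, lower semicontinuity of the norm,
    is what lets the limit inherit almost minimality. *)
Lemma berg_limit (F : nat -> Cn -> C) (c : R) :
  (forall k, berg (F k)) -> (forall k, N (F k) <= c) ->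
  (forall e, 0 < e -> exists K : nat, forall j k, (K <= j)%N -> (K <= k)%N ->
     N (dif (F j) (F k)) <= e) ->
  exists f, [/\ berg f, forall w, Omega w -> cvC (F^~ w) (f w) &
    forall b (K0 : nat), (forall k, (K0 <= k)%N -> N (F k) <= b) -> N f <= b].
Proof.
move=> bF Fc FC.
have ex z : exists l, Omega z -> cvC (F^~ z) l.
  have [Oz|nOz] := pselect (Omega z); last by exists 0.
  have [r [A [r0 A0 rO rA]]] := berg_bound oO O0 bO Oz.
  have [|l hl] := @cvC_cauchy R (F^~ z); last by exists l.
  move=> e e0; have A1 : 0 < A + 1 by rewrite ltr_wpDl.
  have [K hK] := FC (e ^+ 2 / (A + 1)) (divr_gt0 (exprn_gt0 2 e0) A1).
  exists K => j k hj hk.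
  have bD : berg (dif (F j) (F k)) by exact: (nrm2_lin oO _ (bF j) (bF k)).1.
  have := rA _ bD 0; rewrite mxn0 addr0 => /(_ r0); rewrite /dif mulN1r => h.
  rewrite -ler_sqr ?nnegrE ?nc_ge0 ?(ltW e0)// (le_trans h)//.
  rewrite (@le_trans _ _ (A * (e ^+ 2 / (A + 1))))//.
    by rewrite ler_wpM2l//; exact: hK.
  by rewrite mulrA ler_pdivrMr// mulrC ler_wpM2l ?sqr_ge0// lerDl.
have [f fP] := choice ex.
have hf : holo Omega f by move=> z Oz; exact: (berg_limit_frechet bF Fc FC fP Oz).
have bf : berg f.
  split=> //; apply: (@le_lt_trans _ _ c%:E); last exact: ltry.
  by apply: (@berg_limit_fatou F f c 0) => // k _.
exists f; split=> // b K0 hb.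
by rewrite -lee_fin -sqnE//; exact: (@berg_limit_fatou F f b K0).
Qed.

Lemma dotRe_self f z : dotRe f f z = nc (f z) ^+ 2.
Proof. by rewrite dotReE nc_sqr !expr2. Qed.

Lemma dotIm_self f z : dotIm f f z = 0.
Proof. by rewrite dotImE mulrC subrr. Qed.

Lemma Bergman_dotE f g : Bergman_dot Omega f g = (I (dotRe f g) +i* I (dotIm f g))%C.
Proof. by []. Qed.

Lemma Bergman_dot_self f : Bergman_dot Omega f f = (N f)%:C%C.
Proof.
rewrite Bergman_dotE; congr (_ +i* _)%C.
  by apply: eq_Rintegral => z _; exact: dotRe_self.
rewrite (@eq_Rintegral _ _ _ _ _ (fun=> 0)); last by move=> z _; exact: dotIm_self.
by rewrite Rintegral_cst// mul0r.
Qed.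

Lemma Bergman_dotC f g : berg f -> berg g ->
  Bergman_dot Omega g f = (Bergman_dot Omega f g)^*.
Proof.
move=> bf bg; have [i1 i2] := int_dot oO bf bg.
rewrite !Bergman_dotE -[RHS]complex_ext cRe_conj cIm_conj /=; congr (_ +i* _)%C.
  apply: eq_Rintegral => z _; rewrite -[LHS]/(dotRe g f z) -[RHS]/(dotRe f g z).
  by rewrite !dotReE; ring.
rewrite -mulN1r -RintegralZl//.
apply: eq_Rintegral => z _; rewrite -[LHS]/(dotIm g f z) -[RHS]/(-1 * dotIm f g z).
by rewrite !dotImE; ring.
Qed.

Lemma Bergman_dot_lin f g (u : Cn -> C) (t : C) : berg f -> berg g -> berg u ->
  Bergman_dot Omega (fun z => f z + t * g z) u =
  Bergman_dot Omega f u + t * Bergman_dot Omega g u.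
Proof.
move=> bf bg bu; have [i1 i2] := int_dot oO bf bu; have [i3 i4] := int_dot oO bg bu.
rewrite !Bergman_dotE -[RHS]complex_ext cReD cImD cReM cImM /=.
congr (_ +i* _)%C.
  rewrite -!(RintegralZl _ mO)// -RintegralB//; [|exact: intZ..].
  rewrite -RintegralD//; last first.
    by have := integrableB mO (intZ oO (complex.Re t) i3) (intZ oO (complex.Im t) i4).
  apply: eq_Rintegral => z _; rewrite -[LHS]/(dotRe (fun z => f z + t * g z) u z).
  rewrite -/(dotRe f u z) -/(dotRe g u z) -/(dotIm g u z) !dotReE !dotImE cReD cImD cReM cImM; ring.
rewrite -!(RintegralZl _ mO)// -RintegralD//; [|exact: intZ..].
rewrite -RintegralD//; last by apply: intD => //; exact: intZ.
apply: eq_Rintegral => z _; rewrite -[LHS]/(dotIm (fun z => f z + t * g z) u z).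
rewrite -/(dotRe g u z) -/(dotIm f u z) -/(dotIm g u z) !dotReE !dotImE cReD cImD cReM cImM; ring.
Qed.

(* Bessel's inequality, from [0 <= |f - (<f,g>/|g|^2) g|^2]. *)
Lemma Bergman_cauchy_schwarz f g : berg f -> berg g ->
  nc (Bergman_dot Omega f g) ^+ 2 <= N f * N g.
Proof.
move=> bf bg; set d := Bergman_dot Omega f g.
have main (s : R) : 0 <= N f - 2 * s * nc d ^+ 2 + s ^+ 2 * nc d ^+ 2 * N g.
  have [_ E] := nrm2_lin oO (- s%:C%C * d) bf bg.
  have := nrm2_ge0 Omega (fun z => f z + - s%:C%C * d * g z); rewrite E ncM ncN nc_real.
  rewrite exprMn real_normK ?num_real// cReM cImM cReN cImN /= oppr0 !mul0r subr0 addr0.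
  rewrite [nc d ^+ 2]nc_sqr /d Bergman_dotE /=.
  by congr (0 <= _); ring.
have dd := sqr_ge0 (nc d); have Nf := nrm2_ge0 Omega f; have Ng := nrm2_ge0 Omega g.
have [g0|g0] := eqVneq (N g) 0.
  rewrite g0 mulr0; have [->//|d0] := eqVneq (nc d ^+ 2) 0.
  have dp : 0 < nc d ^+ 2 by rewrite lt_neqAle eq_sym d0.
  have := main ((N f + 1) / 2 / nc d ^+ 2); rewrite g0 mulr0 addr0.
  move: (nc d ^+ 2) dp => x xp.
  have -> : 2 * ((N f + 1) / 2 / x) * x = N f + 1 by field; rewrite gt_eqF.
  by rewrite opprD addrA subrr sub0r lerNr oppr0 ler10.
have gp : 0 < N g by rewrite lt_neqAle eq_sym g0.
have := main (N g)^-1.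
have -> : N f - 2 * (N g)^-1 * nc d ^+ 2 + (N g)^-1 ^+ 2 * nc d ^+ 2 * N g =
  N f - nc d ^+ 2 / N g by field; rewrite gt_eqF.
by rewrite subr_ge0 ler_pdivrMr.
Qed.

(** The element [f0] of least norm with [f0 a = 1] is orthogonal to the functions vanishing at [a].
    Writing [h = (h - h a * f0) + h a * f0] gives [<h, f0> = h a * |f0|^2], so [f0 / |f0|^2] is the
    kernel. *)
Lemma Bergman_kernel_exists a : Omega a -> exists k, reproducing_at Omega a k.
Proof.
move=> Oa; pose P (M : nat) f := berg f /\ f a = 1.
have b1 : berg (fun=> 1).
  by apply: (@berg_bounded _ _ _ oO O0 bO _ 1); [exact: holo_cst|move=> z _; rewrite nc1].
have [|//|||//|F [FP Fmin FC]] := @near_minimizers R _ P N (fun f g => N (dif f g))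
  (@mid R n) (N (fun=> 1)).
- by move=> M; exists (fun=> 1).
- by move=> M f _; exact: nrm2_ge0.
- move=> M f g [bf fa] [bg ga]; split; first exact: berg_mid.
  by rewrite /mid fa ga mul1r mulVf// (pnatr_eq0 C 2).
- by move=> M f g [bf _] [bg _]; exact: nrm2_dif.
have Fc k : N (F k) <= N (fun=> 1) + 1.
  have P1 : P k (fun=> 1) by [].
  by rewrite (le_trans (Fmin k _ P1))// lerD2l invf_le1// ler1n.
have [f0 [bf0 Ff0 Nf0]] := berg_limit (fun k => (FP k).1) Fc FC.
have f0a : f0 a = 1.
  apply: (cvC_uniq (Ff0 a Oa)); rewrite (_ : F^~ a = fun=> 1); first exact: cvC_cst.
  by apply/funext => k; case: (FP k).
have f0min g : berg g -> g a = 1 -> N f0 <= N g.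
  move=> bg ga; apply/ler_addgt0Pr => e e0.
  have := near_infty_natSinv_lt (PosNum e0) => -[K _ hK].
  apply: (Nf0 _ K) => k Kk; rewrite (le_trans (Fmin k g (conj bg ga)))// lerD2l.
  exact: ltW (hK k Kk).
have N0 : 0 < N f0.
  have [r [A [r0 A0 _ rA]]] := berg_bound oO O0 bO Oa.
  have := rA _ bf0 0; rewrite mxn0 addr0 f0a nc1 expr1n => /(_ r0) h.
  rewrite lt_neqAle nrm2_ge0 andbT; apply/eqP => N00; move: h.
  by rewrite -N00 mulr0 ler10.
(* The perturbation [f0 - s d g] keeps the value 1 at [a], so minimality makes a quadratic
   expression in [s] nonnegative; at [s = 1 / (N g + 1)] it is negative unless [d = 0]. *)
have orth g : berg g -> g a = 0 -> Bergman_dot Omega f0 g = 0.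
  move=> bg ga; set d := Bergman_dot Omega f0 g.
  have main (s : R) : 0 <= - 2 * s * nc d ^+ 2 + s ^+ 2 * nc d ^+ 2 * N g.
    have [bfg E] := nrm2_lin oO (- s%:C%C * d) bf0 bg.
    have := f0min _ bfg; rewrite f0a ga mulr0 addr0 => /(_ erefl).
    rewrite E ncM ncN nc_real.
    rewrite exprMn real_normK ?num_real// cReM cImM cReN cImN /= oppr0 !mul0r subr0 addr0.
    rewrite [nc d ^+ 2]nc_sqr /d Bergman_dotE /= -addrA lerDl.
    by congr (0 <= _); ring.
  apply/eqP; rewrite -nc_eq0 -sqrf_eq0 eq_le sqr_ge0 andbT.
  have Ng := nrm2_ge0 Omega g; have dd := sqr_ge0 (nc d).
  have G1 : 0 < N g + 1 by rewrite ltr_wpDl.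
  have := main (N g + 1)^-1.
  have -> : - 2 * (N g + 1)^-1 * nc d ^+ 2 + (N g + 1)^-1 ^+ 2 * nc d ^+ 2 * N g =
    - (nc d ^+ 2 * (N g + 2) / (N g + 1) ^+ 2) by field; rewrite gt_eqF.
  rewrite lerNr oppr0 ler_pdivrMr ?exprn_gt0// mul0r pmulr_lle0//.
  by rewrite ltr_wpDl.
exists (fun z => (N f0)^-1%:C%C * f0 z); split.
  by apply/BergmanP; exact: (nrm2_scale oO _ bf0).1.
move=> h /BergmanP bh.
have bk := (nrm2_scale oO (N f0)^-1%:C%C bf0).1.
have [bg _] := nrm2_lin oO (- h a) bh bf0.
have ga : h a + - h a * f0 a = 0 by rewrite f0a mulr1 subrr.
have hE : h = fun z => (h z + - h a * f0 z) + h a * f0 z.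
  by apply/funext => z; ring.
have d1 : Bergman_dot Omega h f0 = h a * (N f0)%:C%C.
  rewrite {1}hE (Bergman_dot_lin (h a) bg bf0 bf0) Bergman_dot_self.
  by rewrite (Bergman_dotC bf0 bg) (orth _ bg ga) conjC0 add0r.
have d2 : Bergman_dot Omega h (fun z => (N f0)^-1%:C%C * f0 z) =
    (N f0)^-1%:C%C * Bergman_dot Omega h f0.
  rewrite (Bergman_dotC bk bh).
  have -> : (fun z => (N f0)^-1%:C%C * f0 z) = (fun z => (0 : C) + (N f0)^-1%:C%C * f0 z).
    by apply/funext => z; rewrite add0r.
  have b0 : berg (fun=> 0).
    by apply: (@berg_bounded _ _ _ oO O0 bO _ 1); [exact: holo_cst|move=> z _; rewrite nc0].
  rewrite (Bergman_dot_lin _ b0 bf0 bh) (Bergman_dotC bh bf0).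
  have -> : Bergman_dot Omega (fun=> 0) h = 0.
    have := Bergman_cauchy_schwarz b0 bh.
    have -> : N (fun=> 0) = 0.
      rewrite /nrm2 (@eq_Rintegral _ _ _ _ _ (fun=> 0)); last first.
        by move=> z _; rewrite nc0 expr0n.
      by rewrite Rintegral_cst// mul0r.
    rewrite mul0r => d0; apply/eqP; rewrite -nc_eq0 -sqrf_eq0 eq_le d0 sqr_ge0 //.
  rewrite add0r rmorphM/= conjCK; congr (_ * _).
  by rewrite -[LHS]complex_ext cRe_conj cIm_conj /= oppr0.
rewrite d2 d1 mulrCA -rmorphM mulVf ?mulr1// gt_eqF//.
Qed.

Lemma Bergman_kernelP a : Omega a -> reproducing_at Omega a (Bergman_kernel Omega a).
Proof. by move=> /Bergman_kernel_exists[k hk]; exact: (xgetPex _ (ex_intro _ k hk)). Qed.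

End bergman_kernel.

(** * Normalized kernels and evaluation at a point *)

Section point_evaluation.
Context {R : realType} {n : nat} (Omega : set 'rV[R[i]]_n).
Local Notation C := R[i].
Local Notation Cn := 'rV[C]_n.
Implicit Types (f g : Cn -> C) (z a : Cn).
Context (oO : open Omega) (O0 : Omega !=set0) (bO : bounded_set Omega).
Local Notation mu := (normalized_lebesgue Omega).
Local Notation N := (nrm2 Omega).
Local Notation ker := (Bergman_kernel Omega).

Let mO : measurable Omega := open_Cn_measurable oO.

Lemma kernel_berg a : Omega a -> berg Omega (ker a).
Proof. by move=> /(Bergman_kernelP oO O0 bO)[/(BergmanP)]. Qed.

Lemma kernel_dot a f : Omega a -> berg Omega f -> f a = Bergman_dot Omega f (ker a).
Proof. by move=> /(Bergman_kernelP oO O0 bO)[_ h] /BergmanP; exact: h. Qed.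

Lemma kernel_diag a : Omega a -> ker a a = (N (ker a))%:C%C.
Proof.
by move=> Oa; rewrite (kernel_dot Oa (kernel_berg Oa)) Bergman_dot_self.
Qed.

(** The reproducing property of the constant 1 and Cauchy-Schwarz give [1 <= N 1 * N (ker a)]. *)
Lemma kernel_nrm2_gt0 a : Omega a -> 0 < N (ker a).
Proof.
move=> Oa; have b1 : berg Omega (fun=> 1).
  by apply: (@berg_bounded _ _ _ oO O0 bO _ 1); [exact: holo_cst|move=> z _; rewrite nc1].
have := Bergman_cauchy_schwarz oO b1 (kernel_berg Oa).
rewrite -(kernel_dot Oa b1) nc1 expr1n => h.
rewrite lt_neqAle nrm2_ge0 andbT; apply/eqP => k0; move: h.
by rewrite -k0 mulr0 ler10.
Qed.

Lemma nc_normalized_kernel a z : Omega a ->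
  nc (normalized_kernel Omega a z) ^+ 2 = nc (ker a z) ^+ 2 / N (ker a).
Proof.
move=> Oa; rewrite /normalized_kernel ncM ncV exprMn exprVn -[nc (sqrtC _) ^+ 2]ncX.
have -> : sqrtC (ker a a) ^+ 2 = ker a a by rewrite sqrtCK.
by rewrite (kernel_diag Oa) nc_real ger0_norm// nrm2_ge0.
Qed.

Lemma measurable_normalized_kernel a : Omega a ->
  measurable_fun Omega (fun z => nc (normalized_kernel Omega a z) ^+ 2).
Proof.
move=> Oa; rewrite (_ : (fun z => _) = fun z => nc (ker a z) ^+ 2 / N (ker a)); last first.
  by apply/funext => z; exact: nc_normalized_kernel.
apply: measurable_funM => //.
by apply/measurable_EFinP; exact: holo_measurable_sqr oO (kernel_berg Oa).1.
Qed.

Lemma integral_normalized_kernel a : Omega a ->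
  (\int[mu]_(z in Omega) (nc (normalized_kernel Omega a z) ^+ 2)%:E = 1)%E.
Proof.
move=> Oa; have N0 := kernel_nrm2_gt0 Oa.
rewrite (eq_integral (fun z => ((N (ker a))^-1)%:E * (nc (ker a z) ^+ 2)%:E)%E); last first.
  by move=> z _; rewrite nc_normalized_kernel// -EFinM mulrC.
rewrite ge0_integralZl//.
- rewrite -[X in (_ * X)%E]/(sqn Omega (ker a)) (sqnE (kernel_berg Oa)) -EFinM.
  by rewrite mulVf// gt_eqF.
- exact: holo_measurable_sqr oO (kernel_berg Oa).1.
- by move=> z _; rewrite lee_fin sqr_ge0.
- by rewrite lee_fin invr_ge0 ltW.
Qed.

(* Apply the reproducing property and Cauchy-Schwarz to [f * k_a]. *)
Lemma evaluation_bound a f (D : R) : Omega a -> holo Omega f ->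
  (weighted_sqnorm Omega (fun z => nc (normalized_kernel Omega a z) ^+ 2)%R f <= D%:E)%E ->
  nc (f a) ^+ 2 <= D.
Proof.
move=> Oa hf fD; have N0 := kernel_nrm2_gt0 Oa; have bk := kernel_berg Oa.
pose F z := f z * ker a z.
have hF : holo Omega F by exact: holoM hf bk.1.
have E : sqn Omega F = ((N (ker a))%:E *
    weighted_sqnorm Omega (fun z => nc (normalized_kernel Omega a z) ^+ 2)%R f)%E.
  rewrite /weighted_sqnorm -ge0_integralZl//.
  - apply: eq_integral => z _; rewrite nc_normalized_kernel// -EFinM; congr EFin.
    rewrite /F ncM exprMn; move: (N _) N0 => x x0; by field; rewrite gt_eqF.
  - apply/measurable_EFinP; apply: measurable_funM; last exact: measurable_normalized_kernel.
    by apply/measurable_EFinP; exact: holo_measurable_sqr.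
  - by move=> z _; rewrite lee_fin mulr_ge0// sqr_ge0.
  - by rewrite lee_fin ltW.
have FD : (sqn Omega F <= (N (ker a) * D)%:E)%E.
  by rewrite E EFinM lee_pmul2l// lte_fin.
have bF : berg Omega F by split=> //; apply: le_lt_trans FD _; exact: ltry.
have := Bergman_cauchy_schwarz oO bF bk; rewrite -(kernel_dot Oa bF).
move: FD; rewrite (sqnE bF) lee_fin {2}/F (kernel_diag Oa) ncM nc_real exprMn.
rewrite real_normK ?num_real//.
(* With [x = N (ker a)], the value of [F] at [a] is [f a * x], so Cauchy-Schwarz reads
   [|f a|^2 x^2 <= (x D) x], and [x^2] cancels. *)
move: (N _) N0 (nc (f a) ^+ 2) (N F) => x x0 y w h1 h2.
have h3 : y * x ^+ 2 <= D * x ^+ 2.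
  by rewrite (le_trans h2)// expr2 mulrA ler_wpM2r ?(ltW x0)// mulrC.
by rewrite -(ler_pM2r (exprn_gt0 2 x0)).
Qed.

End point_evaluation.

(** * Convex combinations of the weights *)

Section convex_weights.
Context {R : realType} {n : nat} (Omega : set 'rV[R[i]]_n).
Local Notation C := R[i].
Local Notation Cn := 'rV[C]_n.
Implicit Types (f g : Cn -> C) (z : Cn).
Context (oO : open Omega) (O0 : Omega !=set0) (bO : bounded_set Omega).
Local Notation mu := (normalized_lebesgue Omega).
Context {M : nat} (a : 'I_M -> Cn) (aO : forall m, Omega (a m)).
Local Notation wsq := (weighted_sqnorm Omega).

Let mO : measurable Omega := open_Cn_measurable oO.

(** Index 0 carries the constant weight and the others the kernels, so that a convex weight is a
    single sum over ['I_M.+1], the index type of [theta]. *)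
Definition wt (i : 'I_M.+1) z : R :=
  if unlift ord0 i is Some m then nc (normalized_kernel Omega (a m) z) ^+ 2 else 1.

Lemma wt0 z : wt ord0 z = 1.
Proof. by rewrite /wt unlift_none. Qed.

Lemma wt_lift m z : wt (lift ord0 m) z = nc (normalized_kernel Omega (a m) z) ^+ 2.
Proof. by rewrite /wt liftK. Qed.

Lemma wt_ge0 i z : 0 <= wt i z.
Proof. by rewrite /wt; case: unlift => // m; exact: sqr_ge0. Qed.

Lemma measurable_wt i : measurable_fun Omega (wt i).
Proof.
by rewrite /wt; case: unlift => // m; exact: (measurable_normalized_kernel oO O0 bO).
Qed.

Lemma integral_wt i : (\int[mu]_(z in Omega) (wt i z)%:E = 1)%E.
Proof.
rewrite /wt; case: unlift => [m|]; first exact: (integral_normalized_kernel oO O0 bO).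
by rewrite integral_cst// mul1e; exact: mu_Omega.
Qed.

Lemma convex_weightE theta z : convex_weight Omega a theta z = \sum_i theta i * wt i z.
Proof.
rewrite big_ord_recl wt0 mulr1; congr (_ + _).
by apply: eq_bigr => m _; rewrite wt_lift.
Qed.

Lemma measurable_sqr_wt f i : holo Omega f ->
  measurable_fun Omega (fun z => (nc (f z) ^+ 2 * wt i z)%:E).
Proof.
move=> hf; apply/measurable_EFinP; apply: measurable_funM; last exact: measurable_wt.
by apply/measurable_EFinP; exact: holo_measurable_sqr.
Qed.

Lemma sqr_wt_ge0 f i z : 0 <= nc (f z) ^+ 2 * wt i z.
Proof. by rewrite mulr_ge0 ?sqr_ge0 ?wt_ge0. Qed.

Lemma wsq_wt_ge0 f i : (0 <= wsq (wt i) f)%E.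
Proof. by apply: integral_ge0 => z _; rewrite lee_fin sqr_wt_ge0. Qed.

Lemma wsq_convex_weight theta f : (forall i, 0 <= theta i) -> holo Omega f ->
  (wsq (convex_weight Omega a theta) f = \sum_i (theta i)%:E * wsq (wt i) f)%E.
Proof.
move=> th0 hf; rewrite /weighted_sqnorm.
rewrite (eq_integral (fun z => \sum_i (theta i)%:E * (nc (f z) ^+ 2 * wt i z)%:E))%E; last first.
  move=> z _; rewrite convex_weightE mulr_sumr -sumEFin; apply: eq_bigr => i _.
  by rewrite -EFinM mulrCA.
rewrite ge0_integral_sum//.
- apply: eq_bigr => i _; rewrite ge0_integralZl//; first exact: measurable_sqr_wt.
    by move=> z _; rewrite lee_fin sqr_wt_ge0.
  by rewrite lee_fin.
- by move=> i; apply: measurable_funeM; exact: measurable_sqr_wt.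
- by move=> i z _; rewrite mule_ge0// lee_fin ?sqr_wt_ge0.
Qed.

Lemma sum_wsq_convex_weight theta L (f : 'I_L -> Cn -> C) : (forall i, 0 <= theta i) ->
  (forall l, holo Omega (f l)) ->
  (\sum_(l < L) wsq (convex_weight Omega a theta) (f l) =
   \sum_i (theta i)%:E * \sum_(l < L) wsq (wt i) (f l))%E.
Proof.
move=> th0 hf; under eq_bigr do rewrite wsq_convex_weight//.
rewrite exchange_big/=; apply: eq_bigr => i _.
by rewrite ge0_sume_distrr// => l _; exact: wsq_wt_ge0.
Qed.

(** Every weight has total mass 1, so a bounded solution has weighted norms controlled independently
    of the points and of the weights. *)
Lemma wsq_wt_bounded i f (B : R) : 0 <= B -> holo Omega f ->
  (forall z, Omega z -> nc (f z) ^+ 2 <= B) -> (wsq (wt i) f <= B%:E)%E.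
Proof.
move=> B0 hf fB; have -> : (B%:E = \int[mu]_(z in Omega) (B%:E * (wt i z)%:E))%E.
  rewrite ge0_integralZl//; first by rewrite integral_wt mule1.
  - apply/measurable_EFinP; exact: measurable_wt.
  - by move=> z _; rewrite lee_fin wt_ge0.
apply: ge0_le_integral => //.
- by move=> z _; rewrite lee_fin sqr_wt_ge0.
- exact: measurable_sqr_wt.
- by apply: measurable_funeM; apply/measurable_EFinP; exact: measurable_wt.
- by move=> z Oz; rewrite -EFinM lee_fin ler_wpM2r ?wt_ge0 ?fB.
Qed.

Lemma nc_sqr_convex (t : R) (v w : C) : 0 <= t <= 1 ->
  nc ((1 - t)%:C%C * v + t%:C%C * w) ^+ 2 <= (1 - t) * nc v ^+ 2 + t * nc w ^+ 2.
Proof.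
move=> /andP[t0 t1].
have h1 : nc ((1 - t)%:C%C * v + t%:C%C * w) <= (1 - t) * nc v + t * nc w.
  by rewrite (le_trans (ncD _ _))// !ncM !nc_real !ger0_norm ?subr_ge0.
have h2 : 0 <= (1 - t) * nc v + t * nc w by exact: le_trans (nc_ge0 _) h1.
apply: (@le_trans _ _ (((1 - t) * nc v + t * nc w) ^+ 2)).
  by rewrite ler_sqr ?nnegrE ?nc_ge0.
rewrite -subr_ge0; have -> : (1 - t) * nc v ^+ 2 + t * nc w ^+ 2 -
  ((1 - t) * nc v + t * nc w) ^+ 2 = t * (1 - t) * (nc v - nc w) ^+ 2 by ring.
by rewrite mulr_ge0 ?sqr_ge0// mulr_ge0// subr_ge0.
Qed.

Lemma wsq_wt_convex i f g (t : R) : 0 <= t <= 1 -> holo Omega f -> holo Omega g ->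
  (wsq (wt i) (fun z => (1 - t)%:C%C * f z + t%:C%C * g z)%R <=
   (1 - t)%R%:E * wsq (wt i) f + t%:E * wsq (wt i) g)%E.
Proof.
move=> t01 hf hg; have /andP[t0 t1] := t01; have t1' : 0 <= 1 - t by rewrite subr_ge0.
rewrite /weighted_sqnorm -!ge0_integralZl//; try exact: measurable_sqr_wt;
  try by move=> z _; rewrite lee_fin sqr_wt_ge0.
have hh : holo Omega (fun z => (1 - t)%:C%C * f z + t%:C%C * g z).
  by apply: holo_lin => //; apply: holoM => //; exact: holo_cst.
rewrite -ge0_integralD//.
- apply: ge0_le_integral => //.
  + by move=> z _; rewrite lee_fin mulr_ge0 ?sqr_ge0 ?wt_ge0.
  + exact: (measurable_sqr_wt i hh).
  + by apply: emeasurable_funD; apply: measurable_funeM; exact: measurable_sqr_wt.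
  + move=> z _; rewrite -!EFinM -EFinD lee_fin.
    rewrite [leRHS](_ : _ = ((1 - t) * nc (f z) ^+ 2 + t * nc (g z) ^+ 2) * wt i z).
      by rewrite ler_wpM2r ?wt_ge0// nc_sqr_convex.
    by ring.
- by move=> z _; rewrite mule_ge0// lee_fin sqr_wt_ge0.
- by apply: measurable_funeM; exact: measurable_sqr_wt.
- by move=> z _; rewrite mule_ge0// lee_fin sqr_wt_ge0.
- by apply: measurable_funeM; exact: measurable_sqr_wt.
Qed.

End convex_weights.

(** * Solutions of the corona equation: uniform bounds and passage to the limit *)

Section corona.
Context {R : realType} {n : nat} (Omega : set 'rV[R[i]]_n).
Local Notation C := R[i].
Local Notation Cn := 'rV[C]_n.
Implicit Types (z : Cn).
Context (oO : open Omega) (O0 : Omega !=set0) (bO : bounded_set Omega).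
Local Notation N := (nrm2 Omega).
Local Notation wsq := (weighted_sqnorm Omega).

Lemma rational_approximation (x e : R) : 0 < e -> exists q : rat, `|ratr q - x| <= e.
Proof.
move=> e0; have /rat_in_itvoo[q] : x - e < x + e by lra.
rewrite in_itv/= => /andP[q1 q2]; exists q; rewrite ler_norml; lra.
Qed.

Lemma dense_sequence : exists a : nat -> Cn, (forall m, Omega (a m)) /\
  forall z (e : R), Omega z -> 0 < e -> exists m, mxn (a m - z) < e.
Proof.
have [z0 Oz0] := O0.
pose pt (v : 'rV[rat * rat]_n) : Cn := \row_j (ratr (v 0 j).1 +i* ratr (v 0 j).2)%C.
(* Decoding the integers enumerates the points with rational coordinates; an integer that encodes no
   point of [Omega] is sent to [z0]. *)
pose a m : Cn := if unpickle m is Some v then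
  (if `[< Omega (pt v) >] then pt v else z0) else z0.
exists a; split.
  by move=> m; rewrite /a; case: unpickle => // v; case: asboolP.
move=> z e Oz e0; have [r r0 rP] := open_mxn oO Oz.
pose d := Num.min e r / 4.
have d0 : 0 < d by rewrite divr_gt0// lt_min e0.
have ex j : exists q : rat * rat,
    `|ratr q.1 - complex.Re (z 0 j)| <= d /\ `|ratr q.2 - complex.Im (z 0 j)| <= d.
  have [q1 h1] := rational_approximation (complex.Re (z 0 j)) d0.
  have [q2 h2] := rational_approximation (complex.Im (z 0 j)) d0.
  by exists (q1, q2).
have [q qP] := choice ex.
pose v : 'rV[rat * rat]_n := \row_j q j.
have vz : mxn (pt v - z) < Num.min e r.
  have m0 : 0 < Num.min e r by rewrite lt_min e0.
  apply: (@le_lt_trans _ _ (d + d)); last by rewrite /d; lra.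
  apply: mxn_le => [|j]; first by rewrite addr_ge0// ltW.
  have [h1 h2] := qP j; rewrite (le_trans (nc_le_ReIm _))// !mxE cReD cReN cImD cImN/=.
  exact: lerD.
have [ve vr] : mxn (pt v - z) < e /\ mxn (pt v - z) < r.
  by move: vz; rewrite lt_min => /andP[].
have Ov : Omega (pt v) by rewrite -(subrKC z (pt v)); exact: rP.
by exists (pickle v); rewrite /a pickleK; case: asboolP.
Qed.

Context {L : nat} (phi : 'I_L -> Cn -> C).

Definition solution (f : 'I_L -> Cn -> C) :=
  (forall l, berg Omega (f l)) /\ forall z, Omega z -> \sum_(l < L) phi l z * f l z = 1.

Lemma solution_convex (s t : C) f g : s + t = 1 -> solution f -> solution g ->
  solution (fun l z => s * f l z + t * g l z).
Proof.
move=> st [bf hf] [bg hg]; split=> [l|z Oz].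
  exact: (nrm2_lin oO t (nrm2_scale oO s (bf l)).1 (bg l)).1.
rewrite -st -[s in RHS]mulr1 -[t in RHS]mulr1 -{1}(hf z Oz) -(hg z Oz) !mulr_sumr -big_split/=.
by apply: eq_bigr => l _; ring.
Qed.

Lemma convex_poisson_uniform (C0 : R) (M : nat) (a : 'I_M -> Cn) :
  (forall m, Omega (a m)) ->
  (forall theta : 'I_M.+1 -> R, (forall m, 0 <= theta m <= 1) -> \sum_m theta m = 1 ->
    exists f : 'I_L -> Cn -> C, [/\ forall l, Bergman Omega (f l),
      (\sum_(l < L) wsq (convex_weight Omega a theta) (f l) <= (C0 ^+ 2)%:E)%E &
      forall z, Omega z -> \sum_(l < L) phi l z * f l z = 1]) ->
  exists f, solution f /\
    forall i, (\sum_(l < L) wsq (wt Omega a i) (f l) <= (2 * C0 ^+ 2 + 1)%:E)%E.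
Proof.
move=> aO hC0.
(* [W] consists of the vectors that dominate the norms of a solution, not of the vectors of norms
   themselves: squared norms are convex and not affine, and domination is what convex combinations
   preserve. *)
pose W (w : 'I_M.+1 -> R) := exists f, solution f /\
  forall i, (\sum_(l < L) wsq (wt Omega a i) (f l) <= (w i)%:E)%E.
have [||||w [f [sf fw]] wb] := @minimax_bound R M W (C0 ^+ 2).
- exact: sqr_ge0.
- move=> w i [f [_ /(_ i)]]; rewrite -lee_fin; apply: le_trans.
  by apply: sume_ge0 => l _; exact: wsq_wt_ge0.
- move=> u w t t01 [f [sf fu]] [g [sg gw]]; have /andP[t0 t1] := t01.
  exists (fun l z => (1 - t)%:C%C * f l z + t%:C%C * g l z); split.
    by apply: solution_convex => //; rewrite -rmorphD/= subrK.
  move=> i; apply: (@le_trans _ _ (\sum_(l < L) ((1 - t)%R%:E * wsq (wt Omega a i) (f l) +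
      t%:E * wsq (wt Omega a i) (g l)))%E).
    apply: lee_sum => l _.
    by apply: (wsq_wt_convex oO O0 bO) => //; [exact: (sf.1 l).1|exact: (sg.1 l).1].
  rewrite big_split/= -!ge0_sume_distrr//; try by move=> l _; exact: wsq_wt_ge0.
  have -> : (((1 - t) * u i + t * w i)%R%:E = (1 - t)%R%:E * (u i)%:E + t%:E * (w i)%:E)%E.
    by rewrite -!EFinM -EFinD.
  apply: leeD; apply: lee_wpmul2l => //.
  by rewrite lee_fin subr_ge0.
- move=> theta th0 th1.
  have th01 m : 0 <= theta m <= 1.
    rewrite (ltW (th0 m)) -th1 (bigD1 m)//= lerDl.
    by apply: sumr_ge0 => i _; exact: ltW.
  have [f [Bf fC hf]] := hC0 theta th01 th1.
  have bf l : berg Omega (f l) by exact/BergmanP.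
  pose v i := (\sum_(l < L) wsq (wt Omega a i) (f l))%E.
  have v0 i : (0 <= v i)%E by apply: sume_ge0 => l _; exact: wsq_wt_ge0.
  have vC : (\sum_i (theta i)%:E * v i <= (C0 ^+ 2)%:E)%E.
    rewrite -(sum_wsq_convex_weight oO O0 bO aO)// => [i|l]; first exact: ltW.
    exact: (bf l).1.
  have tv0 i : (0 <= (theta i)%:E * v i)%E by rewrite mule_ge0// lee_fin ltW.
  (* Here strict positivity of the weights acts: an infinite norm with coefficient [theta i > 0]
     would make the total infinite. *)
  have vfin i : v i \is a fin_num.
    rewrite ge0_fin_numE// ltey; apply/eqP => voo; move: vC.
    rewrite (bigD1 i)//= voo gt0_muley ?lte_fin//.
    rewrite addye ?leye_eq//.
    by rewrite gt_eqF// (lt_le_trans (ltNyr 0))//; apply: sume_ge0.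
  exists (fun i => fine (v i)).
    by exists f; split=> // i; rewrite fineK.
  rewrite -lee_fin -sumEFin; apply: le_trans vC; apply: lee_sum => i _.
  by rewrite EFinM fineK.
exists f; split=> // i; apply: (le_trans (fw i)); rewrite lee_fin; exact: wb.
Qed.

Lemma cvC_sum (u : 'I_L -> nat -> C) (l : 'I_L -> C) :
  (forall i, cvC (u i) (l i)) -> cvC (fun k => \sum_i u i k) (\sum_i l i).
Proof.
move=> ul; have H (r : seq 'I_L) : cvC (fun k => \sum_(i <- r) u i k) (\sum_(i <- r) l i).
  elim: r => [|i r IH].
    rewrite big_nil (_ : (fun k => _) = fun=> 0); first exact: cvC_cst.
    by apply/funext => k; rewrite big_nil.
  rewrite big_cons (_ : (fun k => _) = fun k => u i k + \sum_(j <- r) u j k).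
    exact: cvCD.
  by apply/funext => k; rewrite big_cons.
exact: H.
Qed.

Lemma sqr_le_nc (v : C) (D : R) : 0 <= D -> (nc v ^+ 2 <= D) = (nc v <= Num.sqrt D).
Proof.
by move=> D0; rewrite -{1}(sqr_sqrtr D0) ler_sqr ?nnegrE ?nc_ge0 ?sqrtr_ge0.
Qed.

Lemma solution_limit (a : nat -> Cn) (D : R) : 0 <= D -> (forall m, Omega (a m)) ->
  (forall M : nat, exists f, [/\ solution f, \sum_(l < L) N (f l) <= D &
     forall m l, (m < M)%N -> nc (f l (a m)) ^+ 2 <= D]) ->
  exists f, solution f /\ forall m l, nc (f l (a m)) ^+ 2 <= D.
Proof.
move=> D0 aO hM.
pose P (M : nat) f := solution f /\ forall m l, (m < M)%N -> nc (f l (a m)) ^+ 2 <= D.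
(* The minimization takes place in the L-fold power of A^2, with the sum of the squared norms of the
   components, so that one sequence serves all components at once. *)
pose S (f : 'I_L -> Cn -> C) := \sum_(l < L) N (f l).
pose Df (f g : 'I_L -> Cn -> C) := \sum_(l < L) N (dif (f l) (g l)).
pose md (f g : 'I_L -> Cn -> C) l := mid (f l) (g l).
have midE f g : md f g = fun l z => 2^-1 * f l z + 2^-1 * g l z.
  by apply/funext => l; apply/funext => z; rewrite /md /mid mul1r mulrDr.
have [|||||F [FP Fmin FC]] := @near_minimizers R _ P S Df md D.
- by move=> M; have [f [sf fD fa]] := hM M; exists f.
- by move=> M f [sf fa]; split=> // m l mM; apply: fa; rewrite ltnS ltnW.
- by move=> M f _; apply: sumr_ge0 => l _; exact: nrm2_ge0.
- move=> M f g [sf fa] [sg ga]; split.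
    by rewrite midE; apply: solution_convex => //; rewrite -[X in X + X]mul1r -splitr.
  move=> m l mM; have := fa m l mM; have := ga m l mM; rewrite !sqr_le_nc// => h1 h2.
  rewrite midE (le_trans (ncD _ _))// !ncM ncV nc2.
  by lra.
- move=> M f g [sf _] [sg _]; rewrite /Df /S !mulr_sumr -big_split/= -sumrB.
  by apply: eq_bigr => l _; exact: (nrm2_dif oO (sf.1 l) (sg.1 l)).
have bF k l : berg Omega (F k l) by have [[+ _] _] := FP k; apply.
have leS k l : N (F k l) <= S (F k).
  by rewrite /S (bigD1 l)//= lerDl; apply: sumr_ge0 => j _; exact: nrm2_ge0.
have Fc l k : N (F k l) <= D + 1.
  have [g [sg gD ga]] := hM k; have Pg : P k g by [].
  rewrite (le_trans (leS k l))// (le_trans (Fmin k g Pg))// lerD//.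
  by rewrite invf_le1// ler1n.
have FCl l e : 0 < e -> exists K : nat, forall j k, (K <= j)%N -> (K <= k)%N ->
     N (dif (F j l) (F k l)) <= e.
  move=> e0; have [K hK] := FC e e0; exists K => j k hj hk.
  apply: le_trans (hK j k hj hk); rewrite /Df (bigD1 l)//= lerDl.
  by apply: sumr_ge0 => i _; exact: nrm2_ge0.
have [f fP] := choice (fun l => berg_limit oO O0 bO (fun k => bF k l) (Fc l) (FCl l)).
exists f; split.
  split=> [l|z Oz]; first by have [] := fP l.
  have lim : cvC (fun k => \sum_(l < L) phi l z * F k l z) (\sum_(l < L) phi l z * f l z).
    by apply: (@cvC_sum (fun l k => phi l z * F k l z)) => l; apply: cvCZ;
      have [_ + _] := fP l; apply.
  apply: (cvC_uniq lim); rewrite (_ : (fun k => _) = fun=> 1); first exact: cvC_cst.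
  by apply/funext => k; have [[_ +] _] := FP k; apply.
move=> m l; rewrite sqr_le_nc//.
(* The constraint at [a m] binds [F k] as soon as [k > m], hence also the limit. *)
have [_ fl _] := fP l; apply: (cvC_le (K := m.+1) (fl _ (aO m))) => k mk.
by rewrite -sqr_le_nc//; have [_] := FP k; apply.
Qed.

Lemma solution_dense (a : nat -> Cn) (D : R) f : 0 <= D ->
  (forall z (e : R), Omega z -> 0 < e -> exists m, mxn (a m - z) < e) ->
  solution f -> (forall m l, nc (f l (a m)) ^+ 2 <= D) ->
  forall l z, Omega z -> nc (f l z) ^+ 2 <= D.
Proof.
move=> D0 ad [bf _] fa l z Oz; rewrite sqr_le_nc//.
apply/ler_addgt0Pr => e e0; have [Lz fz] := (bf l).1 z Oz.
have [r r0 rP] := frechet_continuous fz e0; have [m mr] := ad z r Oz r0.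
have := rP _ mr; rewrite subrKC => h; have := fa m l; rewrite sqr_le_nc// => h'.
have -> : f l z = f l (a m) - (f l (a m) - f l z) by rewrite subKr.
by rewrite (le_trans (ncB _ _))// lerD// ltW.
Qed.

End corona.

Theorem corollary36 (R : realType) (n : nat) (hn : (0 < n)%N)
    (Omega : set 'rV[R[i]]_n)
    (Omega_domain : is_domain Omega)
    (Omega_bounded : bounded_set Omega)
    (Omega_spc : strictly_pseudoconvex Omega)
    (Omega_homogeneous : homogeneous Omega)
    (Omega_circular : complete_circular Omega)
    (Omega_smooth : smooth_boundary Omega) :
  corona_property Omega <-> convex_poisson_property Omega.
Proof.
have [nO oO _] := Omega_domain; have bO := Omega_bounded.
split=> hyp L c phi data; have [L0 _ _ _] := data.
  have [C0 [f [C00 fH fC fE]]] := hyp L c phi data.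
  have fb l z : Omega z -> nc (f l z) ^+ 2 <= C0 ^+ 2.
    by move=> Oz; rewrite (le_trans _ (fC z Oz))// le_bigmax.
  have hf l : holo Omega (f l) by apply/holomorphic_holo; case: (fH l).
  have Lge1 : (1 : R) <= L%:R by rewrite ler1n.
  (* Each of the [L] components has squared weighted norm at most [C0^2], and [L C0^2 <= (L C0)^2]
     since [L >= 1]. *)
  exists (L%:R * C0); first by rewrite mulr_gt0// (lt_le_trans ltr01).
  move=> M a theta _ aO th01 th1; exists f; split=> //.
    move=> l; apply/BergmanP; apply: (berg_bounded (B := C0) oO nO bO) => // z Oz.
    by rewrite -ler_sqr ?nnegrE ?nc_ge0 ?(ltW C00)// fb.
  have th0 i : 0 <= theta i by case/andP: (th01 i).
  rewrite (sum_wsq_convex_weight oO nO bO)//.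
  apply: (@le_trans _ _ (\sum_i (theta i * (L%:R * C0 ^+ 2))%:E)%E).
    apply: lee_sum => i _; rewrite EFinM; apply: lee_wpmul2l; first by rewrite lee_fin.
    apply: (@le_trans _ _ (\sum_(l < L) (C0 ^+ 2)%:E)%E).
      apply: lee_sum => l _; apply: wsq_wt_bounded => //; first exact: sqr_ge0.
      exact: fb.
    by rewrite sumEFin lee_fin sumr_const card_ord mulr_natl.
  rewrite sumEFin lee_fin -mulr_suml th1 mul1r exprMn ler_wpM2r ?sqr_ge0//.
  by rewrite expr2 ler_peMl// ler0n.
have [C0 C00 hC0] := hyp L c phi data.
pose D := 2 * C0 ^+ 2 + 1.
have D0 : 0 <= D by rewrite addr_ge0// mulr_ge0// sqr_ge0.
have [a [aO ad]] := dense_sequence oO nO.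
have [|f [sf fa]] := @solution_limit _ _ _ oO nO bO _ phi a D D0 aO.
  (* The Convex Poisson Property asks for at least one point, so [M + 1] points are taken to obtain
     the [M] constraints, the case [M = 0] included. *)
  move=> M; have aO' (m : 'I_M.+1) : Omega (a m) by exact: aO.
  have [f [sf fD]] := convex_poisson_uniform oO nO bO aO'
    (fun theta => hC0 M.+1 (fun m => a m) theta isT aO').
  exists f; split=> //.
    (* The weight of index 0 being the constant 1, its norm is that of A^2. *)
    rewrite -lee_fin -sumEFin; apply: le_trans (fD ord0); apply: lee_sum => l _.
    rewrite -(sqnE (sf.1 l)) /weighted_sqnorm /sqn le_eqVlt; apply/orP; left; apply/eqP.
    by apply: eq_integral => z _; rewrite wt0 mulr1.
  move=> m l mM; have mM' : (m < M.+1)%N by rewrite ltnW.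
  apply: (evaluation_bound oO nO bO (aO m) (sf.1 l).1).
  apply: le_trans (fD (lift ord0 (Ordinal mM'))).
  rewrite (bigD1 l)//= -[X in (X <= _)%E]adde0; apply: leeD; last first.
    by apply: sume_ge0 => i _; exact: wsq_wt_ge0.
  rewrite le_eqVlt; apply/orP; left; apply/eqP.
  by apply: eq_integral => z _; rewrite wt_lift.
have fD := solution_dense D0 ad sf fa.
(* [D + 1] is positive and [D <= (D + 1)^2]. *)
exists (D + 1), f; split.
- by rewrite ltr_wpDl.
- move=> l; split; first by apply/holomorphic_holo; exact: (sf.1 l).1.
  exists (Num.sqrt D) => z Oz; rewrite -sqr_le_nc//; exact: fD.
- move=> z Oz; apply: (@le_trans _ _ D); last by rewrite expr2; nra.
  by apply/bigmax_leP; split=> // l _; exact: fD.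
- exact: sf.2.
Qed.
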